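(* Let $-2<s<0$ and $\beta>0$. For $n\ge1$ let $\mathsf{P}_n^{s,\beta,\mathrm{stat}}$ be the stationarized version of the finite-volume Riesz gas $\mathsf{P}_n^{s,\beta}$ with $n$ particles in $\square_n=[-\frac n2,\frac n2]$. Then the sequence $\{\mathsf{P}_n^{s,\beta,\mathrm{stat}}\}_n$ admits accumulation points for the local topology; that is, there exist a subsequence $(n_k)_k$ and a stationary point process law $\mathsf{P}$ on $\mathbb{R}$ such that $\mathsf{P}_{n_k}^{s,\beta,\mathrm{stat}}\to\mathsf{P}$ locally.
   Context: A configuration is a locally finite integer-valued measure $\xi=\sum_j\delta_{x_j}$ on $\mathbb{R}$ (multiple points allowed); $\Gamma$ is the space of configurations, with the $\sigma$-algebra generated by the maps $\xi\mapsto\xi(A)$, $A$ Borel. A point process is a $\Gamma$-valued random variable, or its law. Translations act by $\theta_x\sum_j\delta_{x_j}=\sum_j\delta_{x_j+x}$; a law $\mathsf{P}$ is stationary if $\mathsf{P}\circ\theta_x^{-1}=\mathsf{P}$ for all $x\in\mathbb{R}$. Finite-volume Riesz gas: let $g_s(x-y)=-|x-y|^{-s}$. For a configuration $\gamma$ of $n$ points in $\square_n$, $$H_n^{(s)}(\gamma)=\frac12\iint_{\square_n\times\square_n}g_s(x-y)\,\nu(dx)\,\nu(dy),\qquad \nu=\gamma-\mathsf{Leb}_{\square_n},$$ and $$\mathsf{P}_n^{s,\beta}(d\gamma)=\frac{1}{Z_n^{(s,\beta)}}e^{-\beta H_n^{(s)}(\gamma)}\,\mathsf{Bin}_{n,\square_n}(d\gamma),\qquad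 Z_n^{(s,\beta)}=\int e^{-\beta H_n^{(s)}(\gamma)}\,\mathsf{Bin}_{n,\square_n}(d\gamma),$$ where $\mathsf{Bin}_{n,\square_n}$ is the law of $\sum_{j=1}^n\delta_{X_j}$ with $X_1,\dots,X_n$ i.i.d. uniform on $\square_n$. Stationarized version: given a point process law $\mathsf{P}_\square$ in a bounded interval $\square$ of length $m$, tile $\mathbb{R}=\bigcup_{k\in m\mathbb{Z}}\theta_k\square$, let $\{\xi_k\}_{k\in m\mathbb{Z}}$ be independent with $\xi_k$ distributed as the translate by $k$ of $\mathsf{P}_\square$, and let $U$ be uniform in $\square$, independent of the $\xi_k$. Then $\mathsf{P}_\square^{\mathrm{stat}}$ is the law of $\sum_{k\in m\mathbb{Z}}\theta_U\xi_k$. Local topology: $\mathsf{P}_n\to\mathsf{P}$ locally iff $\mathbb{E}_{\mathsf{P}_n}[F(\xi)]\to\mathbb{E}_{\mathsf{P}}[F(\xi)]$ for every measurable, local, tame functional $F$ on $\Gamma$. $F$ is local if there is a bounded box $\square$ such that $F(\xi)$ depends only on the restriction $\xi_\square$ of $\xi$ to $\square$; it is tame if moreover $|F(\xi)|\le C(1+\xi(\square))$ for some $C>0$. (This topology is stronger than the weak topology associated with the vague topology on $\Gamma$.) *)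

(* Defs.v *)
From HB Require Import structures.
From mathcomp Require Import all_boot all_order all_algebra.
From mathcomp Require Import all_classical all_reals all_analysis.
From mathcomp Require Import measurable_realfun ring lra.

Set Implicit Arguments.
Unset Strict Implicit.
Unset Printing Implicit Defensive.
Import Order.TTheory GRing.Theory Num.Theory.
Import numFieldNormedType.Exports.

Local Open Scope classical_set_scope.
Local Open Scope ring_scope.

Section configurations.
Context (R : realType).
Local Notation borelR := (measurableTypeR R).

(* A locally finite Borel measure on R is a finite or countable sum of Dirac
   masses iff its finite values are natural numbers. *)
Record config : Type := Config {
  config_measure :> {measure set borelR -> \bar R} ;
  config_locally_finite :
    forall r : R, (config_measure `[(- r)%R, r]%classic < +oo)%E ;
  config_integer_valued : forall A : set borelR, measurable A ->
    (config_measure A < +oo)%E -> exists k : nat, config_measure A = k%:R%:E }.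

Lemma config0_locally_finite (r : R) :
  ((mzero : {measure set borelR -> \bar R}) `[(- r)%R, r]%classic < +oo)%E.
Proof. by rewrite /= /mzero ltry. Qed.

Lemma config0_integer_valued (A : set borelR) : measurable A ->
  ((mzero : {measure set borelR -> \bar R}) A < +oo)%E ->
  exists k : nat, (mzero : {measure set borelR -> \bar R}) A = k%:R%:E.
Proof. by exists 0%N. Qed.

Definition config0 : config :=
  Config config0_locally_finite config0_integer_valued.

HB.instance Definition _ := gen_eqMixin config.
HB.instance Definition _ := gen_choiceMixin config.
HB.instance Definition _ := isPointed.Build config config0.

Definition config_measurable : set_system config :=
  <<s \bigcup_(A in @measurable _ borelR)
        preimage_set_system [set: config] (fun xi : config => xi A : \bar R)
          measurable >>.

Let config_measurable0 : config_measurable set0.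
Proof. exact: sigma_algebra0. Qed.

Let config_measurableC (U : set config) :
  config_measurable U -> config_measurable (~` U).
Proof. exact: sigma_algebraC. Qed.

Let config_measurableU (F : (set config)^nat) :
  (forall i, config_measurable (F i)) -> config_measurable (\bigcup_i F i).
Proof. exact: sigma_algebra_bigcup. Qed.

Definition config_display : measure_display.
Proof. by constructor. Qed.

HB.instance Definition _ :=
  @isMeasurable.Build config_display config config_measurable
    config_measurable0 config_measurableC config_measurableU.

Lemma measurable_config_eval (A : set borelR) : measurable A ->
  measurable_fun [set: config] (fun xi : config => xi A).
Proof.
move=> mA.
apply: (@measurability config_display _ config _ setT
  (fun xi : config => xi A : \bar R) measurable).
  by rewrite smallest_id//; exact: sigma_algebra_measurable.
apply: subset_trans; last exact: sub_gen_smallest.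
exact: (bigcup_sup mA).
Qed.

Lemma measurable_to_config d (T : measurableType d) (f : T -> config) :
  (forall A : set borelR, measurable A ->
     measurable_fun [set: T] (fun t => f t A)) ->
  measurable_fun [set: T] f.
Proof.
move=> mf.
apply: (@measurability _ _ T config setT f
  (\bigcup_(A in @measurable _ borelR)
     preimage_set_system [set: config] (fun xi : config => xi A : \bar R) measurable)).
  by [].
move=> _ [_ [A mA [B mB <-]] <-].
rewrite !setTI.
have := mf A mA measurableT B mB; rewrite setTI.
by [].
Qed.

End configurations.

Section translation.
Context (R : realType).
Local Notation borelR := (measurableTypeR R).

Definition shift_measure (x : R) (mu : {measure set borelR -> \bar R})
  (A : set borelR) : \bar R := mu [set y | A (y + x)].

Lemma measurable_shift (x : R) (A : set borelR) :
  measurable A -> @measurable _ borelR [set y | A (y + x)].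
Proof.
move=> mA.
have mf : measurable_fun [set: borelR] (fun y : borelR => (y + x : borelR)).
  exact: measurable_funD.
by have := mf measurableT A mA; rewrite setTI.
Qed.

Section shift_measure_is_measure.
Variables (x : R) (mu : {measure set borelR -> \bar R}).

Let shift_measure0 : shift_measure x mu set0 = 0%E.
Proof. exact: measure0. Qed.

Let shift_measure_ge0 A : (0 <= shift_measure x mu A)%E.
Proof. exact: measure_ge0. Qed.

Let shift_measure_sigma_additive : semi_sigma_additive (shift_measure x mu).
Proof.
move=> F mF tF mUF.
apply: (@measure_semi_sigma_additive _ _ _ mu (fun n => [set y | F n (y + x)])).
- by move=> n; exact: measurable_shift.
- apply/trivIsetP => i j _ _ ij.
  apply/seteqP; split => // y [/= Fi Fj].
  by move/trivIsetP : tF => /(_ i j I I ij)/seteqP[+ _] => /(_ (y + x)); apply.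
- exact: (measurable_shift x mUF).
Qed.

HB.instance Definition _ := isMeasure.Build _ _ _ (shift_measure x mu)
  shift_measure0 shift_measure_ge0 shift_measure_sigma_additive.

End shift_measure_is_measure.

Variables (x : R) (xi : config R).

Lemma translate_locally_finite (r : R) :
  (shift_measure x xi `[(- r)%R, r]%classic < +oo)%E.
Proof.
apply: le_lt_trans (config_locally_finite xi (`|r| + `|x|)).
apply: (@le_measure _ _ _ xi [set y | `[- r, r]%classic (y + x)]
  `[- (`|r| + `|x|), `|r| + `|x|]%classic); rewrite ?inE.
- by apply: measurable_shift; exact: measurable_itv.
- exact: measurable_itv.
move=> y /=; rewrite !in_itv/= => /andP[h1 h2].
have := ler_norm r; have := ler_norm (- r).
have := ler_norm x; have := ler_norm (- x); rewrite !normrN => *.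
by apply/andP; split; lra.
Qed.

Lemma translate_integer_valued (A : set borelR) : measurable A ->
  (shift_measure x xi A < +oo)%E ->
  exists k : nat, shift_measure x xi A = k%:R%:E.
Proof.
by move=> mA; apply: config_integer_valued; exact: measurable_shift.
Qed.

Definition translate : config R :=
  Config translate_locally_finite translate_integer_valued.

End translation.

Section iid_law.
Context d (T : measurableType d) (R : realType).

Definition tuple_cons n (p : T * n.-tuple T) : n.+1.-tuple T :=
  [tuple of p.1 :: p.2].

Lemma measurable_tuple_cons n : measurable_fun setT (@tuple_cons n).
Proof. exact: measurable_cons. Qed.

HB.instance Definition _ n := isMeasurableFun.Build _ _ _ _ (@tuple_cons n)
  (@measurable_tuple_cons n).

Fixpoint iid_law (P : probability T R) (n : nat) :
    probability (n.-tuple T) R :=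
  match n with
  | 0 => \d_[tuple]
  | m.+1 => distribution (P \x iid_law P m)%E (@tuple_cons m)
  end.

End iid_law.

Section empirical.
Context (R : realType) (n : nat).
Local Notation borelR := (measurableTypeR R).

Definition points_measure (x : n.-tuple borelR) :
    {measure set borelR -> \bar R} :=
  msum (fun k =>
    \d_(nth (point : borelR) x k) : {measure set borelR -> \bar R}) n.

Lemma points_measureE (x : n.-tuple borelR) (A : set borelR) :
  points_measure x A = (\sum_(k < n) (tnth x k \in A)%:R)%:E.
Proof.
rewrite /points_measure /= /msum -sumEFin.
by apply: eq_bigr => k _; rewrite /= diracE (tnth_nth (point : borelR)).
Qed.

Lemma points_locally_finite (x : n.-tuple borelR) (r : R) :
  (points_measure x `[(- r)%R, r]%classic < +oo)%E.
Proof. by rewrite points_measureE ltry. Qed.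

Lemma points_integer_valued (x : n.-tuple borelR) (A : set borelR) :
  measurable A -> (points_measure x A < +oo)%E ->
  exists k : nat, points_measure x A = k%:R%:E.
Proof.
move=> _ _; exists (\sum_(k < n) (tnth x k \in A))%N.
by rewrite points_measureE natr_sum.
Qed.

Definition points_config (x : n.-tuple borelR) : config R :=
  Config (points_locally_finite x) (@points_integer_valued x).

Lemma measurable_points_config :
  measurable_fun [set: n.-tuple borelR] points_config.
Proof.
apply: measurable_to_config => A mA.
rewrite (_ : (fun _ => _) =
    (fun x : n.-tuple borelR => \sum_(k < n) (\d_(tnth x k) A : \bar R))%E).
  apply: emeasurable_sum => k.
  rewrite (_ : (fun _ => _) =
    EFin \o (\1_A : borelR -> R) \o (fun x : n.-tuple borelR => tnth x k)) //.
  apply: measurableT_comp; last exact: measurable_tnth.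
  exact/measurable_EFinP/measurable_indic.
apply/funext => x /=; rewrite /msum.
by apply: eq_bigr => k _; rewrite (tnth_nth (point : borelR)).
Qed.

HB.instance Definition _ :=
  isMeasurableFun.Build _ _ _ _ points_config measurable_points_config.

End empirical.

Section riesz_gas.
Context (R : realType).
Local Notation borelR := (measurableTypeR R).

Definition box (n : nat) : set borelR :=
  `[- (n%:R / 2), n%:R / 2]%classic.

Lemma box_lt (n : nat) : (0 < n)%N -> - (n%:R / 2) < n%:R / 2 :> R.
Proof. by rewrite -(ltr0n R) => n0; lra. Qed.

Definition binomial_process (n : nat) (n0 : (0 < n)%N) :
    probability (config R) R :=
  distribution (iid_law (uniform_prob (box_lt n0)) n) (@points_config R n).

(* At x = 0 the value is 0 when s < 0, since 0 `^ a = 0 for a != 0. *)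
Definition riesz_potential (s x : R) : R := - (`|x| `^ (- s)).

(* Integral of f against the signed measure gamma - Leb on box n. *)
Definition integral_fluct (n : nat) (gamma : config R) (f : R -> R) : R :=
  \int[gamma]_(x in box n) f x - \int[lebesgue_measure]_(x in box n) f x.

Definition riesz_energy (s : R) (n : nat) (gamma : config R) : R :=
  2^-1 * integral_fluct n gamma (fun x =>
           integral_fluct n gamma (fun y => riesz_potential s (x - y))).

Definition gibbs_weight (s beta : R) (n : nat) (gamma : config R) : R :=
  expR (- beta * riesz_energy s n gamma).

Definition partition_function (s beta : R) (n : nat) (n0 : (0 < n)%N) : R :=
  \int[binomial_process n0]_gamma gibbs_weight s beta n gamma.

Definition riesz_gas (s beta : R) (n : nat) (n0 : (0 < n)%N)
    (A : set (config R)) : \bar R :=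
  ((\int[binomial_process n0]_(gamma in A) gibbs_weight s beta n gamma)
     / partition_function s beta n0)%:E.

End riesz_gas.

Section independence.
Context d (T : measurableType d) (R : realType) (P : probability T R).

Definition independent_systems (I : choiceType) (F : I -> set_system T) :
    Prop :=
  forall (s : seq I) (A : I -> set T), uniq s ->
    (forall i, i \in s -> F i (A i)) ->
    P (\bigcap_(i in [set` s]) A i) = (\prod_(i <- s) P (A i))%E.

Definition generated_by d' (T' : measurableType d') (X : T -> T') :
    set_system T :=
  preimage_set_system [set: T] X measurable.

End independence.

Section stationarization.
Context (R : realType).
Local Notation borelR := (measurableTypeR R).

Definition stationary (P : probability (config R) R) : Prop :=
  forall (x : R) (A : set (config R)), measurable A ->
    P (translate x @^-1` A) = P A.

(* Tile k is the translate of `[a, b] by k (b - a). The superposition Xi is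
   prescribed only almost surely, because the sum can fail to be locally finite
   on the null event where some xi k charges the complement of its tile. *)
Definition is_stationarization (a b : R) (ab : a < b)
    (P : set (config R) -> \bar R) (Q : probability (config R) R) : Prop :=
  exists (d : measure_display) (Omega : measurableType d)
    (Pr : probability Omega R) (xi : int -> {RV Pr >-> config R})
    (U : {RV Pr >-> borelR}) (Xi : {RV Pr >-> config R}),
  [/\ forall (k : int) (A : set (config R)), measurable A ->
        distribution Pr (xi k) A = P (translate (k%:~R * (b - a)) @^-1` A),
      forall B : set borelR, measurable B ->
        distribution Pr U B = uniform_prob ab B,
      independent_systems Pr (fun o : option int =>
        if o is Some k then generated_by (xi k) else generated_by U),
      {ae Pr, forall w, forall A : set borelR, measurable A ->
        Xi w A = \esum_(k in [set: int]) translate (U w) (xi k w) A}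
    & forall A : set (config R), measurable A -> Q A = distribution Pr Xi A].

End stationarization.

Section local_topology.
Context (R : realType).
Local Notation borelR := (measurableTypeR R).

(* Measures are functions on all sets, so restrictions to B are compared on
   Borel subsets of B only. *)
Definition local_on (B : set borelR) (F : config R -> R) : Prop :=
  forall xi eta : config R,
    (forall A : set borelR, measurable A -> A `<=` B -> xi A = eta A) ->
    F xi = F eta.

Definition tame_on (B : set borelR) (F : config R -> R) : Prop :=
  exists2 C : R, 0 < C &
    forall xi : config R, (`|F xi|%:E <= C%:E * (1 + xi B))%E.

Definition local_tame (F : config R -> R) : Prop :=
  exists a b : R, local_on `[a, b]%classic F /\ tame_on `[a, b]%classic F.

Definition cvg_local (P_ : nat -> probability (config R) R)
    (P : probability (config R) R) : Prop :=
  forall F : config R -> R, measurable_fun [set: config R] F ->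
    local_tame F -> ('E_(P_ n)[F] @[n --> \oo] --> 'E_P[F])%E.

End local_topology.

(* Main.v *)
Require Import Defs.
From HB Require Import structures.
From mathcomp Require Import all_boot all_order all_algebra.
From mathcomp Require Import all_classical all_reals all_analysis.
From mathcomp Require Import measurable_realfun ring lra zify.
Set Implicit Arguments.
Unset Strict Implicit.
Unset Printing Implicit Defensive.
Import Order.TTheory GRing.Theory Num.Theory.
Import numFieldNormedType.Exports.

Local Open Scope classical_set_scope.
Local Open Scope ring_scope.

(** Write a = -s, a number in ]0, 2[, so that the pair potential is -|x - y|^a.

The Riesz gas enters through one estimate only, [riesz_gas_le]: its law is at
most e^(C n) times the binomial process, with C = 1 + beta / 2. The Boltzmann
weight is at most 1 because the energy is nonnegative: |x|^a is a mixture of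
the functions 1 - cos (t x) with positive weights ([powR_cosmix]), hence is
conditionally negative definite ([pairing_positive]), and the n points and
Lebesgue measure have the same mass in the box. The partition function is at
least e^(-C n): keep only the configurations with one point in each unit cell.
For independent uniform points in the cells, the mean energy consists of the
self-interactions of the cells, at most 1 / 2 each, and Jensen's inequality
applies ([cells_add_weight_ge]).

The rest holds for all laws with such a density bound
([accumulation_of_stationarizations]). Let Q_n be the law of theta_U xi, for a
single tile xi and an independent uniform shift U. If Phi sees only a window of
length 2 r, then its Q_n-expectation is, up to a constant, 1 / n times the mean
of a sum of copies of Phi over O(n) disjoint blocks. The entropy inequality
bounds the mean of the sum by the logarithm of an exponential moment under the
binomial process, plus C n; the exponential moments of disjoint blocks
factorise after comparison with a Poisson process, so that both terms are O(n).
With a factor K in front of Phi one gets a bound of order 1 / K, uniform in n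
([shifted_law_le]).
As K is arbitrary, tame functionals of the window that tend to 0 pointwise have
Q_n-expectations that tend to 0 uniformly in n ([equicontinuous_shifted_law]).

This equicontinuity replaces tightness. A diagonal subsequence makes the
probabilities of all finite Boolean combinations of the countably many events
{at least m points in ]p, q]}, p and q rational, converge. The limits are the
law of a random sequence of bits, and by equicontinuity this sequence is almost
surely the code of a configuration, whose law is P
([equicontinuous_cvg_events]). Equicontinuity again extends the convergence to
all local events and all local tame functionals ([cvg_local_nonneg]). A
translation by x changes Q_n by at most |x| / n, so that P is stationary.
Finally, the stationarization and theta_U xi coincide in a window of radius r
unless U is within r of the ends of the box; this has probability 2 r / n,
and on that event the window shows o(n) points in the mean
([gas_interval_bound], [stationarization_close]). *)

(** * Configurations: adding a point, translating, restricting *)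

Section config_basics.
Context (R : realType).
Local Notation borelR := (measurableTypeR R).
Local Notation leb := (@lebesgue_measure R).
Implicit Types (xi eta : config R) (x y u v : R).

Lemma config_eqP xi eta : (forall A, xi A = eta A) -> xi = eta.
Proof.
case: xi eta => [m lf iv] [m' lf' iv'] /= mm'.
have {}mm' : m = m' by apply: eq_measure; apply/funext.
by case: _ / mm' in lf' iv' *; congr Config; exact: Prop_irrelevance.
Qed.

Lemma config_bounded_ltry xi (r : R) (A : set borelR) : measurable A ->
  A `<=` `[- r, r] -> (xi A < +oo)%E.
Proof.
move=> mA Ar; apply: le_lt_trans (config_locally_finite xi r).
by apply: le_measure; rewrite ?inE//; exact: measurable_itv.
Qed.

Lemma cvg_measure_windows (mu : {measure set borelR -> \bar R}) (A : set borelR) :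
  measurable A ->
  mu (A `&` `](- n%:R), n%:R]%classic) @[n --> \oo] --> mu A.
Proof.
move=> mA; have mI n : @measurable _ borelR (A `&` `](- n%:R), n%:R]%classic).
  by apply: measurableI => //; exact: measurable_itv.
have -> : mu A = mu (\bigcup_n (A `&` `](- n%:R), n%:R]%classic)).
  congr (mu _); rewrite -setI_bigcupr (_ : \bigcup_n _ = setT) ?setIT//.
  apply/seteqP; split => // x _; exists (Num.truncn `|x|).+1 => //=.
  have /ltr_normlP[h1 h2] := truncnS_gt `|x|; rewrite in_itv/=.
  by apply/andP; split; [lra|exact: ltW].
apply: nondecreasing_cvg_mu => //; first exact: bigcup_measurable.
move=> i j ij; apply/subsetPset; apply: setIS => x /=; rewrite !in_itv/=.
have : i%:R <= j%:R :> R by rewrite ler_nat.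
by move=> h /andP[h1 h2]; apply/andP; split; lra.
Qed.

Section config_integral.
Context d (T : measurableType d) (c : T -> config R).
Hypothesis mc : measurable_fun [set: T] c.

Let k (t : T) : {measure set borelR -> \bar R} := c t.

Let mk (U : set borelR) : measurable U -> measurable_fun [set: T] (k ^~ U).
Proof.
by move=> mU; exact: (measurableT_comp (measurable_config_eval mU) mc).
Qed.

HB.instance Definition _ := @isKernel.Build _ _ _ _ _ k mk.

Let measurable_config_xsection_bounded (r : R) (A : set (T * borelR)) :
  measurable A ->
  measurable_fun [set: T] (fun t => c t (xsection A t `&` `](- r), r]%classic)).
Proof.
move=> mA.
have mD : @measurable _ borelR `](- r), r]%classic by exact: measurable_itv.
have H := @measurable_prod_subset_xsection_kernel _ _ T borelR R k _ mD.
have := H _ A mA; case=> [t|_]; last exact.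
have fk : (c t `](- r)%R, r]%classic < +oo)%E.
  apply: (@config_bounded_ltry _ r) => [|x /=]; first exact: mD.
  by rewrite !in_itv/= => /andP[/ltW -> ->].
exists (fine (c t `](- r), r]%classic) + 1) => X mX.
rewrite /mrestr/=; apply: (@le_lt_trans _ _ (c t `](- r), r]%classic)).
  by apply: le_measure; rewrite ?inE//; exact: measurableI.
by rewrite -[ltLHS]fineK ?ge0_fin_numE// lte_fin; lra.
Qed.

(** The total mass of a configuration may be infinite, so that sections are
    first measured inside bounded windows, which then exhaust the line. *)
Lemma measurable_config_xsection (A : set (T * borelR)) : measurable A ->
  measurable_fun [set: T] (fun t => c t (xsection A t)).
Proof.
move=> mA; apply: (emeasurable_fun_cvg
  (fun n : nat => fun t => c t (xsection A t `&` `](- n%:R), n%:R]%classic))).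
  by move=> n; exact: measurable_config_xsection_bounded.
by move=> t _; apply: cvg_measure_windows; exact: measurable_xsection.
Qed.

Import HBNNSimple.

Lemma measurable_config_integral (f : T * borelR -> \bar R) :
  (forall z, 0 <= f z)%E -> measurable_fun [set: T * borelR] f ->
  measurable_fun [set: T] (fun t => \int[c t]_y f (t, y))%E.
Proof.
move=> f0 mf; pose f_ := nnsfun_approx measurableT mf.
apply: (@measurable_fun_xsection_integral _ _ _ _ _ _ (fun t => c t) f_).
- by move=> a b ab; exact/nd_nnsfun_approx.
- by move=> z; exact: cvg_nnsfun_approx.
- by move=> n r; exact: measurable_config_xsection.
Qed.

End config_integral.

Section add_point.
Variables (x : R) (xi : config R).

Let m : {measure set borelR -> \bar R} :=
  measure_add xi (\d_(x : borelR) : {measure set borelR -> \bar R}).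

Let mE A : m A = (xi A + (\1_A x)%:E)%E.
Proof. by rewrite -diracE; exact: measure_addE. Qed.

Let add_point_lf (r : R) : (m `[(- r)%R, r]%classic < +oo)%E.
Proof. by rewrite mE lte_add_pinfty ?ltry// config_locally_finite. Qed.

Let add_point_iv (A : set borelR) : measurable A ->
  (m A < +oo)%E -> exists k : nat, m A = k%:R%:E.
Proof.
move=> mA mAy; have : (xi A < +oo)%E.
  by apply: le_lt_trans mAy; rewrite mE leeDl// lee_fin.
move=> /(config_integer_valued mA)[k kE]; exists (k + (x \in A))%N.
by rewrite mE kE natrD indicE.
Qed.

Definition add_point : config R := Config add_point_lf add_point_iv.

Lemma add_pointE A : add_point A = (xi A + (\1_A x)%:E)%E.
Proof. exact: mE. Qed.

End add_point.

Lemma measurable_add_point d (T : measurableType d) (f : T -> borelR)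
    (c : T -> config R) : measurable_fun setT f -> measurable_fun setT c ->
  measurable_fun setT (fun t => add_point (f t) (c t)).
Proof.
move=> mf mc; apply: measurable_to_config => A mA.
under eq_fun do rewrite add_pointE.
apply: emeasurable_funD; first exact: (measurableT_comp (measurable_config_eval mA) mc).
apply/measurable_EFinP; apply: (measurableT_comp _ mf).
exact: measurable_indic.
Qed.

(** The set in which points are counted moves with t: the count is the integral
    against c t of a function of both variables. *)
Lemma measurable_translate d (T : measurableType d) (f : T -> borelR)
    (c : T -> config R) : measurable_fun setT f -> measurable_fun setT c ->
  measurable_fun setT (fun t => translate (f t) (c t)).
Proof.
move=> mf mc; apply: measurable_to_config => A mA.
rewrite (_ : (fun t => _) =
  (fun t => \int[c t]_y (\1_A (y + f t) : R)%:E)%E); last first.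
  apply/funext => t; have mS := measurable_shift (f t) mA.
  transitivity (\int[c t]_y (\1_[set y | A (y + f t)] y : R)%:E)%E.
    by rewrite integral_indic// setIT.
  apply: eq_integral => y _; congr (_%:E); rewrite !indicE; congr (_%:R).
apply: (@measurable_config_integral _ _ c mc
  (fun z : T * borelR => (\1_A (z.2 + f z.1) : R)%:E)).
  by move=> z; rewrite lee_fin.
apply/measurable_EFinP; apply: measurableT_comp; first exact: measurable_indic.
apply: measurable_funD; first exact: measurable_snd.
exact: (measurableT_comp mf measurable_fst).
Qed.

Lemma measurable_translate_preimage x (A : set (config R)) : measurable A ->
  measurable (translate x @^-1` A).
Proof.
move=> mA; have mt : measurable_fun setT (translate x : config R -> config R).
  by apply: measurable_translate.
by have := mt measurableT A mA; rewrite setTI.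
Qed.

Lemma measurable_count_neq (D : set borelR) (c : \bar R) : measurable D ->
  measurable [set xi : config R | xi D != c].
Proof.
move=> mD; have := measurable_config_eval mD measurableT
  (measurableC (emeasurable_set1 c)).
by rewrite setTI; congr (measurable _); apply/seteqP; split => xi /= /eqP.
Qed.

Lemma translateE u xi A : translate u xi A = xi [set y | A (y + u)].
Proof. by []. Qed.

Lemma translate_add_point u x xi :
  translate u (add_point x xi) = add_point (x + u) (translate u xi).
Proof. by apply: config_eqP => A; rewrite translateE !add_pointE. Qed.

Lemma translate0 xi : translate 0 xi = xi.
Proof.
apply: config_eqP => A; rewrite translateE; congr (xi _).
by apply/seteqP; split => y/=; rewrite addr0.
Qed.

Lemma translateD u v xi : translate u (translate v xi) = translate (u + v) xi.
Proof.
apply: config_eqP => A; rewrite !translateE; congr (xi _).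
by apply/seteqP; split => y/=; rewrite -addrA (addrC v).
Qed.

Lemma translate_config0 u : translate u (config0 R) = config0 R.
Proof. exact: config_eqP. Qed.

Section restrict.
Variables (D : set borelR) (mD : measurable D) (xi : config R).

Let m : {measure set borelR -> \bar R} := mrestr xi mD.

Let restrict_lf (r : R) : (m `[(- r)%R, r]%classic < +oo)%E.
Proof.
apply: le_lt_trans (config_locally_finite xi r).
have mI : @measurable _ borelR `[(- r)%R, r]%classic by exact: measurable_itv.
by apply: (@le_measure _ _ _ xi); rewrite ?inE//; exact: measurableI.
Qed.

Let restrict_iv (A : set borelR) : measurable A ->
  (m A < +oo)%E -> exists k : nat, m A = k%:R%:E.
Proof. by move=> mA; apply: config_integer_valued; exact: measurableI. Qed.

Definition restrict : config R := Config restrict_lf restrict_iv.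

Lemma restrictE A : restrict A = xi (A `&` D).
Proof. by []. Qed.

End restrict.

Lemma measurable_restrict (D : set borelR) (mD : measurable D) :
  measurable_fun setT (restrict mD).
Proof.
apply: measurable_to_config => A mA.
under eq_fun do rewrite restrictE.
by apply: measurable_config_eval; exact: measurableI.
Qed.

End config_basics.

(** * Integrating over the positions of added points *)

Section nnm.
Context (R : realType).
Local Notation borelR := (measurableTypeR R).
Local Notation leb := (@lebesgue_measure R).
Implicit Types (h : config R -> \bar R) (B : set borelR).

(** The hypothesis under which integrals can be exchanged without any
    integrability. *)
Definition nnm d (T : measurableType d) (h : T -> \bar R) :=
  measurable_fun setT h /\ forall t, (0 <= h t)%E.

(** The iterates of this operator at the empty configuration are the integrals
    of h over the positions of n points of B; binomial and Poisson expectations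
    are written with them. *)
Definition addint B h (xi : config R) : \bar R :=
  (\int[leb]_(x in B) h (add_point x xi))%E.

Lemma nnm_add_point h xi : nnm h -> nnm (fun x : borelR => h (add_point x xi)).
Proof.
move=> [mh h0]; split => //; apply: (measurableT_comp mh).
by apply: measurable_add_point => //; exact: measurable_id.
Qed.

Lemma nnm_addint B h : measurable B -> nnm h -> nnm (addint B h).
Proof.
move=> mB [mh h0]; split; last by move=> xi; apply: integral_ge0.
rewrite (_ : addint B h = (fun xi => \int[leb]_x
    (h (add_point x xi) * (\1_B x)%:E))%E); last first.
  by apply/funext => xi; rewrite /addint integral_mkcond epatch_indic.
apply: (@measurable_fun_fubini_tonelli_F _ _ (config R) borelR R leb
  (fun z => (h (add_point z.2 z.1) * (\1_B z.2)%:E)%E)).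
  apply: emeasurable_funM.
    apply: (measurableT_comp mh); apply: measurable_add_point.
      exact: measurable_snd.
    exact: measurable_fst.
  apply/measurable_EFinP; apply: measurableT_comp; last exact: measurable_snd.
  exact: measurable_indic.
by move=> z; rewrite mule_ge0 ?lee_fin.
Qed.

Lemma nnm_iter B h n : measurable B -> nnm h -> nnm (iter n (addint B) h).
Proof. by move=> mB nh; elim: n => //= n ih; exact: nnm_addint. Qed.

Lemma nnmD d (T : measurableType d) (f g : T -> \bar R) : nnm f -> nnm g ->
  nnm (fun t => f t + g t)%E.
Proof.
by move=> [mf f0] [mg g0]; split; [exact: emeasurable_funD|move=> t; exact: adde_ge0].
Qed.

Lemma nnmM d (T : measurableType d) (f g : T -> \bar R) : nnm f -> nnm g ->
  nnm (fun t => f t * g t)%E.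
Proof.
by move=> [mf f0] [mg g0]; split; [exact: emeasurable_funM|move=> t; exact: mule_ge0].
Qed.

Lemma nnm_cst d (T : measurableType d) (c : \bar R) : (0 <= c)%E -> nnm (fun _ : T => c).
Proof. by split => //; exact: measurable_cst. Qed.

Lemma nnm_indic d (T : measurableType d) (A : set T) : measurable A ->
  nnm (fun t => (\1_A t : R)%:E).
Proof.
by move=> mA; split => [|t]; [apply/measurable_EFinP; exact: measurable_indic|rewrite lee_fin].
Qed.

Lemma addintD B h1 h2 xi : measurable B -> nnm h1 -> nnm h2 ->
  addint B (fun xi => h1 xi + h2 xi)%E xi = (addint B h1 xi + addint B h2 xi)%E.
Proof.
move=> mB n1 n2; have [m1 p1] := nnm_add_point xi n1.
have [m2 p2] := nnm_add_point xi n2.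
by rewrite /addint ge0_integralD//; exact: measurable_funTS.
Qed.

Lemma addintZ B (c : \bar R) h xi : measurable B -> nnm h -> (0 <= c)%E ->
  addint B (fun xi => c * h xi)%E xi = (c * addint B h xi)%E.
Proof.
move=> mB n1 c0; have [m1 p1] := nnm_add_point xi n1.
by rewrite /addint ge0_integralZl//; exact: measurable_funTS.
Qed.

Lemma addintU B1 B2 h xi : measurable B1 -> measurable B2 -> [disjoint B1 & B2] ->
  nnm h -> addint (B1 `|` B2) h xi = (addint B1 h xi + addint B2 h xi)%E.
Proof.
move=> mB1 mB2 B12 n1; have [m1 p1] := nnm_add_point xi n1.
by rewrite /addint ge0_integral_setU//; exact: measurable_funTS.
Qed.

Lemma addint_le B B' h h' xi : measurable B -> measurable B' -> B `<=` B' ->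
  nnm h -> nnm h' -> (forall x, B x -> h (add_point x xi) <= h' (add_point x xi))%E ->
  (addint B h xi <= addint B' h' xi)%E.
Proof.
move=> mB mB' BB' n1 n2 hh'.
have [m1 p1] := nnm_add_point xi n1; have [m2 p2] := nnm_add_point xi n2.
apply: (@le_trans _ _ (addint B h' xi)).
  by apply: ge0_le_integral => //; exact: measurable_funTS.
by apply: ge0_subset_integral => //; exact: measurable_funTS.
Qed.

Lemma integral_mulindic B (g : borelR -> \bar R) (c : R) :
  measurable B -> nnm g -> (0 <= c)%R ->
  (\int[leb]_y (g y * (\1_B y)%:E * c%:E) = (\int[leb]_(y in B) g y) * c%:E)%E.
Proof.
move=> mB [mg g0] c0; rewrite ge0_integralZr//; last first.
- by move=> y _; rewrite mule_ge0 ?lee_fin.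
- apply: emeasurable_funM => //; apply/measurable_EFinP.
  exact: measurable_indic.
by congr (_ * _)%E; rewrite [RHS]integral_mkcond epatch_indic.
Qed.

(** Adding x and then y gives the same configuration as adding y and then x, so
    that Tonelli's theorem applies. *)
Lemma addintC B1 B2 h xi : measurable B1 -> measurable B2 -> nnm h ->
  addint B1 (addint B2 h) xi = addint B2 (addint B1 h) xi.
Proof.
move=> mB1 mB2 [mh h0].
pose f (z : borelR * borelR) : \bar R :=
  (h (add_point z.2 (add_point z.1 xi)) * (\1_B2 z.2)%:E * (\1_B1 z.1)%:E)%E.
have mf : measurable_fun setT f.
  apply: emeasurable_funM; last first.
    apply/measurable_EFinP; apply: measurableT_comp; last exact: measurable_fst.
    exact: measurable_indic.
  apply: emeasurable_funM; last first.
    apply/measurable_EFinP; apply: measurableT_comp; last exact: measurable_snd.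
    exact: measurable_indic.
  apply: (measurableT_comp mh); apply: measurable_add_point.
    exact: measurable_snd.
  apply: measurable_add_point; first exact: measurable_fst.
  exact: measurable_cst.
have f0 z : (0 <= f z)%E by rewrite !mule_ge0 ?lee_fin.
have E := @fubini_tonelli _ _ borelR borelR R leb leb f mf f0.
rewrite /addint [LHS]integral_mkcond epatch_indic.
transitivity (\int[leb]_x \int[leb]_y f (x, y))%E.
  apply: eq_integral => x _ /=.
  rewrite -(@integral_mulindic B2 (fun y => h (add_point y (add_point x xi)))
    (\1_B1 x) mB2 (nnm_add_point _ (conj mh h0)))//.
rewrite E [RHS]integral_mkcond epatch_indic.
apply: eq_integral => y _ /=.
have addC x : add_point y (add_point x xi) = add_point x (add_point y xi).
  by apply: config_eqP => A; rewrite !add_pointE addeAC.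
have i0 : (0 <= \1_B2 y :> R)%R by [].
rewrite -(@integral_mulindic B1 (fun x => h (add_point x (add_point y xi)))
    (\1_B2 y) mB1 (nnm_add_point _ (conj mh h0)) i0).
by apply: eq_integral => x _; rewrite /f/= addC muleAC.
Qed.

Lemma iter_addint_le B B' h h' n xi : measurable B -> measurable B' -> B `<=` B' ->
  nnm h -> nnm h' -> (forall xi, h xi <= h' xi)%E ->
  (iter n (addint B) h xi <= iter n (addint B') h' xi)%E.
Proof.
move=> mB mB' BB' nh nh' hh'; elim: n xi => [|n ih] xi; first exact: hh'.
apply: (addint_le mB mB' BB'); [exact: nnm_iter|exact: nnm_iter|].
by move=> x _; exact: ih.
Qed.

Lemma addint_natmul B h k xi : measurable B -> nnm h ->
  addint B (fun xi => h xi *+ k)%E xi = (addint B h xi *+ k)%E.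
Proof.
move=> mB nh; under eq_fun do rewrite -mule_natl.
by rewrite addintZ// ?mule_natl// lee_fin.
Qed.

Lemma addint_sum B n (F : 'I_n -> config R -> \bar R) xi : measurable B ->
  (forall i, nnm (F i)) ->
  addint B (fun xi => \sum_(i < n) F i xi)%E xi = (\sum_(i < n) addint B (F i) xi)%E.
Proof.
move=> mB nF; rewrite /addint ge0_integral_sum// => i; last first.
  by move=> x _; exact: (nF i).2.
apply: measurable_funTS; exact: (nnm_add_point xi (nF i)).1.
Qed.

(** The inductive step of the binomial theorem. *)
Lemma pascal_sum (V : nmodType) (T : nat -> nat -> V) m :
  \sum_(k < m.+1) (T k.+1 (m - k)%N + T k (m - k).+1) *+ 'C(m, k) =
  \sum_(k < m.+2) T k (m.+1 - k)%N *+ 'C(m.+1, k).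
Proof.
under eq_bigr do rewrite mulrnDl.
rewrite big_split/= [RHS]big_ord_recl/= bin0 mulr1n subn0.
rewrite [X in _ = _ + X](eq_bigr (fun i : 'I_m.+1 => T i.+1 (m - i)%N *+ 'C(m, i.+1)
   + T i.+1 (m - i)%N *+ 'C(m, i))); last first.
  by move=> i _; rewrite /bump/= add1n binS mulrnDr subSS.
rewrite big_split/= [X in _ + X = _]big_ord_recl/= bin0 mulr1n subn0.
rewrite [X in _ = _ + (X + _)]big_ord_recr/= bin_small// mulr0n addr0.
rewrite addrC -addrA; congr (_ + (_ + _)).
by apply: eq_bigr => i _; rewrite /bump/= add1n subnSK.
Qed.

(** Locality, in the form needed when points are added one at a time. *)
Definition insens (V : Type) B (h : config R -> V) := forall x xi, ~ B x -> h (add_point x xi) = h xi.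

Lemma add_pointC x y (xi : config R) :
  add_point x (add_point y xi) = add_point y (add_point x xi).
Proof. by apply: config_eqP => A; rewrite !add_pointE addeAC. Qed.

Lemma insens_addint B B' h : insens B h -> insens B (addint B' h).
Proof.
move=> hB x xi Bx; apply: eq_integral => y _.
by rewrite add_pointC hB.
Qed.

Lemma insens_iter B B' h n : insens B h -> insens B (iter n (addint B') h).
Proof. by move=> hB; elim: n => // n; exact: insens_addint. Qed.

Lemma addint_prodl B1 B2 h1 h2 xi : measurable B1 -> [disjoint B1 & B2] ->
  nnm h1 -> nnm h2 -> insens B2 h2 ->
  addint B1 (fun xi => h1 xi * h2 xi)%E xi = (addint B1 h1 xi * h2 xi)%E.
Proof.
move=> mB1 /disj_setPS B12 n1 n2 i2; rewrite -ge0_integralZr//.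
- apply: eq_integral => x; rewrite inE => B1x; rewrite i2// => B2x.
  by have := B12 x (conj B1x B2x).
- by apply: measurable_funTS; exact: (nnm_add_point xi n1).1.
- by move=> x _; exact: n1.2.
- exact: n2.2.
Qed.

(** The binomial theorem: each of the m added points falls in B1 or in B2, and
    only one of the two factors sees it. *)
Lemma iter_addint_prod B1 B2 h1 h2 m : measurable B1 -> measurable B2 ->
  [disjoint B1 & B2] -> nnm h1 -> nnm h2 -> insens B1 h1 -> insens B2 h2 ->
  iter m (addint (B1 `|` B2)) (fun xi => h1 xi * h2 xi)%E =
  (fun xi => \sum_(k < m.+1) (iter k (addint B1) h1 xi *
      iter (m - k) (addint B2) h2 xi) *+ 'C(m, k))%E.
Proof.
move=> mB1 mB2 B12 n1 n2 i1 i2; elim: m => [|m ih].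
  by apply/funext => xi; rewrite big_ord_recl big_ord0/= adde0.
have nn k l : nnm (fun xi => iter k (addint B1) h1 xi * iter l (addint B2) h2 xi)%E.
  by apply: nnmM; exact: nnm_iter.
rewrite iterS ih; apply/funext => xi.
rewrite addint_sum; [|exact: measurableU|]; last first.
  move=> i; under eq_fun do rewrite -mule_natl.
  by apply: nnmM => //; apply: nnm_cst; rewrite lee_fin.
rewrite -(pascal_sum (fun k l => iter k (addint B1) h1 xi *
  iter l (addint B2) h2 xi)%E).
apply: eq_bigr => k _; rewrite addint_natmul//; last exact: measurableU.
congr (_ *+ _)%E; rewrite addintU// (@addint_prodl B1 B2)//; last 3 first.
- exact: nnm_iter.
- exact: nnm_iter.
- exact: insens_iter.
congr (_ + _)%E.
rewrite [LHS](_ : _ = addint B2 (fun xi => iter (m - k) (addint B2) h2 xi *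
  iter k (addint B1) h1 xi)%E xi); last first.
  by congr (addint _ _ _); apply/funext => eta; rewrite muleC.
rewrite (@addint_prodl B2 B1)//; last 4 first.
- by rewrite disj_set_sym.
- exact: nnm_iter.
- exact: nnm_iter.
- exact: insens_iter.
by rewrite muleC.
Qed.

(** Up to the factor e^(- |B|), this is the expectation of h under the Poisson
    process of intensity 1 on B, restricted to at most n points. *)
Definition expint B n h : \bar R :=
  (\sum_(m < n.+1) (m`!%:R^-1)%:E * iter m (addint B) h (config0 R))%E.

(** The pairs (k, l) with k + l <= n are among those with k <= n and l <= n. *)
Lemma sum_triangle_le n (u v : nat -> \bar R) :
  (forall i, 0 <= u i)%E -> (forall i, 0 <= v i)%E ->
  (\sum_(m < n.+1) \sum_(k < m.+1) u k * v (m - k)%N <=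
   (\sum_(k < n.+1) u k) * (\sum_(k < n.+1) v k))%E.
Proof.
move=> u0 v0.
have uv0 i j : (0 <= u i * v j)%E by exact: mule_ge0.
rewrite ge0_sume_distrl//.
under [leRHS]eq_bigr do rewrite ge0_sume_distrr//.
rewrite (eq_bigr (fun m : 'I_n.+1 => \sum_(k < n.+1)
    if (k < m.+1)%N then (u k * v (m - k)%N)%E else 0)); last first.
  move=> m _; rewrite -big_mkcond/=.
  by rewrite (big_ord_widen n.+1 (fun k => u k * v (m - k)%N)%E (ltn_ord m)).
rewrite exchange_big/=; apply: lee_sum => k _.
rewrite -big_mkcond/=.
rewrite -(big_mkord (fun m => k < m.+1)%N (fun m => u k * v (m - k)%N)%E).
rewrite (@big_cat_nat _ _ _ k) /=; [|by []|exact: (ltnW (ltn_ord k))].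
rewrite big_nat_cond big_pred0 ?add0e; last first.
  by move=> i; case: ltnP => //= ik; rewrite ltnS leqNgt ik.
rewrite -{1}(add0n (k : nat)) big_addn.
rewrite -(big_mkord xpredT (fun j => u k * v j)%E).
rewrite [leRHS](@big_cat_nat _ _ _ (n.+1 - k)%N) ?leq_subr//=.
rewrite -[leLHS]adde0; apply: leeD; last by apply: sume_ge0.
rewrite big_mkcond/=; apply: lee_sum => i _.
by case: ifP => // _; rewrite addnK.
Qed.

(** Independence of a Poisson process over disjoint sets; after the truncation
    at n points only this inequality is left. *)
Lemma expint_prod B1 B2 h1 h2 n : measurable B1 -> measurable B2 ->
  [disjoint B1 & B2] -> nnm h1 -> nnm h2 -> insens B1 h1 -> insens B2 h2 ->
  (expint (B1 `|` B2) n (fun xi => h1 xi * h2 xi) <= expint B1 n h1 * expint B2 n h2)%E.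
Proof.
move=> mB1 mB2 B12 n1 n2 i1 i2.
have p1 m : (0 <= iter m (addint B1) h1 (config0 R))%E by exact: (nnm_iter m mB1 n1).2.
have p2 m : (0 <= iter m (addint B2) h2 (config0 R))%E by exact: (nnm_iter m mB2 n2).2.
pose u m := ((m`!%:R^-1)%:E * iter m (addint B1) h1 (config0 R))%E.
pose v m := ((m`!%:R^-1)%:E * iter m (addint B2) h2 (config0 R))%E.
apply: (le_trans _ (@sum_triangle_le n u v _ _)); last 2 first.
- by move=> m; rewrite /u mule_ge0// lee_fin.
- by move=> m; rewrite /v mule_ge0// lee_fin.
apply: lee_sum => m _; rewrite iter_addint_prod// ge0_sume_distrr//; last first.
  by move=> k _; rewrite -mule_natl mule_ge0// ?lee_fin// mule_ge0.
apply: lee_sum => k _; rewrite /u /v -mule_natl muleA.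
rewrite [leRHS](_ : _ = ((k`!%:R^-1)%:E * (((m - k)`!)%:R^-1)%:E *
  (iter k (addint B1) h1 (config0 R) * iter (m - k) (addint B2) h2 (config0 R))))%E.
  rewrite -!EFinM; apply: lee_wpmul2r; first by rewrite mule_ge0.
  rewrite lee_fin -(bin_fact (ltn_ord k : k <= m)%N) !natrM.
  have k0 : (k`!%:R : R) != 0 by rewrite pnatr_eq0 -lt0n fact_gt0.
  have l0 : ((m - k)`!%:R : R) != 0 by rewrite pnatr_eq0 -lt0n fact_gt0.
  have b0 : ('C(m, k)%:R : R) != 0 by rewrite pnatr_eq0 -lt0n bin_gt0; exact: (ltn_ord k).
  by rewrite le_eqVlt; apply/orP; left; apply/eqP; field; rewrite k0 l0 b0.
by rewrite !muleA; congr (_ * _)%E; rewrite muleAC.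
Qed.

Lemma expint_le B B' h h' n : measurable B -> measurable B' -> B `<=` B' ->
  nnm h -> nnm h' -> (forall xi, h xi <= h' xi)%E ->
  (expint B n h <= expint B' n h')%E.
Proof.
move=> mB mB' BB' nh nh' hh'; apply: lee_sum => m _.
by apply: lee_wpmul2l; [rewrite lee_fin|exact: iter_addint_le].
Qed.

End nnm.

(** * The entropy bound for randomly shifted laws *)

Section gas_bounds.
Context (R : realType).
Local Notation borelR := (measurableTypeR R).
Local Notation leb := (@lebesgue_measure R).
Implicit Types (h : config R -> \bar R) (B D : set borelR).

Lemma nnm_integralZ d (T : measurableType d) (m : {measure set T -> \bar R})
    (f : T -> \bar R) (c : R) : nnm f -> (0 <= c)%R ->
  (\int[m]_x (c%:E * f x) = c%:E * \int[m]_x f x)%E.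
Proof.
by move=> [mf f0] c0; rewrite ge0_integralZl ?lee_fin.
Qed.

Lemma nnm_integralD d (T : measurableType d) (m : {measure set T -> \bar R})
    (f g : T -> \bar R) :
  nnm f -> nnm g -> (\int[m]_t (f t + g t) = \int[m]_t f t + \int[m]_t g t)%E.
Proof. by move=> [mf f0] [mg g0]; rewrite ge0_integralD. Qed.

Section shift_integral.
Variable u : R.
Let f (x : borelR) : borelR := (x + u)%R.
Let mf : measurable_fun setT f.
Proof. exact: measurable_funD. Qed.
HB.instance Definition _ := isMeasurableFun.Build _ _ _ _ f mf.

Let leb_shift A : measurable A -> pushforward leb f A = leb A.
Proof.
move=> mA; apply/esym/lebesgue_measure_unique => // _ [[a b]] _ <-.
transitivity (leb `](a - u)%R, (b - u)%R]%classic).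
  rewrite /= !lebesgue_measure_itv/= !lte_fin ltrD2r.
  by case: ifP => // _; rewrite -!EFinB; congr (_%:E); lra.
congr (lebesgue_measure _); apply/esym.
apply/seteqP; split => x /=; rewrite !in_itv/= /f => /andP[h1 h2];
  apply/andP; split; lra.
Qed.

Lemma integral_shift (D : set borelR) (g : borelR -> \bar R) : measurable D ->
  nnm g -> (\int[leb]_(x in [set x | D (x + u)%R]) g (x + u)%R =
            \int[leb]_(y in D) g y)%E.
Proof.
move=> mD [mg g0].
transitivity (\int[pushforward leb f]_(y in D) g y)%E.
  by rewrite ge0_integral_pushforward//; exact: measurable_funTS.
by apply: eq_measure_integral => A mA _; exact: leb_shift.
Qed.

End shift_integral.

Lemma addint_translate D h u (xi : config R) : measurable D -> nnm h ->
  addint [set x | D (x + u)%R] (h \o translate u) xi = addint D h (translate u xi).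
Proof.
move=> mD nh; rewrite /addint -(integral_shift u mD (nnm_add_point _ nh)).
by apply: eq_integral => x _ /=; rewrite translate_add_point.
Qed.

Lemma iter_addint_translate D h u n (xi : config R) : measurable D -> nnm h ->
  iter n (addint [set x | D (x + u)%R]) (h \o translate u) xi =
  iter n (addint D) h (translate u xi).
Proof.
move=> mD nh; elim: n xi => // n ih xi.
rewrite iterS (_ : iter n _ _ = iter n (addint D) h \o translate u).
  by rewrite addint_translate//; exact: nnm_iter.
exact/funext.
Qed.

Lemma expint_translate D h u n : measurable D -> nnm h ->
  expint [set x | D (x + u)%R] n (h \o translate u) = expint D n h.
Proof.
move=> mD nh; apply: eq_bigr => m _.
by rewrite iter_addint_translate// translate_config0.
Qed.

Lemma nnm_expR d (T : measurableType d) (X : T -> R) : measurable_fun setT X ->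
  nnm (fun xi => (expR (X xi))%:E).
Proof.
move=> mX; split; last by move=> xi; rewrite lee_fin expR_ge0.
by apply/measurable_EFinP; apply: measurableT_comp.
Qed.

(** One application of [expint_prod] for each block. *)
Lemma expint_blocks (c L sigma : R) (X : nat -> config R -> R) n M : 0 < L -> 0 <= sigma ->
  (forall j, measurable_fun setT (X j)) ->
  (forall j, insens `](c + j%:R * L)%R, (c + j.+1%:R * L)%R]%classic (X j)) ->
  (forall j, expint `](c + j%:R * L)%R, (c + j.+1%:R * L)%R]%classic n
      (fun xi => (expR (X j xi))%:E) <= sigma%:E)%E ->
  (expint `]c, (c + M%:R * L)%R]%classic n
     (fun xi => (expR (\sum_(j < M) X j xi))%:E) <= (sigma ^+ M)%:E)%E.
Proof.
move=> L0 s0 mX iX hX; elim: M => [|M ih].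
  rewrite expr0 mul0r addr0 set_itvoc0.
  rewrite /expint big_ord_recl/= fact0 invr1 mul1e big_ord0 expR0.
  rewrite big1 ?adde0// => i _.
  by rewrite /bump/= /addint integral_set0 mule0.
have -> : `]c, (c + M.+1%:R * L)]%classic = `]c, (c + M%:R * L)%R]%classic `|`
    `](c + M%:R * L)%R, (c + M.+1%:R * L)%R]%classic.
  have ML : 0 <= M%:R * L by rewrite mulr_ge0// ltW.
  rewrite -natr1 mulrDl mul1r.
  apply/seteqP; split => x /=; rewrite !in_itv/=.
    move=> /andP[h1 h2]; case: (leP x (c + M%:R * L)) => h3; [left|right];
    apply/andP; split => //; lra.
  by case=> /andP[h1 h2]; apply/andP; split; lra.
under [X in expint _ _ X]eq_fun do rewrite big_ord_recr/= expRD EFinM.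
have dj : [disjoint `]c, (c + M%:R * L)%R]%classic & `](c + M%:R * L)%R, (c + M.+1%:R * L)%R]%classic].
  apply/disj_setPS => x [/=]; rewrite !in_itv/= => /andP[h1 h2] /andP[h3 h4].
  by move: h2; rewrite leNgt h3.
have ins : insens `]c, (c + M%:R * L)%R]%classic
    (fun xi => (expR (\sum_(j < M) X j xi))%:E).
  move=> x xi xM; congr (expR _)%:E; apply: eq_bigr => j _.
  apply: iX => /=; rewrite !in_itv/= => /andP[h1 h2]; apply: xM => /=.
  rewrite in_itv/=; have jL : 0 <= j%:R * L by rewrite mulr_ge0// ltW.
  have jM : j.+1%:R * L <= M%:R * L by
    apply: ler_wpM2r; [exact: ltW|rewrite ler_nat; exact: ltn_ord].
  by apply/andP; split; lra.
apply: (le_trans (expint_prod _ _ _ dj _ _ ins _)) => //.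
- by apply: nnm_expR; apply: measurable_sum => j; exact: mX.
- exact: nnm_expR.
- by move=> x xi xM; congr (expR _)%:E; exact: iX.
rewrite exprSr EFinM; apply: lee_pmul => //.
- apply: sume_ge0 => m _; rewrite mule_ge0 ?lee_fin//.
  by apply: (nnm_iter _ _ _).2 => //; apply: nnm_expR; apply: measurable_sum => j; exact: mX.
- apply: sume_ge0 => m _; rewrite mule_ge0 ?lee_fin//.
  by apply: (nnm_iter _ _ _).2 => //; exact: nnm_expR.
Qed.

Lemma points_config_cons m (x : R) (t : m.-tuple borelR) :
  points_config [tuple of x :: t] = add_point x (points_config t).
Proof.
apply: config_eqP => A; rewrite add_pointE [LHS]points_measureE.
rewrite [X in (X + _)%E]points_measureE -EFinD big_ord_recl addrC tnth0; congr (_ + _)%:E.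
by apply: eq_bigr => i _; rewrite tnthS.
Qed.

Lemma points_config_nil (t : 0.-tuple borelR) : points_config t = config0 R.
Proof.
by apply: config_eqP => A; rewrite [LHS]points_measureE big_ord0.
Qed.

Lemma iter_addint_add_point B h x n (xi : config R) :
  iter n (addint B) (h \o add_point x) xi = iter n (addint B) h (add_point x xi).
Proof.
elim: n xi => // n ih xi; rewrite !iterS.
by apply: eq_integral => y _; rewrite ih add_pointC.
Qed.

Lemma measurable_box n : @measurable _ borelR (box n).
Proof. exact: measurable_itv. Qed.

Lemma integral_iid_law n (n0 : (0 < n)%N) m h : nnm h ->
  (\int[iid_law (uniform_prob (box_lt R n0)) m]_t h (points_config t) =
   (n%:R^-1 ^+ m)%:E * iter m (addint (box n)) h (config0 R))%E.
Proof.
elim: m h => [|m ih] h nh.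
  rewrite expr0 mul1e integral_dirac//=; last first.
    by apply: (measurableT_comp nh.1); exact: measurable_points_config.
  by rewrite diracT mul1e points_config_nil.
have mpc k := @measurable_points_config R k.
rewrite /= ge0_integral_pushforward//; last 2 first.
- by apply: (measurableT_comp nh.1); exact: mpc.
- by move=> t _; exact: nh.2.
rewrite preimage_setT fubini_tonelli1//; last 2 first.
- apply: (measurableT_comp nh.1); apply: (measurableT_comp (mpc _)).
  exact: measurable_tuple_cons.
- by move=> t; exact: nh.2.
rewrite /fubini_F.
have nhx x : nnm (h \o add_point x).
  split; last by move=> xi; exact: nh.2.
  apply: (measurableT_comp nh.1); apply: measurable_add_point => //.
transitivity (\int[uniform_prob (box_lt R n0)]_x
  ((n%:R^-1 ^+ m)%:E * iter m (addint (box n)) h (add_point x (config0 R))))%E.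
  apply: eq_integral => x _; rewrite -iter_addint_add_point -ih//.
  by apply: eq_integral => t _ /=; rewrite -points_config_cons.
have nI := nnm_add_point (config0 R) (nnm_iter m (measurable_box n) nh).
rewrite ge0_integralZl//; [|exact: nI.1|by move=> x _; exact: nI.2].
rewrite integral_uniform//; [|exact: nI.1|exact: nI.2].
rewrite muleA -EFinM; congr (_%:E * _)%E.
rewrite exprSr; congr (_ * _^-1); lra.
Qed.

Lemma integral_binomial_process n (n0 : (0 < n)%N) h : nnm h ->
  (\int[binomial_process R n0]_xi h xi =
   (n%:R^-1 ^+ n)%:E * iter n (addint (box n)) h (config0 R))%E.
Proof.
move=> nh; rewrite -(integral_iid_law n0)//.
by rewrite ge0_integral_pushforward//; [exact: nh.1|move=> t _; exact: nh.2].
Qed.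

(** The n-point term of the sum already dominates, because n^(-n) <= 1 / n!;
    the loss is a factor of order e^n, comparable with the density bounds of the
    form e^(C n) to which this is applied. *)
Lemma binomial_process_le_expint n (n0 : (0 < n)%N) h : nnm h ->
  (\int[binomial_process R n0]_xi h xi <= expint (box n) n h)%E.
Proof.
move=> nh; rewrite integral_binomial_process//.
have mB := measurable_box n.
have i0 m := (nnm_iter m mB nh).2 (config0 R).
apply: (@le_trans _ _ ((n`!%:R^-1)%:E * iter n (addint (box n)) h (config0 R))%E).
  apply: lee_wpmul2r => //; rewrite lee_fin exprVn lef_pV2 ?posrE ?exprn_gt0 ?ltr0n ?fact_gt0//.
  rewrite -natrX ler_nat; elim: (n) => // k ih; rewrite factS expnS.
  apply: leq_mul => //; apply: (leq_trans ih).
  by case: (k) => // j; rewrite leq_exp2r.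
rewrite /expint big_ord_recr/= leeDr//; apply: sume_ge0 => m _.
by rewrite mule_ge0// lee_fin.
Qed.

(** The entropy inequality. The domination gives a P-mean of e^X of at most
    e^(b + c); integrating 1 + (X - b - c) <= e^(X - b - c) concludes. *)
Lemma expR_tilt d (T : measurableType d) (P : probability T R)
    (Q : {measure set T -> \bar R}) (c b : R) (X : T -> R) : 0 <= c -> 0 <= b ->
  (forall A, measurable A -> P A <= (expR c)%:E * Q A)%E ->
  measurable_fun setT X -> (forall t, 0 <= X t) ->
  (\int[Q]_t (expR (X t))%:E <= (expR b)%:E)%E ->
  (\int[P]_t (X t)%:E <= (b + c)%:E)%E.
Proof.
move=> c0 b0 PQ mX X0 hQ.
have nX := nnm_expR mX.
have ec : 0 <= expR c by exact: expR_ge0.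
have hP : (\int[P]_t (expR (X t))%:E <= (expR (b + c))%:E)%E.
  apply: (le_trans (@ge0_le_measure_integral _ _ _ P (mscale (NngNum ec) Q) _
     (fun t => (expR (X t))%:E) setT measurableT _ _)).
  - by move=> A mA; exact: PQ.
  - exact: nX.2.
  - exact: nX.1.
  rewrite ge0_integral_mscale//; [|exact: nX.1].
  by rewrite expRD mulrC EFinM; apply: lee_wpmul2l; rewrite ?lee_fin.
have mXE : measurable_fun setT (EFin \o X) by exact/measurable_EFinP.
suff : (\int[P]_t ((X t)%:E + 1) <= (b + c)%:E + 1)%E.
  rewrite ge0_integralD//; last by move=> t _; rewrite lee_fin.
  by rewrite integral_cst//= probability_setT mul1e leeD2rE.
apply: (@le_trans _ _ (\int[P]_t ((b + c)%:E + (expR (- (b + c)))%:E * (expR (X t))%:E))%E).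
  apply: ge0_le_integral => //.
  - by move=> t _; rewrite adde_ge0// lee_fin.
  - exact: emeasurable_funD.
  - apply: emeasurable_funD => //; apply: emeasurable_funM => //; exact: nX.1.
  move=> t _; rewrite -EFinM -!EFinD lee_fin -expRD.
  by have := expR_ge1Dx (- (b + c) + X t); lra.
have k0 (t : T) : setT t -> (0 <= (b + c)%:E)%E by rewrite lee_fin addr_ge0.
have e0 (t : T) : setT t -> (0 <= (expR (- (b + c)))%:E * (expR (X t))%:E)%E.
  by rewrite -EFinM lee_fin mulr_ge0 ?expR_ge0.
have me : measurable_fun setT (fun t => (expR (- (b + c)))%:E * (expR (X t))%:E)%E.
  by apply: emeasurable_funM => //; exact: nX.1.
rewrite ge0_integralD//.
rewrite integral_cst//= probability_setT mule1 leeD2lE//.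
rewrite ge0_integralZl ?lee_fin ?expR_ge0//; last exact: nX.1.
apply: (@le_trans _ _ ((expR (- (b + c)))%:E * (expR (b + c))%:E)%E).
  by apply: lee_wpmul2l; rewrite ?lee_fin ?expR_ge0.
by rewrite -EFinM -expRD addNr expR0.
Qed.


Definition shift_map (z : borelR * config R) : config R := translate z.1 z.2.

Lemma measurable_shift_map : measurable_fun setT shift_map.
Proof. by apply: measurable_translate. Qed.

HB.instance Definition _ := isMeasurableFun.Build _ _ _ _ shift_map
  measurable_shift_map.

(** What a bounded window sees of the stationarization, unless the shift is
    close to an end of the box. *)
Definition shifted_law n (n0 : (0 < n)%N) (mu : probability (config R) R) :
    probability (config R) R :=
  distribution (uniform_prob (box_lt R n0) \x mu)%E shift_map.

Lemma nnm_shift_integral (mu : probability (config R) R) h : nnm h ->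
  nnm (fun u : borelR => \int[mu]_xi h (translate u xi))%E.
Proof.
move=> nh; split; last by move=> u; apply: integral_ge0 => xi _; exact: nh.2.
apply: (@measurable_fun_fubini_tonelli_F _ _ borelR (config R) R mu (h \o shift_map)).
  exact: (measurableT_comp nh.1 measurable_shift_map).
by move=> z; exact: nh.2.
Qed.

Lemma integral_shifted_law n (n0 : (0 < n)%N) (mu : probability (config R) R) h :
  nnm h -> (\int[shifted_law n0 mu]_xi h xi =
   n%:R^-1%:E * \int[leb]_(u in box n) \int[mu]_xi h (translate u xi))%E.
Proof.
move=> nh; rewrite ge0_integral_pushforward//; last 2 first.
- exact: nh.1.
- by move=> t _; exact: nh.2.
rewrite preimage_setT fubini_tonelli1//; last 2 first.
- exact: (measurableT_comp nh.1 measurable_shift_map).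
- by move=> t; exact: nh.2.
have [m1 p1] := nnm_shift_integral mu nh.
rewrite integral_uniform//; congr (_^-1%:E * _)%E; lra.
Qed.

Lemma integral_tiles (a L : R) (g : borelR -> \bar R) M : 0 < L -> nnm g ->
  (\int[leb]_(u in `](a - M%:R * L + L)%R, (a + L)%R]) g u =
   \sum_(j < M) \int[leb]_(v in `]0%R, L]) g (v + (a - j%:R * L))%R)%E.
Proof.
move=> L0 ng; elim: M => [|M ih].
  by rewrite mul0r subr0 set_itvoc0 integral_set0 big_ord0.
rewrite big_ord_recr/= -ih.
have ML : 0 <= M%:R * L by rewrite mulr_ge0// ltW.
have -> : `](a - M.+1%:R * L + L)%R, (a + L)%R]%classic =
  `](a - M%:R * L + L)%R, (a + L)%R]%classic `|` `](a - M%:R * L)%R, (a - M%:R * L + L)%R]%classic.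
  rewrite -natr1 mulrDl mul1r.
  apply/seteqP; split => x /=; rewrite !in_itv/=.
    move=> /andP[h1 h2]; case: (leP x (a - M%:R * L + L)) => h3; [right|left];
    apply/andP; split => //; lra.
  by case=> /andP[h1 h2]; apply/andP; split; lra.
rewrite ge0_integral_setU//=; [|exact: (measurable_funTS ng.1)|by move=> x _; exact: ng.2|].
  congr (_ + _)%E; rewrite -(integral_shift (a - M%:R * L)) //.
  congr (\int[_]_(x in _) _)%E.
  apply/seteqP; split => x /=; rewrite !in_itv/= => /andP[h1 h2];
    apply/andP; split; lra.
apply/disj_setPS => x [/=]; rewrite !in_itv/= => /andP[h1 h2] /andP[h3 h4].
by move: h1; rewrite ltNge h4.
Qed.

(** Averaging Phi over the shift is averaging, over a shift v of ]0, 2 r], the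
    sum of Phi over disjoint blocks. The entropy inequality is applied to K times
    this sum: the cost C n of the density is paid once for all the blocks, and the
    exponential moments of the blocks factorise. The bound does not depend on n. *)
Lemma shifted_law_le n (n0 : (0 < n)%N) (mu : probability (config R) R) (r : nat)
    (C K sigma : R) (Phi : config R -> R) : (0 < r)%N -> 0 <= C -> 0 < K -> 0 <= sigma ->
  (forall A, measurable A -> mu A <= (expR (C * n%:R))%:E * binomial_process R n0 A)%E ->
  measurable_fun setT Phi -> (forall xi, 0 <= Phi xi) ->
  insens `](- r%:R), r%:R]%classic Phi ->
  (forall m, expint `](- r%:R)%R, r%:R] m (fun xi => (expR (K * Phi xi))%:E) <= (expR sigma)%:E)%E ->
  (\int[shifted_law n0 mu]_xi (Phi xi)%:E <= (2 * r%:R / K * (C + 3 * sigma))%:E)%E.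
Proof.
move=> r0 C0 K0 s0 muB mPhi Phi0 iPhi hS.
have nPhi : nnm (fun xi => (Phi xi)%:E) by split => //; exact/measurable_EFinP.
rewrite integral_shifted_law//.
set L : R := 2 * r%:R.
have r1 : 1 <= r%:R :> R by rewrite ler1n.
have n1 : 1 <= n%:R :> R by rewrite ler1n.
have L0 : 0 < L by rewrite /L; lra.
pose g u := (\int[mu]_xi (Phi (translate u xi))%:E)%E.
have ng : nnm g by exact: (nnm_shift_integral mu nPhi).
(* The blocks have length L >= 2: n + 2 of them cover the box for every
   offset v in ]0, L]. *)
pose M := n.+2.
have nL : n%:R <= n%:R * L by rewrite ler_peMr//; rewrite /L; lra.
have MLE : M%:R * L = n%:R * L + 2 * L by rewrite /M -natr1 -natr1; ring.
have step : (\int[leb]_(u in box n) g u <=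
    \int[leb]_(v in `]0%R, L]) (\sum_(j < M) g (v + (n%:R / 2 - j%:R * L))%R)%E)%E.
  have ngs (j : nat) : nnm (fun v : borelR => g (v + (n%:R / 2 - j%:R * L))%R).
    split; last by move=> v; exact: ng.2.
    by apply: (measurableT_comp ng.1); exact: measurable_funD.
  rewrite ge0_integral_sum//; last 2 first.
  - by move=> j; exact: (measurable_funTS (ngs j).1).
  - by move=> j v _; exact: (ngs j).2.
  rewrite -(integral_tiles (n%:R / 2) M L0 ng).
  apply: ge0_subset_integral => //.
  - exact: measurable_box.
  - exact: (measurable_funTS ng.1).
  - by move=> v _; exact: ng.2.
  move=> x; rewrite /box/= !in_itv/= => /andP[h1 h2]; rewrite MLE.
  by apply/andP; split; lra.
have bound v : 0 < v -> v <= L -> (\sum_(j < M) g (v + (n%:R / 2 - j%:R * L))%R <=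
   (K^-1 * (M%:R * sigma + C * n%:R))%:E)%E.
  move=> v0 vL.
  pose X (j : nat) xi : R := K * Phi (translate (v + (n%:R / 2 - j%:R * L)) xi).
  have mtr u : measurable_fun setT (translate u : config R -> config R).
    by apply: measurable_translate.
  have mX j : measurable_fun setT (X j).
    by apply: measurable_funM => //; apply: (measurableT_comp mPhi).
  have X0 j xi : 0 <= X j xi by rewrite mulr_ge0// ltW.
  have mS : measurable_fun setT (fun xi => \sum_(j < M) X j xi).
    by apply: measurable_sum => j; exact: mX.
  have -> : (\sum_(j < M) g (v + (n%:R / 2 - j%:R * L))%R =
     K^-1%:E * \int[mu]_xi (\sum_(j < M) X j xi)%:E)%E.
    under eq_integral do rewrite -sumEFin.
    rewrite ge0_integral_sum//; last 2 first.
    - by move=> j; exact/measurable_EFinP.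
    - by move=> j xi _; rewrite lee_fin.
    rewrite ge0_sume_distrr; last first.
      by move=> j _; apply: integral_ge0 => xi _; rewrite lee_fin.
    apply: eq_bigr => j _.
    rewrite /X; under [X in (_ * X)%E]eq_integral do rewrite EFinM.
    have nt : nnm (fun xi => (Phi (translate (v + (n%:R / 2 - j%:R * L)) xi))%:E).
      split; last by move=> xi; rewrite lee_fin.
      by apply/measurable_EFinP; apply: (measurableT_comp mPhi).
    rewrite (nnm_integralZ mu nt (ltW K0)).
    by rewrite muleA -EFinM mulVf ?gt_eqF// mul1e.
  rewrite EFinM; apply: lee_wpmul2l; first by rewrite lee_fin invr_ge0 ltW.
  apply: (@expR_tilt _ _ mu (binomial_process R n0) (C * n%:R) (M%:R * sigma)) => //.
  - by rewrite mulr_ge0.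
  - by rewrite mulr_ge0.
  - by move=> xi; apply: sumr_ge0 => j _; exact: X0.
  pose c : R := - r%:R - v - n%:R / 2.
  apply: (le_trans (binomial_process_le_expint n0 (nnm_expR mS))).
  rewrite expRM_natl.
  apply: (@le_trans _ _ (expint `]c, (c + M%:R * L)%R] n
     (fun xi => (expR (\sum_(j < M) X j xi))%:E))).
    apply: expint_le => //; [exact: measurable_itv| |exact: nnm_expR|exact: nnm_expR].
    move=> x; rewrite /box/= !in_itv/= => /andP[h1 h2]; rewrite MLE /c.
    by rewrite /L in vL nL *; apply/andP; split; lra.
  apply: expint_blocks => //.
    move=> j x xi xB; rewrite /X translate_add_point iPhi//= in_itv/= => /andP[h1 h2].
    have LE : L = 2 * r%:R by [].
    by apply: xB; rewrite /= in_itv/= -natr1 /c; apply/andP; split; lra.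
  move=> j; rewrite (_ : `](c + j%:R * L)%R, (c + j.+1%:R * L)%R]%classic =
    [set x | `](- r%:R)%R, r%:R]%classic (x + (v + (n%:R / 2 - j%:R * L)))]); last first.
    have LE : L = 2 * r%:R by [].
    apply/seteqP; split => x /=; rewrite !in_itv/= -[j.+1%:R]natr1 /c => /andP[h1 h2];
    apply/andP; split; lra.
  apply: le_trans (hS n).
  have nK : nnm (fun xi => (expR (K * Phi xi))%:E).
    by apply: nnm_expR; exact: measurable_funM.
  rewrite -(expint_translate (v + (n%:R / 2 - j%:R * L)) n (measurable_itv _) nK).
  exact: lexx.
apply: (@le_trans _ _ (n%:R^-1%:E * (L * (K^-1 * (M%:R * sigma + C * n%:R)))%:E)%E).
  apply: lee_wpmul2l; first by rewrite lee_fin invr_ge0.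
  apply: (le_trans step).
  apply: (@le_trans _ _ (\int[leb]_(v in `]0%R, L]) (K^-1 * (M%:R * sigma + C * n%:R))%:E)%E).
    apply: ge0_le_integral => //.
    - by move=> v _; apply: sume_ge0 => j _; exact: ng.2.
    - apply: measurable_funTS; apply: emeasurable_sum => j.
      by apply: (measurableT_comp ng.1); exact: measurable_funD.
    - by move=> v /=; rewrite in_itv/= => /andP[v0 vL]; exact: bound.
  by rewrite integral_cst//= lebesgue_measure_itv/= lte_fin L0 sube0 -EFinM mulrC.
rewrite -EFinM lee_fin.
have -> : n%:R^-1 * (L * (K^-1 * (M%:R * sigma + C * n%:R))) =
   L / K * (C + M%:R / n%:R * sigma).
  by field; rewrite !gt_eqF//; lra.
apply: ler_wpM2l; first by apply: divr_ge0; exact: ltW.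
rewrite lerD2l; apply: ler_wpM2r => //.
have -> : M%:R = n%:R + 2 :> R by rewrite /M -addn2 natrD.
by rewrite ler_pdivrMr; lra.
Qed.

End gas_bounds.

(** * Exponential moments and equicontinuity *)

Section equicontinuity.
Context (R : realType).
Local Notation borelR := (measurableTypeR R).
Local Notation leb := (@lebesgue_measure R).
Implicit Types (h : config R -> \bar R) (B D : set borelR) (xi : config R).

Lemma exp_partial_sum_le (x : R) n : 0 <= x ->
  \sum_(m < n) (m`!%:R^-1 * x ^+ m) <= expR x.
Proof.
move=> x0.
have := @nondecreasing_cvgn_le _ (series (exp_coeff x)) _ (is_cvg_series_exp_coeff x) n.
rewrite /series/= /expR big_mkord; under eq_bigr do rewrite mulrC; apply.
apply/nondecreasing_seqP => k; rewrite /series/= big_nat_recr//= lerDl.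
exact: exp_coeff_ge0.
Qed.

Definition count D xi : R := fine (xi D).

Lemma count_ge0 D xi : 0 <= count D xi.
Proof. by apply: fine_ge0; exact: measure_ge0. Qed.

Lemma measurable_count D : measurable D -> measurable_fun setT (count D).
Proof.
move=> mD; apply: (@measurableT_comp _ _ _ _ _ _ (@fine R)) => //.
exact: measurable_config_eval.
Qed.

Lemma count_add_point (r : R) D x xi : measurable D -> D `<=` `[- r, r]%classic ->
  count D (add_point x xi) = count D xi + \1_D x.
Proof.
move=> mD Dr; rewrite /count add_pointE fineD// ge0_fin_numE//.
exact: config_bounded_ltry Dr.
Qed.

Lemma countE (r : R) D xi : measurable D -> D `<=` `[- r, r]%classic ->
  xi D = (count D xi)%:E.
Proof.
move=> mD Dr; rewrite /count fineK// ge0_fin_numE//.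
exact: config_bounded_ltry Dr.
Qed.

Lemma count0 D : count D (config0 R) = 0.
Proof. by []. Qed.

Lemma measurable_expcount (c d : R) D : measurable D ->
  measurable_fun setT (fun xi => c + d * count D xi).
Proof.
move=> mD; apply: measurable_funD => //; apply: measurable_funM => //.
exact: measurable_count.
Qed.

Section poisson.
Variable r : nat.
Hypothesis r0 : (0 < r)%N.

Let N0 : (0 < 2 * r)%N. Proof. by rewrite muln_gt0. Qed.

Let w_ge0 (m : nat) : (0 : R) <= (2 * r)%:R ^+ m / m`!%:R.
Proof. by rewrite divr_ge0// exprn_ge0. Qed.

(** The Poisson process on box (2 r), an interval that contains the window of
    radius r, with the normalising factor e^(- 2 r) left out. It dominates all the
    truncated sums [expint], and makes dominated convergence available for them. *)
Definition poisson : {measure set (config R) -> \bar R} :=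
  mseries (fun m => mscale (NngNum (w_ge0 m))
    (distribution (iid_law (uniform_prob (box_lt R N0)) m) (@points_config R m))) 0.

Local Notation B := (box (2 * r) : set borelR).

Lemma integral_poisson h : nnm h -> (\int[poisson]_xi h xi =
  \sum_(m <oo) (m`!%:R^-1)%:E * iter m (addint B) h (config0 R))%E.
Proof.
move=> nh; rewrite ge0_integral_measure_series//; last 2 first.
- by move=> t _; exact: nh.2.
- exact: nh.1.
apply: eq_eseriesr => m _; rewrite ge0_integral_mscale//; last 2 first.
- exact: nh.1.
- by move=> t _; exact: nh.2.
rewrite ge0_integral_pushforward//; last 2 first.
- exact: nh.1.
- by move=> t _; exact: nh.2.
rewrite preimage_setT (integral_iid_law N0)// muleA -EFinM; congr (_%:E * _)%E.
rewrite /= exprVn; field; rewrite expf_neq0 ?pnatr_eq0 -?lt0n ?fact_gt0//.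
Qed.

Lemma expint_le_poisson D n h : measurable D -> D `<=` B -> nnm h ->
  (expint D n h <= \int[poisson]_xi h xi)%E.
Proof.
move=> mD DB nh; have mB := @measurable_box R (2 * r).
rewrite integral_poisson//; apply: (@le_trans _ _ (expint B n h)).
  exact: expint_le.
rewrite /expint -(big_mkord xpredT (fun m => (m`!%:R^-1)%:E * iter m (addint B) h (config0 R))%E).
apply: (@nneseries_lim_ge R (fun m => (m`!%:R^-1)%:E * iter m (addint B) h (config0 R))%E xpredT 0%N n.+1).
by move=> m _ _; rewrite mule_ge0 ?lee_fin//; exact: (nnm_iter _ mB nh).2.
Qed.

(** Adding a point multiplies e^(d N_D) by at most e^d. *)
Lemma iter_expcount D (c d : R) m xi : measurable D -> D `<=` B -> 0 <= d ->
  (iter m (addint B) (fun xi => (expR (c + d * count D xi))%:E) xi <=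
   (((2 * r)%:R * expR d) ^+ m)%:E * (expR (c + d * count D xi))%:E)%E.
Proof.
move=> mD DB d0; have mB := @measurable_box R (2 * r).
have DI : D `<=` `[- r%:R, r%:R]%classic.
  move=> x /DB; rewrite /box/= natrM !in_itv/= => /andP[h1 h2].
  by apply/andP; split; lra.
have nh := nnm_expR (measurable_expcount c d mD).
elim: m xi => [|m ih] xi; first by rewrite expr0 mul1e.
rewrite iterS exprS.
apply: (@le_trans _ _ (addint B (fun xi => (((2 * r)%:R * expR d) ^+ m)%:E *
   (expR (c + d * count D xi))%:E)%E xi)).
  apply: addint_le => //; first exact: nnm_iter.
  by apply: nnmM => //; apply: nnm_cst; rewrite lee_fin exprn_ge0// mulr_ge0// expR_ge0.
rewrite addintZ//.
rewrite [X in (_ <= X%:E * _)%E]mulrC EFinM -muleA; apply: lee_wpmul2l.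
  by rewrite lee_fin exprn_ge0// mulr_ge0// expR_ge0.
rewrite -EFinM.
apply: (@le_trans _ _ (\int[leb]_(x in B) (expR (d + (c + d * count D xi)))%:E)%E).
  have [m1 p1] := nnm_add_point xi nh.
  apply: ge0_le_integral => //.
  - exact: measurable_funTS.
  move=> x _; rewrite lee_fin ler_expR (count_add_point _ _ mD DI) mulrDr.
  have : d * \1_D x <= d by rewrite ler_piMr// indicE lern1 leq_b1.
  lra.
rewrite integral_cst//= /box lebesgue_measure_itv/= lte_fin natrM.
have r1 : 1 <= r%:R :> R by rewrite ler1n.
rewrite ifT; last lra.
rewrite -EFinB -EFinM lee_fin expRD mulrC mulrA ler_wpM2r ?expR_ge0//.
rewrite ler_wpM2r ?expR_ge0//; lra.
Qed.

Lemma poisson_expcount D (c d : R) : measurable D -> D `<=` B -> 0 <= d ->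
  (\int[poisson]_xi (expR (c + d * count D xi))%:E <=
   (expR (c + (2 * r)%:R * expR d))%:E)%E.
Proof.
move=> mD DB d0; have mB := @measurable_box R (2 * r).
have nh := nnm_expR (measurable_expcount c d mD).
rewrite integral_poisson//; apply: lime_le.
  by apply: is_cvg_nneseries => m _ _; rewrite mule_ge0 ?lee_fin//; exact: (nnm_iter _ mB nh).2.
apply: nearW => n.
apply: (@le_trans _ _ (\sum_(0 <= m < n) (m`!%:R^-1 * ((2 * r)%:R * expR d) ^+ m)%:E * (expR c)%:E)%E).
  apply: lee_sum => m _; rewrite EFinM -muleA; apply: lee_wpmul2l.
    by rewrite lee_fin.
  apply: (le_trans (iter_expcount c m (config0 R) mD DB d0)).
  by rewrite count0 mulr0 addr0.
rewrite -ge0_sume_distrl; last first.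
  by move=> m _; rewrite lee_fin mulr_ge0// exprn_ge0// mulr_ge0// expR_ge0.
rewrite sumEFin -EFinM lee_fin addrC expRD ler_wpM2r ?expR_ge0// big_mkord.
by apply: exp_partial_sum_le; rewrite mulr_ge0// expR_ge0.
Qed.

(** Dominated convergence under [poisson], with the dominating function
    e^(K C0 (1 + N_D)). The limit of the integrals is the total mass e^(2 r). *)
Lemma expint_equicontinuous D (C0 K : R) (Phi : nat -> config R -> R) :
  measurable D -> D `<=` B -> 0 <= C0 -> 0 <= K ->
  (forall j, measurable_fun setT (Phi j)) -> (forall j xi, 0 <= Phi j xi) ->
  (forall j xi, Phi j xi <= C0 * (1 + count D xi)) ->
  (forall xi, Phi j xi @[j --> \oo] --> 0) ->
  \forall j \near \oo, forall m,
    (expint D m (fun xi => (expR (K * Phi j xi))%:E) <= (expR ((2 * r)%:R + 1))%:E)%E.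
Proof.
move=> mD DB C00 K0 mPhi Phi0 PhiC Phicvg.
have mX j : measurable_fun setT (fun xi => K * Phi j xi) by exact: measurable_funM.
have nX j := nnm_expR (mX j).
pose f_ (j : nat) (xi : config R) : \bar R := (expR (K * Phi j xi))%:E.
pose g (xi : config R) : \bar R := (expR (K * C0 + K * C0 * count D xi))%:E.
have ng : nnm g by apply: nnm_expR; exact: measurable_expcount.
have ig : (poisson : {measure set (config R) -> \bar R}).-integrable setT g.
  apply/integrableP; split; first exact: ng.1.
  rewrite (eq_integral g); last by move=> xi _; rewrite gee0_abs// ng.2.
  apply: (le_lt_trans (poisson_expcount _ _ _ _)) => //; last exact: ltry.
  exact: mulr_ge0.
have H : (\int[poisson]_xi f_ j xi @[j --> \oo] --> \int[poisson]_xi (cst 1 xi))%E.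
  apply: (@dominated_cvg _ _ _ poisson setT measurableT f_ (cst 1%E) g) => //.
  - by move=> j; exact: (nX j).1.
  - move=> xi _; have cK : K * Phi j xi @[j --> \oo] --> (0 : R).
      by rewrite -[X in _ --> X](mulr0 K); apply: cvgM; [exact: cvg_cst|exact: Phicvg].
    apply: cvg_EFin; first by apply: nearW.
    rewrite /f_ /= -(@expR0 R).
    apply: (@cvg_comp _ _ _ (fun j => K * Phi j xi) (expR : R -> R) _ (nbhs (0:R))).
      exact: cK.
    exact: continuous_expR.
  - move=> j xi _; rewrite gee0_abs ?lee_fin ?expR_ge0// ler_expR -mulrA -mulrDr.
    apply: ler_wpM2l => //; apply: (le_trans (PhiC j xi)); lra.
have I1 : (\int[poisson]_xi (cst 1 xi) < (expR ((2 * r)%:R + 1))%:E)%E.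
  apply: (@le_lt_trans _ _ (expR (2 * r)%:R)%:E); last by rewrite lte_fin ltr_expR ltrDl.
  have := poisson_expcount 0 mD DB (lexx 0).
  by under eq_integral do rewrite mul0r addr0 expR0; rewrite expR0 mulr1 add0r.
have : \forall j \near \oo, (\int[poisson]_xi f_ j xi < (expR ((2 * r)%:R + 1))%:E)%E.
  exact: (H _ (open_ereal_lt' I1)).
apply: filterS => j /ltW hj m; apply: le_trans hj.
by apply: expint_le_poisson => //; exact: nX.
Qed.

End poisson.

(** Half-open, so that its translates by multiples of 2 r are disjoint blocks. *)
Definition window (r : nat) : set borelR := `](- r%:R), r%:R]%classic.

Lemma measurable_window r : measurable (window r).
Proof. exact: measurable_itv. Qed.

Lemma window_sub r : window r `<=` `[- r%:R, r%:R]%classic.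
Proof. by move=> x; rewrite /window/= !in_itv/= => /andP[/ltW -> ->]. Qed.

Lemma window_sub_box r : window r `<=` (box (2 * r) : set borelR).
Proof.
move=> x; rewrite /window /box/= !in_itv/= natrM => /andP[h1 h2].
by apply/andP; split; lra.
Qed.

(** The substitute for tightness: functionals of a window with at most linear
    growth that tend to 0 pointwise have uniformly small expectations. *)
Definition equicontinuous (Q : nat -> probability (config R) R) : Prop :=
  forall (r : nat) (C0 : R) (Phi : nat -> config R -> R), (0 < r)%N -> 0 <= C0 ->
  (forall j, measurable_fun setT (Phi j)) -> (forall j xi, 0 <= Phi j xi) ->
  (forall j, insens (window r) (Phi j)) ->
  (forall j xi, Phi j xi <= C0 * (1 + count (window r) xi)) ->
  (forall xi, Phi j xi @[j --> \oo] --> 0) ->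
  forall e : R, 0 < e ->
  \forall j \near \oo, forall n, (\int[Q n]_xi (Phi j xi)%:E <= e%:E)%E.

(** In [shifted_law_le], K is taken so large that the bound is e; the
    exponential moment of K Phi_j is under control as soon as j is large. *)
Lemma equicontinuous_shifted_law (C : R) (mu : nat -> probability (config R) R) :
  0 <= C ->
  (forall n A, measurable A ->
    mu n A <= (expR (C * n.+1%:R))%:E * binomial_process R (ltn0Sn n) A)%E ->
  equicontinuous (fun n => shifted_law (ltn0Sn n) (mu n)).
Proof.
move=> C0 muB r c0 Phi r0 c00 mPhi Phi0 iPhi PhiC Phicvg e e0.
pose sigma : R := (2 * r)%:R + 1.
have s0 : 0 <= sigma by rewrite addr_ge0.
have r1 : 1 <= r%:R :> R by rewrite ler1n.
pose K : R := 2 * r%:R * (C + 3 * sigma) / e.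
have s1 : 1 <= sigma by rewrite lerDr.
have cs0 : 0 < C + 3 * sigma by lra.
have K0 : 0 < K by rewrite divr_gt0// !mulr_gt0//; lra.
have := expint_equicontinuous r0 (measurable_window r) (@window_sub_box r) c00
  (ltW K0) mPhi Phi0 PhiC Phicvg.
apply: filterS => j hj n.
have := @shifted_law_le R n.+1 (ltn0Sn n) (mu n) r C K sigma (Phi j) r0 C0 K0 s0
  (muB n) (mPhi j) (Phi0 j) (iPhi j) hj.
move=> /le_trans; apply; rewrite lee_fin /K le_eqVlt; apply/orP; left; apply/eqP.
by field; rewrite !gt_eqF//; lra.
Qed.

End equicontinuity.

(** * Random bits with prescribed cylinder probabilities *)

Section bit_tree.
Context (R : realType).
Local Notation borelR := (measurableTypeR R).
Local Notation leb := (@lebesgue_measure R).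

Let m01 : @measurable _ borelR `[0, 1[%classic.
Proof. exact: measurable_itv. Qed.

Definition leb01 : set borelR -> \bar R := mrestr leb m01.

HB.instance Definition _ := Measure.on leb01.

Let leb01T : leb01 setT = 1%E.
Proof. by rewrite /leb01 /mrestr setTI lebesgue_measure_itv/= lte_fin ltr01 sube0. Qed.

HB.instance Definition _ := Measure_isProbability.Build _ _ _ leb01 leb01T.

Section tree.
Variable p : seq bool -> R.
Hypothesis p_nil : p [::] = 1.
Hypothesis p_ge0 : forall w, 0 <= p w.
Hypothesis p_split : forall w, p (false :: w) + p (true :: w) = p w.

(** The word w, last bit first, is represented by the interval of length p w
    that starts at tree_left w; it is cut into the interval of false :: w and,
    to its right, that of true :: w. *)
Fixpoint tree_left (w : seq bool) : R :=
  if w is b :: w' then tree_left w' + (if b then p (false :: w') else 0) else 0.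

Fixpoint tree_bits (k : nat) (u : R) : seq bool :=
  if k is k'.+1 then
    let w := tree_bits k' u in (tree_left w + p (false :: w) <= u) :: w
  else [::].

Lemma size_tree_bits k u : size (tree_bits k u) = k.
Proof. by elim: k => //= k ->. Qed.

Lemma tree_bitsP k u w : 0 <= u < 1 -> size w = k ->
  (tree_bits k u == w) = (tree_left w <= u < tree_left w + p w).
Proof.
move=> u01; elim: k w => [|k ih] [|b w]//=; first by rewrite p_nil add0r u01.
move=> [wk]; rewrite eqseq_cons; have := p_split w.
have pf := p_ge0 (false :: w); have pt := p_ge0 (true :: w).
case: (eqVneq (tree_bits k u) w) => [E|bw]; last first.
  move=> pE; have := ih _ wk; rewrite (negbTE bw) => /esym/negbT h.
  rewrite andbF; apply/esym/negbTE/negP => /andP[h1 h2]; move/negP: h; apply.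
  by apply/andP; case: b h1 h2 => h1 h2; split; lra.
move=> pE; have := ih _ wk; rewrite E eqxx => /esym /andP[h1 h2].
rewrite andbT; case: b => /=.
  by rewrite eqb_id; apply/idP/andP => [h|[]//]; split; lra.
by rewrite eqbF_neg -ltNge addr0 h1.
Qed.

Lemma tree_left_bounds w : 0 <= tree_left w /\ tree_left w + p w <= 1.
Proof.
elim: w => [|b w [h1 h2]] /=; first by rewrite p_nil add0r.
have := p_split w; have pf := p_ge0 (false :: w); have pt := p_ge0 (true :: w).
by case: b => pE; split; lra.
Qed.

(** The bits of a uniform point of [0, 1[ therefore have the cylinder
    probabilities p: this is Kolmogorov's extension theorem for sequences of bits. *)
Lemma leb01_tree_bits w : leb01 [set u | tree_bits (size w) u == w] = (p w)%:E.
Proof.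
rewrite /leb01 /mrestr (_ : _ `&` _ = `[tree_left w, tree_left w + p w[%classic).
  rewrite lebesgue_measure_itv/= lte_fin ltrDl -EFinB addrC addKr.
  by case: ifPn => //; rewrite -leNgt => h; congr (_%:E); apply/le_anti; rewrite h p_ge0.
have [l0 l1] := tree_left_bounds w.
apply/seteqP; split => u /=.
  by rewrite !in_itv/= => -[h u01]; rewrite tree_bitsP in h.
rewrite !in_itv/= => /andP[h1 h2].
have u01 : 0 <= u < 1 by apply/andP; split; lra.
by split => //; rewrite tree_bitsP// h1.
Qed.

Lemma measurable_tree_bits w : @measurable _ borelR [set u | tree_bits (size w) u == w].
Proof.
elim: w => [|b w ih].
  by rewrite (_ : [set u | _] = setT)//; apply/seteqP; split.
rewrite (_ : [set u | _] = [set u | tree_bits (size w) u == w] `&`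
  [set u | (tree_left w + p (false :: w) <= u) = b]).
  apply: measurableI => //; case: b.
    rewrite (_ : [set u | _] = `[tree_left w + p (false :: w), +oo[%classic).
      exact: measurable_itv.
    by apply/seteqP; split => u/=; rewrite in_itv/= andbT.
  rewrite (_ : [set u | _] = `]-oo, tree_left w + p (false :: w)[%classic).
    exact: measurable_itv.
  apply/seteqP; split => u/=; rewrite in_itv/= ltNge; first by move=> ->.
  by move=> /negbTE.
apply/seteqP; split => u /=; rewrite eqseq_cons.
  by move=> /andP[/eqP + /eqP E]; rewrite E => ->; split.
by move=> [/eqP -> ->]; rewrite !eqxx.
Qed.

End tree.

End bit_tree.

(** * Diagonal extraction of cylinder probabilities *)

Section coding.
Context d (T : measurableType d) (R : realType).
Variable E : nat -> set T.
Hypothesis mE : forall i, measurable (E i).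

(** The last event comes first, as in [tree_bits]. *)
Fixpoint code (k : nat) (t : T) : seq bool :=
  if k is k'.+1 then (t \in E k') :: code k' t else [::].

Lemma size_code k t : size (code k t) = k.
Proof. by elim: k => //= k ->. Qed.

Lemma code_cons b w : [set t | code (size (b :: w)) t == b :: w] =
  [set t | code (size w) t == w] `&` (if b then E (size w) else ~` E (size w)).
Proof.
case: b => /=; apply/seteqP; split => t /=; rewrite eqseq_cons ?eqb_id ?eqbF_neg.
- by move=> /andP[/set_mem].
- by move=> [-> /mem_set ->].
- by move=> /andP[/negP h ->]; split => // /mem_set.
- by move=> [-> h]; rewrite andbT; apply/negP => /set_mem.
Qed.

Lemma measurable_code w : measurable [set t | code (size w) t == w].
Proof.
elim: w => [|b w ih]; first by rewrite (_ : [set t | _] = setT)//; apply/seteqP; split.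
rewrite code_cons; apply: measurableI => //; case: b => //; exact: measurableC.
Qed.

Lemma code_split (P : probability T R) w :
  (P [set t | code (size (false :: w)) t == false :: w] +
   P [set t | code (size (true :: w)) t == true :: w] =
   P [set t | code (size w) t == w])%E.
Proof.
rewrite !code_cons addeC -measureU//; last 3 first.
- apply: measurableI => //; exact: measurable_code.
- apply: measurableI; [exact: measurable_code|exact: measurableC].
- by rewrite setIACA setICr setI0.
by rewrite -setIUr setUCr setIT.
Qed.

End coding.

(** A condition on k bits is a finite disjoint union of cylinders. *)
Lemma prob_code d (S : measurableType d) (R : realType) (P : probability S R)
    (c : S -> seq bool) k (g : pred (seq bool)) :
  (forall s, size (c s) = k) ->
  (forall w, size w = k -> measurable [set s | c s == w]) ->
  measurable [set s | g (c s)] /\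
  fine (P [set s | g (c s)]) =
    \sum_(w : k.-tuple bool | g w) fine (P [set s | c s == w :> seq bool]).
Proof.
move=> sc mc.
pose F (w : k.-tuple bool) := [set s | c s == w :> seq bool].
have mF w : measurable (F w) by apply: mc; rewrite size_tuple.
pose D := [set` [pred w : k.-tuple bool | g w]].
have fD : finite_set D by exact: finite_finpred.
have E : [set s | g (c s)] = \bigcup_(w in D) F w.
  apply/seteqP; split => s /=.
    move=> gs; have sk : size (c s) == k by rewrite sc.
    by exists (Tuple sk) => //=; exact/eqP.
  by move=> [w /= gw /eqP ->].
split; first by rewrite E; apply: fin_bigcup_measurable => // w _.
rewrite E measure_fin_bigcup//; last first.
  by move=> w w' _ _ [s [/= /eqP h1 /eqP h2]]; apply: val_inj; rewrite /= -h1.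
rewrite (fsbigE [seq w <- index_enum _ | g (tval w)])/=; first last.
- by move=> w gw; rewrite mem_filter mem_index_enum andbT => /negP; exact.
- by move=> w /=; rewrite mem_filter => /andP[].
- by rewrite filter_uniq// index_enum_uniq.
rewrite big_filter_cond.
under eq_bigr do rewrite -[P _]fineK ?fin_num_measure//.
rewrite sumEFin /=.
apply: eq_bigl => w; rewrite /D; apply/andP/idP => [[]//|gw]; split => //.
exact: mem_set.
Qed.

Section diagonal.
Context (R : realType).

Lemma ultra_bounded_cvg (U : set_system nat) (a : nat -> R) : UltraFilter U ->
  (forall n, 0 <= a n <= 1) ->
  exists l, forall e, 0 < e -> U [set n | `|a n - l| < e].
Proof.
move=> UU a01; have PU : ProperFilter U by exact: ultra_proper.
have [l [_ cl]] := @segment_compact R 0 1 (a @ U) _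
  (filterS (fun n _ => (a01 n : `[0, 1]%classic (a n))) filterT).
exists l => e e0; have [//|h] := in_ultra_setVsetC [set n | `|a n - l| < e] UU.
have [x [/= xA xe]] := cl _ _ (h : (a @ U) [set x | ~ (`|x - l| < e)]) (nbhsx_ballx l e e0).
by move: xA; rewrite distrC.
Qed.

(** An ultrafilter finer than the neighbourhoods of infinity selects all the
    limits at once; phi k is then an index at which the first k sequences are
    close to their limits. *)
Lemma diagonal_subsequence (a : nat -> nat -> R) :
  (forall i n, 0 <= a i n <= 1) ->
  exists (phi : nat -> nat) (l : nat -> R), {homo phi : i j / (i < j)%N} /\
    forall i, a i (phi k) @[k --> \oo] --> l i.
Proof.
move=> a01.
have [U [UU sU]] := @ultraFilterLemma nat \oo _.
have PU : ProperFilter U by exact: ultra_proper.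
have /choice[l hl] : forall i, exists l, forall e, 0 < e -> U [set n | `|a i n - l| < e].
  by move=> i; exact: ultra_bounded_cvg.
have hU k e : 0 < e -> U [set n | forall i, (i < k)%N -> `|a i n - l i| < e].
  move=> e0; elim: k => [|k ih]; first by apply: filterS filterT => n _ i.
  apply: filterS2 ih (hl k e e0) => n /= h1 h2 i.
  by rewrite ltnS leq_eqVlt => /predU1P[->//|]; exact: h1.
have next m k : exists n, (m < n)%N /\ forall i, (i < k)%N -> `|a i n - l i| < k.+1%:R^-1.
  have Um : U [set n | (m < n)%N] by apply: sU; exists m.+1.
  have Uk := hU k k.+1%:R^-1 (ltac:(by rewrite invr_gt0)).
  by have [n [h1 h2]] := filter_ex (filterI Um Uk); exists n.
have {}/choice[f hf] : forall mk : nat * nat, exists n, (mk.1 < n)%N /\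
  forall i, (i < mk.2)%N -> `|a i n - l i| < mk.2.+1%:R^-1 by move=> [m k]; exact: next.
pose phi := fix phi k := if k is k'.+1 then f (phi k', k) else f (0%N, 0%N).
exists phi, l; split.
  apply: homo_ltn; first exact: ltn_trans.
  by move=> k; exact: (hf (phi k, k.+1)).1.
move=> i.
have H k : (0 < k)%N -> (i < k)%N -> `|a i (phi k) - l i| < k.+1%:R^-1.
  by case: k => // k _ ik; exact: (hf (phi k, k.+1)).2.
apply/cvgrPdist_lt => e e0; near=> k.
have k0 : (0 < k)%N by near: k; exists 1%N.
have ik : (i < k)%N by near: k; exists i.+1.
have : k.+1%:R^-1 < e.
  by near: k; exact: near_infty_natSinv_lt (PosNum e0).
by apply: lt_trans; rewrite distrC; exact: H.
Unshelve. all: by end_near. Qed.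

End diagonal.

Section limit_code.
Context d (T : measurableType d) (R : realType).
Variables (Q : nat -> probability T R) (E : nat -> set T).
Hypothesis mE : forall i, measurable (E i).

(** Cylinder probabilities are additive along the tree, and so are their
    limits, which are thus realised by a tree of intervals. *)
Lemma limit_code : exists (phi : nat -> nat) (p : seq bool -> R),
  [/\ {homo phi : i j / (i < j)%N},
      [/\ p [::] = 1, (forall w, 0 <= p w) &
          (forall w, p (false :: w) + p (true :: w) = p w)] &
      forall k (g : pred (seq bool)),
        fine (Q (phi n) [set t | g (code E k t)]) @[n --> \oo] -->
        fine (leb01 [set u | g (tree_bits p k u)])].
Proof.
pose a i n : R := if unpickle i is Some w then
  fine (Q n [set t | code E (size w) t == w]) else 0.
have Pfin n A : measurable A -> Q n A \is a fin_num by move=> mA; rewrite fin_num_measure.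
have a01 i n : 0 <= a i n <= 1.
  rewrite /a; case: unpickle => [w|]; last by rewrite lexx ler01.
  have mw := measurable_code mE w.
  by rewrite fine_ge0//= -lee_fin fineK ?Pfin// probability_le1.
have [phi [l [hphi hl]]] := diagonal_subsequence a01.
pose p (w : seq bool) := l (pickle w).
have pl w : fine (Q (phi n) [set t | code E (size w) t == w]) @[n --> \oo] --> p w.
  rewrite (_ : (fun n => _) = (fun n => a (pickle w) (phi n))); first exact: hl.
  by apply/funext => n; rewrite /a pickleK.
have p0 : p [::] = 1.
  have := pl [::]; move=> /cvg_unique; apply => //.
  rewrite (_ : (fun n => _) = cst 1); first exact: cvg_cst.
  apply/funext => n /=; rewrite (_ : [set t | _] = setT) ?probability_setT//.
  by apply/seteqP; split.
have pge w : 0 <= p w.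
  apply: (cvgr_to_ge (pl w)).
  by apply: nearW => n; apply: fine_ge0.
have ps w : p (false :: w) + p (true :: w) = p w.
  suff hw : fine (Q (phi n) [set t | code E (size w) t == w]) @[n --> \oo] -->
      p (false :: w) + p (true :: w) by exact: (cvg_unique _ hw (pl w)).
  rewrite (_ : (fun n => _) =
    (fun n => fine (Q (phi n) [set t | code E (size (false :: w)) t == false :: w]) +
              fine (Q (phi n) [set t | code E (size (true :: w)) t == true :: w]))).
    exact: cvgD (pl (false :: w)) (pl (true :: w)).
  apply/funext => n /=; rewrite -fineD ?Pfin//; try exact: (measurable_code mE (_ :: _)).
  by congr fine; apply/esym; exact: (code_split mE).
exists phi, p; split => // k g.
have [m1 ->] := @prob_code _ _ R (@leb01 R : probability _ R) (tree_bits p k) k g (size_tree_bits p k)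
  (fun w wk => eq_rect _ (fun j => measurable [set u | tree_bits p j u == w])
     (measurable_tree_bits p w) _ wk).
rewrite (_ : (fun n => _) = (fun n => \sum_(w : k.-tuple bool | g w)
   fine (Q (phi n) [set t | code E k t == w :> seq bool]))); last first.
  apply/funext => n.
  by have [m2 ->] := @prob_code _ _ R (Q (phi n)) (code E k) k g (size_code E k)
  (fun w wk => eq_rect _ (fun j => measurable [set t | code E j t == w])
     (measurable_code mE w) _ wk).
apply: cvg_big => [|w gw]; first exact: add_continuous.
have H : fine (@leb01 R [set u | tree_bits p k u == w :> seq bool]) = p w.
  by have := leb01_tree_bits p0 pge ps w; rewrite size_tuple => ->.
by have := pl w; rewrite size_tuple -H.
Qed.

End limit_code.

(** * Configurations from integer-valued increments *)

Section increments.
Context (R : realType).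
Local Notation borelR := (measurableTypeR R).

Lemma nat_cvg (u : nat -> nat) (l : R) :
  (u n)%:R @[n --> \oo] --> l -> exists m : nat, l = m%:R.
Proof.
move=> ul; have /cvgrPdist_lt/(_ (4^-1)) := ul; case=> [|N _ hN]; first by rewrite invr_gt0.
exists (u N); apply: (cvg_unique _ ul) => //.
apply: cvg_near_cst; exists N => // n /= Nn.
have h1 := hN N (leqnn N); have h2 := hN n Nn.
have : `|(u n)%:R - (u N)%:R| < 1 :> R.
  have -> : (u n)%:R - (u N)%:R = (l - (u N)%:R) - (l - (u n)%:R) :> R by ring.
  by apply: le_lt_trans (ler_normB _ _) _; lra.
move/ltr_normlP => [h3 h4]; apply/eqP; rewrite eqr_nat eqn_leq -ltnS -[X in _ && X]ltnS.
by rewrite -!(ltr_nat R) -!natr1; apply/andP; split; lra.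
Qed.

(** Inside a bounded window, the sets of integer mass form a Dynkin system: a
    limit of integers is an integer. *)
Lemma integer_valued_measure (mu : {measure set borelR -> \bar R}) :
  (forall a b : R, a <= b -> exists m : nat, mu `]a, b]%classic = m%:R%:E) ->
  forall A, measurable A -> (mu A < +oo)%E -> exists m : nat, mu A = m%:R%:E.
Proof.
move=> muI.
pose W (k : nat) : set borelR := `](- k%:R), k%:R]%classic.
have mW k : measurable (W k) by exact: measurable_itv.
have local k (A : set borelR) : measurable A -> exists m : nat, mu (A `&` W k) = m%:R%:E.
  have k0 : - k%:R <= k%:R :> R by apply: (@le_trans _ _ 0) => //; rewrite oppr_le0.
  have [mk mkE] := muI _ _ k0.
  apply: (@dynkin_induction _ borelR (@ocitv R) (fun A => exists m : nat, mu (A `&` W k) = m%:R%:E)).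
  - by [].
  - exact: ocitvI.
  - by exists mk; rewrite setTI.
  - move=> _ [[a b] _ <-]/=.
    have [ab|ba] := leP (Order.max a (- k%:R)) (Order.min b k%:R).
      have [m mE] := muI _ _ ab; exists m; rewrite -mE; congr (mu _).
      apply/seteqP; split => x /=; rewrite /W /= !in_itv/= gt_max le_min.
        by move=> [/andP[-> ->] /andP[-> ->]].
      by move=> /andP[/andP[-> ->] /andP[-> ->]].
    exists 0%N; rewrite (_ : _ `&` _ = set0) ?measure0//.
    apply/seteqP; split => x //=; rewrite /W /= !in_itv/= => -[/andP[h1 h2] /andP[h3 h4]].
    move: ba; rewrite ltNge => /negP; apply.
    by rewrite (@le_trans _ _ x)//; [rewrite ge_max !ltW|rewrite le_min h2].
  - move=> S mS [m mE]; exists (mk - m)%N.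
    have -> : ~` S `&` W k = W k `\` S by rewrite setDE setIC.
    have Wfin : mu (W k) \is a fin_num by rewrite mkE.
    have {}mkE : mu (W k) = mk%:R%:E by exact: mkE.
    have -> : mu (W k `\` S) = (mu (W k) - mu (W k `&` S))%E.
      by apply: measureD => //; rewrite [ltLHS]mkE ltry.
    rewrite setIC mE mkE -EFinB natrB//.
    by rewrite -(ler_nat R) -lee_fin -mE -mkE le_measure// inE//; exact: measurableI.
  - move=> F mF tF /choice[m mE].
    have mFW n : measurable (F n `&` W k) by exact: measurableI.
    have h : (\sum_(0 <= i < n) mu (F i `&` W k) @[n --> \oo] --> mu (\bigcup_n F n `&` W k))%E.
      rewrite setI_bigcupl; apply: measure_semi_sigma_additive => //.
      - exact: trivIset_setIr.
      - exact: bigcup_measurable.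
    have fin : mu (\bigcup_n F n `&` W k) \is a fin_num.
      rewrite ge0_fin_numE//; apply: (@le_lt_trans _ _ (mu (W k))); last by rewrite mkE ltry.
      by rewrite le_measure// inE//; apply: measurableI => //; exact: bigcup_measurable.
    have h2 : (\sum_(0 <= i < n) m i)%N%:R @[n --> \oo] --> fine (mu (\bigcup_n F n `&` W k)).
      move: h; rewrite -(fineK fin) => /fine_cvg.
      apply: cvg_trans; apply: near_eq_cvg; apply: nearW => n /=.
      by under eq_bigr do rewrite mE; rewrite sumEFin/= natr_sum.
    have [M ME] := nat_cvg h2.
    by exists M; rewrite -ME fineK.
move=> A mA Afin.
have /choice[m mE] : forall k, exists m : nat, mu (A `&` W k) = m%:R%:E by move=> k; exact: local.
have h : mu (A `&` W k) @[k --> \oo] --> mu A by exact: cvg_measure_windows.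
have fA : mu A \is a fin_num by rewrite ge0_fin_numE.
have h2 : (m k)%:R @[k --> \oo] --> fine (mu A).
  have : mu (A `&` W k) @[k --> \oo] --> (fine (mu A))%:E by rewrite fineK.
  move/fine_cvg; apply: cvg_trans; apply: near_eq_cvg; apply: nearW => n /=.
  by rewrite mE.
have [M ME] := nat_cvg h2.
by exists M; rewrite -ME fineK.
Qed.

Section stieltjes.
Variable c : rat -> rat -> nat.
Hypothesis c_add : forall p q t, p <= q -> q <= t -> c p t = (c p q + c q t)%N.
Hypothesis c_rc : forall q, exists2 q', q < q' & c q q' = 0%N.

(** A primitive of the increments on the rationals; F extends it to the real
    line, from the right. *)
Let N (q : rat) : R := if 0 <= q then (c 0 q)%:R else - (c q 0)%:R.

Let NB p q : p <= q -> N q - N p = (c p q)%:R.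
Proof.
move=> pq; rewrite /N; case: (leP 0 p) => p0; case: (leP 0 q) => q0.
- by rewrite (c_add p0 pq) natrD; ring.
- by have := le_lt_trans (le_trans p0 pq) q0; rewrite ltxx.
- by rewrite (c_add (ltW p0) q0) natrD; ring.
- by rewrite (c_add pq (ltW q0)) natrD; ring.
Qed.

Let Nle p q : p <= q -> N p <= N q.
Proof. by move=> pq; rewrite -subr_ge0 NB. Qed.

Let S (x : R) : set R := [set N q | q in [set q | x < ratr q]].

Let F (x : R) : R := inf (S x).

(** N is integer valued, so that the infimum defining F is attained. *)
Let FE x : exists q, [/\ x < ratr q, F x = N q & forall q', x < ratr q' -> N q <= N q'].
Proof.
have [q0 /andP[q0x _]] : exists q : rat, x < ratr q < x + 1.
  have h : x < x + 1 by rewrite ltrDl.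
  by have [q] := rat_in_itvoo h; rewrite in_itv/= => hq; exists q.
have [p0 /andP[_ p0x]] : exists q : rat, x - 1 < ratr q < x.
  have h : x - 1 < x by lra.
  by have [q] := rat_in_itvoo h; rewrite in_itv/= => hq; exists q.
have lb : lbound (S x) (N p0).
  move=> _ [q /= xq <-]; apply: Nle.
  by rewrite -(ler_rat R) ltW// (lt_trans p0x).
have hi : has_inf (S x) by split; [exists (N q0), q0|exists (N p0)].
have [_ [q xq <-] Nq] := inf_adherent (ltr01 : 0 < 1 :> R) hi.
pose m := c p0 q.
have min q' : x < ratr q' -> N q <= N q'.
  move=> xq'; rewrite leNgt; apply/negP => lt.
  have pq' : p0 <= q' by rewrite -(ler_rat R) ltW// (lt_trans p0x).
  have pq : p0 <= q by rewrite -(ler_rat R) ltW// (lt_trans p0x).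
  have := NB pq; have := NB pq'; move=> h1 h2.
  have : F x <= N q' by apply: ge_inf; [exists (N p0)|exists q'].
  have : (c p0 q').+1%:R <= (c p0 q)%:R :> R.
    by rewrite ler_nat -(ltr_nat R); lra.
  rewrite -natr1 /F; lra.
exists q; split => //; apply/eqP; rewrite eq_le; apply/andP; split.
  by apply: ge_inf; [exists (N p0)|exists q].
by apply: lb_le_inf; [exists (N q0), q0|move=> _ [q' /= xq' <-]; exact: min].
Qed.

Let Fq q : F (ratr q) = N q.
Proof.
have [q' [/= qq' -> h]] := FE (ratr q); rewrite ltr_rat in qq'.
have [q2 qq2 c0] := c_rc q.
have := h q2; rewrite ltr_rat => /(_ qq2).
have := NB (ltW qq2); rewrite c0; have := Nle (ltW qq'); lra.
Qed.

Let F_nd : {homo F : x y / x <= y}.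
Proof.
move=> x y xy; have [q [xq -> h]] := FE x; have [q' [yq -> _]] := FE y.
exact/h/(le_lt_trans xy).
Qed.

Let F_rc : forall x : R, F @ at_right x --> F x.
Proof.
move=> x; have [q [xq Fx h]] := FE x.
apply: cvg_near_cst; near=> y.
have xy : x < y by near: y; exact: nbhs_right_gt.
have yq : y < ratr q by near: y; exact: nbhs_right_lt.
apply/le_anti/andP; split; last exact/F_nd/ltW.
rewrite Fx; by have [q' [_ -> h']] := FE y; exact: h'.
Unshelve. all: by end_near. Qed.

HB.instance Definition _ := isCumulative.Build R _ R F F_nd F_rc.

Let mu : {measure set borelR -> \bar R} := lebesgue_stieltjes_measure F.

Let muE (a b : R) : a <= b -> mu `]a, b]%classic = (F b - F a)%:E.
Proof.
move=> ab; rewrite /mu/= /lebesgue_stieltjes_measure /measure_extension/=.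
by rewrite measurable_mu_extE/= ?wlength_itv_bnd//; exact: is_ocitv.
Qed.

Let muI (a b : R) : a <= b -> exists m : nat, mu `]a, b]%classic = m%:R%:E.
Proof.
move=> ab; rewrite muE//; have [q [aq -> h]] := FE a; have [q' [bq' -> _]] := FE b.
have [qq'|q'q] := leP q q'; first by exists (c q q'); rewrite NB.
exists 0%N; congr (_%:E); have := Nle (ltW q'q).
by have := h q' (le_lt_trans ab bq'); lra.
Qed.

Let mu_lf (r : R) : (mu `[(- r)%R, r]%classic < +oo)%E.
Proof.
apply: (@le_lt_trans _ _ (mu `]-(`|r| + 1)%R, (`|r| + 1)%R]%classic)).
  rewrite le_measure// ?inE//.
  move=> x /=; rewrite !in_itv/= => /andP[h1 h2].
  by have := ler_norm r; have := ler_norm (- r); rewrite normrN => *; apply/andP; split; lra.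
by rewrite muE ?ltry//; have := normr_ge0 r; lra.
Qed.

(** By c_rc, F extends N, and its Stieltjes measure has the prescribed mass on
    intervals with rational ends. This measure is integer valued by
    [integer_valued_measure]. *)
Lemma config_of_increments : exists xi : config R, forall p q, p <= q ->
  xi `](ratr p), (ratr q)]%classic = (c p q)%:R%:E.
Proof.
exists (Config mu_lf (integer_valued_measure muI)) => p q pq.
by rewrite [LHS]muE ?ler_rat// !Fq NB.
Qed.

End stieltjes.

End increments.

(** * Counting events generate the sigma-algebra *)

Section count_events.
Context (R : realType).
Local Notation borelR := (measurableTypeR R).
Implicit Types (xi : config R).

Definition rat_itv (p q : rat) : set borelR := `](ratr p), (ratr q)]%classic.

Lemma measurable_rat_itv p q : measurable (rat_itv p q).
Proof. exact: measurable_itv. Qed.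

Lemma rat_itv_sub p q :
  rat_itv p q `<=` `[- (`|ratr p| + `|ratr q| : R), `|ratr p| + `|ratr q|]%classic.
Proof.
move=> x; rewrite /rat_itv /= !in_itv/= => /andP[h1 h2].
have := ler_norm (- (ratr p : R)); have := ler_norm (ratr q : R).
have := normr_ge0 (ratr p : R); have := normr_ge0 (ratr q : R).
by rewrite normrN => *; apply/andP; split; lra.
Qed.

Lemma rat_itvI p q p' q' : rat_itv p q `&` rat_itv p' q' =
  rat_itv (Order.max p p') (Order.min q q').
Proof.
apply/seteqP; split => x; rewrite /rat_itv/= !in_itv/=.
  move=> [/andP[h1 h2] /andP[h3 h4]].
  by apply/andP; split; [case: (leP p p')|case: (leP q q')].
case: (leP p p') => pp; case: (leP q q') => qq; move=> /andP[h1 h2];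
  (have := pp; have := qq; rewrite -?(ltr_rat R) -?(ler_rat R) => qq' pp');
  by split; apply/andP; split; lra.
Qed.

Lemma config_nat xi A : measurable A -> (exists r : R, A `<=` `[- r, r]%classic) ->
  exists k : nat, xi A = k%:R%:E.
Proof.
move=> mA [r Ar]; apply: config_integer_valued => //.
exact: config_bounded_ltry Ar.
Qed.

Lemma config_rat_itv xi p q : exists k : nat, xi (rat_itv p q) = k%:R%:E.
Proof.
apply: config_nat; first exact: measurable_rat_itv.
by eexists; exact: rat_itv_sub.
Qed.

Definition at_least (z : rat * rat * nat) : set (config R) :=
  [set xi | (z.2%:R%:E <= xi (rat_itv z.1.1 z.1.2))%E].

Lemma measurable_at_least z : measurable (at_least z).
Proof.
have := measurable_config_eval (measurable_rat_itv z.1.1 z.1.2).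
move=> /(_ measurableT _ (emeasurable_itv `[z.2%:R%:E, +oo[)).
rewrite setTI; congr (measurable _); apply/seteqP; split => xi /=;
  rewrite in_itv/= andbT//.
Qed.

Lemma measurable_rat_itv_gen (A : set borelR) : measurable A ->
  <<s [set rat_itv z.1 z.2 | z in [set: rat * rat]] >> A.
Proof.
move: A; apply: smallest_sub; first exact: smallest_sigma_algebra.
move=> _ [[a b] _ <-] /=.
pose G : set_system R := [set rat_itv z.1 z.2 | z in [set: rat * rat]].
pose T := g_sigma_algebraType G.
suff : @measurable _ T `]a, b]%classic by [].
have mG p q : @measurable _ T (rat_itv p q).
  by apply: sub_sigma_algebra; exists (p, q).
(* ]a, b] is the union over p > a of the intersection over q > b of ]p, q]. *)
pose H p q : set R := if b < ratr q then rat_itv p q else setT.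
pose K p : set R := if a < ratr p then \bigcap_(q in [set: rat]) H p q else set0.
have -> : `]a, b]%classic = \bigcup_(p in [set: rat]) K p.
  apply/seteqP; split => x /=; rewrite in_itv/=.
    move=> /andP[ax xb]; have [p] := rat_in_itvoo ax; rewrite in_itv/= => /andP[ap px].
    exists p => //; rewrite /K ap => q _; rewrite /H; case: ifPn => // bq.
    by rewrite /rat_itv/= in_itv/= px/= ltW// (le_lt_trans xb).
  move=> [p _]; rewrite /K; case: ifPn => // ap h; apply/andP; split.
    have b1 : b < b + 1 by rewrite ltrDl.
    have [q] := rat_in_itvoo b1; rewrite in_itv/= => /andP[bq _].
    by have := h q I; rewrite /H bq /rat_itv/= in_itv/= => /andP[/(lt_trans ap)].
  rewrite leNgt; apply/negP => bx.
  have [q] := rat_in_itvoo bx; rewrite in_itv/= => /andP[bq qx].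
  by have := h q I; rewrite /H bq /rat_itv/= in_itv/= => /andP[_]; rewrite leNgt qx.
apply: (@bigcupT_measurable_rat _ T) => p; rewrite /K; case: ifP => // _.
rewrite -(setCK (\bigcap_(q in _) _)); apply: measurableC.
rewrite setC_bigcap; apply: (@bigcupT_measurable_rat _ T) => q.
by apply: measurableC; rewrite /H; case: ifP => // _; exact: measurableT.
Qed.

(** The number of points in a rational interval is the sum over m >= 1 of the
    indicators of the events of having at least m points. Other Borel sets are
    reached by a Dynkin argument inside each bounded window. *)
Lemma measurable_to_config_at_least d (T : measurableType d) (f : T -> config R) :
  (forall z, measurable [set t | at_least z (f t)]) -> measurable_fun setT f.
Proof.
move=> mf.
have mrat p q : measurable_fun setT (fun t => f t (rat_itv p q)).
  apply: (emeasurable_fun_cvg (fun n : nat => fun t =>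
    (\sum_(m < n) (\1_[set t | at_least (p, q, m.+1) (f t)] t : R))%:E)).
    move=> n; apply/measurable_EFinP; apply: measurable_sum => m.
    exact: measurable_indic.
  move=> t _; have [k kE] := config_rat_itv (f t) p q.
  rewrite kE; apply: cvg_near_cst; exists k => // n /= kn.
  congr (_%:E); rewrite (eq_bigr (fun m : 'I_n => (m < k)%N%:R)); last first.
    move=> m _; rewrite indicE; congr (_%:R); congr nat_of_bool.
    apply/idP/idP.
      by rewrite inE /at_least/= kE lee_fin ler_nat.
    by move=> mk; rewrite inE /at_least/= kE lee_fin ler_nat.
  rewrite -natr_sum; congr (_%:R).
  rewrite -(big_mkord xpredT (fun m => (m < k)%N : nat)) (@big_cat_nat _ _ _ k)//=.
  rewrite [X in (_ + X)%N]big_nat_cond [X in (_ + X)%N]big1 ?addn0; last first.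
    by move=> i /andP[/andP[ki _] _]; rewrite ltnNge ki.
  rewrite big_nat_cond (eq_bigr (fun=> 1%N)); last by move=> i /andP[/andP[_ ->]].
  by rewrite -big_nat_cond sum_nat_const_nat subn0 muln1.
apply: measurable_to_config => A mA.
pose W (k : nat) : set borelR := rat_itv (- k%:R) k%:R.
have mW k : measurable (W k) by exact: measurable_rat_itv.
have WE k : W k = `](- k%:R), k%:R]%classic.
  by rewrite /W /rat_itv rmorphN/= ratr_nat.
suff H k (S : set borelR) : measurable S -> measurable_fun setT (fun t => f t (S `&` W k)).
  apply: (emeasurable_fun_cvg (fun n : nat => fun t => f t (A `&` W n))).
    by move=> n; exact: H.
  by move=> t _; under eq_fun do rewrite WE; exact: cvg_measure_windows.
move=> mS.
have finW t : f t (W k) \is a fin_num by have [m ->] := config_rat_itv (f t) (- k%:R) k%:R.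
apply: (@dynkin_induction _ borelR [set rat_itv z.1 z.2 | z in [set: rat * rat]]
  (fun S => measurable_fun setT (fun t => f t (S `&` W k)))).
- apply/seteqP; split; first exact: measurable_rat_itv_gen.
  apply: smallest_sub; first exact: sigma_algebra_measurable.
  by move=> _ [[p q] _ <-]; exact: measurable_rat_itv.
- move=> _ _ [[p q] _ <-] [[p' q'] _ <-]; exists (Order.max p p', Order.min q q') => //.
  exact/esym/rat_itvI.
- by under eq_fun do rewrite setTI; exact: mrat.
- by move=> _ [[p q] _ <-]; under eq_fun do rewrite rat_itvI; exact: mrat.
- move=> B mB h.
  rewrite (_ : (fun t => _) = (fun t => f t (W k) - f t (B `&` W k)))%E.
    by apply: emeasurable_funB => //; exact: mrat.
  apply/funext => t; have -> : ~` B `&` W k = W k `\` B by rewrite setDE setIC.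
  rewrite setIC; apply: measureD => //; rewrite -ge0_fin_numE//; exact: finW.
- move=> F mF tF h.
  rewrite (_ : (fun t => _) = (fun t => \sum_(n <oo) f t (F n `&` W k)))%E.
    by apply: ge0_emeasurable_sum.
  apply/funext => t; rewrite setI_bigcupl measure_bigcup//=.
  - by apply: eq_eseriesl => n; rewrite in_setT.
  - by move=> n _; exact: measurableI.
  - exact: trivIset_setIr.
- exact: measurable_rat_itv_gen.
Qed.

(** A single sequence lists the events for all intervals and all thresholds, so
    that a configuration is encoded by a sequence of bits. *)
Definition event (i : nat) : set (config R) :=
  if unpickle i is Some z then at_least z else set0.

Lemma eventE z : event (pickle z) = at_least z.
Proof. by rewrite /event pickleK. Qed.

Lemma measurable_event i : measurable (event i).
Proof. by rewrite /event; case: unpickle => // z; exact: measurable_at_least. Qed.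

Lemma measurable_to_config_event d (T : measurableType d) (f : T -> config R) :
  (forall i, measurable [set t | event i (f t)]) -> measurable_fun setT f.
Proof.
move=> mf; apply: measurable_to_config_at_least => z.
by rewrite -(eventE z).
Qed.

Definition events (s : seq nat) : set (config R) :=
  [set xi | forall i, i \in s -> event i xi].

Lemma events_cat s1 s2 : events (s1 ++ s2) = events s1 `&` events s2.
Proof.
apply/seteqP; split => xi /=.
  by move=> h; split=> i si; apply: h; rewrite mem_cat si ?orbT.
by move=> [h1 h2] i; rewrite mem_cat => /orP[/h1|/h2].
Qed.

Lemma measurable_events s : measurable (events s).
Proof.
elim: s => [|i s ih].
  by rewrite (_ : events _ = setT)//; apply/seteqP; split.
rewrite -cat1s events_cat; apply: measurableI => //.
rewrite (_ : events _ = event i); first exact: measurable_event.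
apply/seteqP; split => xi /=; first by apply; rewrite mem_head.
by move=> h j; rewrite inE => /eqP ->.
Qed.

Lemma config_measurable_events :
  @measurable _ (config R) = <<s [set events s | s in [set: seq nat]] >>.
Proof.
pose G := [set events s | s in [set: seq nat]].
apply/seteqP; split => [A mA|]; last first.
  apply: smallest_sub; first exact: sigma_algebra_measurable.
  by move=> _ [s _ <-]; exact: measurable_events.
pose T := g_sigma_algebraType G.
have mid : measurable_fun [set: T] (id : T -> config R).
  apply: measurable_to_config_event => i.
  apply: sub_sigma_algebra; exists [:: i] => //.
  apply/seteqP; split => xi /=; first by apply; rewrite mem_head.
  by move=> h j; rewrite inE => /eqP ->.
by have := mid measurableT A mA; rewrite setTI.
Qed.

Lemma setI_closed_events : setI_closed [set events s | s in [set: seq nat]].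
Proof.
by move=> _ _ [s1 _ <-] [s2 _ <-]; exists (s1 ++ s2) => //; exact: events_cat.
Qed.

(** The finite intersections of counting events form a pi-system that generates
    the sigma-algebra of configurations. *)
Lemma events_dynkin (H : set (set (config R))) :
  H setT -> (forall s, H (events s)) ->
  (forall S, measurable S -> H S -> H (~` S)) ->
  (forall F : (set (config R))^nat, (forall n, measurable (F n)) ->
    trivIset setT F -> (forall n, H (F n)) -> H (\bigcup_k F k)) ->
  forall S, measurable S -> H S.
Proof.
move=> HT Hs HC HU S; rewrite config_measurable_events.
apply: (dynkin_induction config_measurable_events setI_closed_events) => //.
by move=> _ [s _ <-].
Qed.

End count_events.

(** * The limit bits come from a configuration *)

Section bits_to_config.
Context (R : realType).
Variable x : nat -> bool.
Let y (p q : rat) (m : nat) := x (pickle (p, q, m)).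
Hypothesis x_code : forall i,
  x i = if unpickle i is Some z then x (pickle (z : rat * rat * nat)) else false.
Hypothesis y_ge0 : forall p q, y p q 0.
Hypothesis y_mono : forall p q m, y p q m.+1 -> y p q m.
Hypothesis y_superadd : forall p q t m l, p <= q -> q <= t ->
  y p q m -> y q t l -> y p t (m + l).
Hypothesis y_subadd : forall p q t m l, p <= q -> q <= t ->
  y p t (m + l).+1 -> y p q m.+1 || y q t l.+1.
Hypothesis y_empty : forall p q, q <= p -> ~~ y p q 1.
Hypothesis y_finite : forall p q, exists m, ~~ y p q m.
Hypothesis y_right : forall q, exists j : nat, ~~ y q (q + j.+1%:R^-1) 1.

Let c_ex p q : exists c, forall m, y p q m = (m <= c)%N.
Proof.
have mono m m' : (m' <= m)%N -> y p q m -> y p q m'.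
  move=> /subnK <-; elim: (m - m')%N => // k ih; rewrite addSn => h.
  exact/ih/y_mono.
case: (ex_minnP (y_finite p q)) => M yM minM.
have M0 : (0 < M)%N by case: M yM {minM} => //; rewrite y_ge0.
exists M.-1 => m; apply/idP/idP.
  by move=> ym; rewrite -ltnS prednK// ltnNge; apply: contra yM => /mono; exact.
move=> mM; apply/negPn/negP => /minM; rewrite leqNgt => /negP; apply.
by rewrite -(prednK M0).
Qed.

(** The bits of a configuration satisfy all the relations assumed of x.
    Conversely, let c p q be the largest m whose bit (p, q, m) is set: it exists by
    y_finite, is additive by y_superadd and y_subadd, and right-continuous by
    y_right. *)
Lemma config_of_bits : exists xi : config R, forall i, (xi \in @event R i) = x i.
Proof.
have /choice[c' hc'] : forall pq : rat * rat, exists c, forall m, y pq.1 pq.2 m = (m <= c)%N.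
  by move=> [p q]; exact: c_ex.
pose c p q := c' (p, q); have hc p q m : y p q m = (m <= c p q)%N by exact: (hc' (p, q)).
have c_add p q t : p <= q -> q <= t -> c p t = (c p q + c q t)%N.
  move=> pq qt; apply/eqP; rewrite eqn_leq -[X in _ && X]hc; apply/andP; split.
    rewrite leqNgt -hc; apply/negP => /(y_subadd pq qt).
    by rewrite !hc !ltnn.
  by apply: (y_superadd pq qt); rewrite hc.
have c_rc q : exists2 q', q < q' & c q q' = 0%N.
  have [j] := y_right q; rewrite hc -ltnNge ltnS leqn0 => /eqP c0.
  by exists (q + j.+1%:R^-1) => //; rewrite ltrDl invr_gt0.
have [xi xiE] := config_of_increments R c_add c_rc.
have E p q m : (xi \in @at_least R (p, q, m)) = y p q m.
  have [pq|qp] := leP p q.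
    rewrite hc; apply/idP/idP.
      by rewrite inE /at_least/= /rat_itv xiE// lee_fin ler_nat.
    by move=> h; rewrite inE /at_least/= /rat_itv xiE// lee_fin ler_nat.
  have -> : y p q m = (m == 0%N).
    case: m => [|m]; first by rewrite y_ge0.
    by apply/negbTE; have := y_empty (ltW qp); rewrite !hc; apply: contra; exact: leq_trans.
  have I0 : @rat_itv R p q = set0.
    by rewrite /rat_itv set_itv_ge// bnd_simp -leNgt ler_rat ltW.
  apply/idP/idP; rewrite inE /at_least/= I0 measure0 lee_fin lern0//.
exists xi => i; rewrite x_code /event; case: unpickle => [[[p q] m]|].
  exact: E.
by rewrite in_set0.
Qed.

End bits_to_config.

Section limit_process.
Context (R : realType).
Local Notation borelR := (measurableTypeR R).
Variable Q : nat -> probability (config R) R.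
Hypothesis Q_equi : equicontinuous Q.

Lemma equicontinuous_sets r (A : nat -> set (config R)) : (0 < r)%N ->
  (forall j, measurable (A j)) -> (forall j, insens (@window R r) (fun xi => xi \in A j)) ->
  (forall xi, \forall j \near \oo, ~ A j xi) ->
  forall e, 0 < e -> \forall j \near \oo, forall n, (Q n (A j) <= e%:E)%E.
Proof.
move=> r0 mA iA A0 e e0.
have := @Q_equi r 1 (fun j => \1_(A j)) r0 ler01.
case/(_ _ _ _ _ _ e e0).
- by move=> j; exact: measurable_indic.
- by move=> j xi.
- by move=> j x xi wx; rewrite !indicE iA.
- move=> j xi; rewrite mul1r indicE; apply: (@le_trans _ _ 1).
    by rewrite lern1 leq_b1.
  by rewrite lerDl count_ge0.
- move=> xi; apply: cvg_near_cst; apply: filterS (A0 xi) => j nA.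
  by rewrite indicE memNset.
move=> N _ hN; exists N => // j /hN + n => /(_ n).
by rewrite integral_indic// setIT.
Qed.

Lemma insens_at_least r z : @rat_itv R z.1.1 z.1.2 `<=` @window R r ->
  insens (@window R r) (fun xi => xi \in @at_least R z).
Proof.
move=> sub x xi wx; have x0 : \1_(@rat_itv R z.1.1 z.1.2) x = 0 :> R.
  by rewrite indicE memNset// => /sub.
apply/idP/idP; rewrite !inE /at_least/= add_pointE x0 adde0//.
Qed.

Lemma rat_itv_window p q : exists2 r, (0 < r)%N & @rat_itv R p q `<=` @window R r.
Proof.
exists (Num.truncn (`|ratr p| + `|ratr q| : R)).+1 => // x.
have := truncnS_gt (`|ratr p| + `|ratr q| : R).
set r := (Num.truncn _).+1 => hr.
rewrite /window /rat_itv/= !in_itv/= => /andP[h1 h2].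
have := ler_norm (- ratr p : R); have := ler_norm (ratr q : R); rewrite normrN.
have := normr_ge0 (ratr p : R); have := normr_ge0 (ratr q : R).
by move=> *; apply/andP; split; lra.
Qed.

Lemma ae_countable d (T : measurableType d) (mu : {measure set T -> \bar R})
    (I : countType) (P : I -> T -> Prop) :
  (forall i, {ae mu, forall t, P i t}) -> {ae mu, forall t, forall i, P i t}.
Proof.
move=> h; have := @ae_foralln _ _ _ mu
  (fun n t => if unpickle n is Some i then P i t else True).
case=> [n|].
  case: unpickle => [i|]; first exact: h.
  exact: filterT.
move=> A [mA A0 hA]; exists A; split => // t /= nP; apply: hA => /= h'.
by apply: nP => i; have := h' (pickle i); rewrite pickleK.
Qed.

Variables (phi : nat -> nat) (p : seq bool -> R).
Hypothesis conv : forall k (g : pred (seq bool)),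
  fine (Q (phi n) [set t | g (code (@event R) k t)]) @[n --> \oo] -->
  fine (leb01 [set u | g (tree_bits p k u)]).

Definition bit (i : nat) (u : R) : bool := nth false (tree_bits p i.+1 u) 0.

Let nth_bit k i u : (i < k)%N -> nth false (tree_bits p k u) (k - i.+1) = bit i u.
Proof.
elim: k => // k ih; rewrite ltnS leq_eqVlt => /predU1P[->|ik].
  by rewrite subnn.
by rewrite subSS -(subnSK ik)/= ih.
Qed.

Let nth_code k i xi : (i < k)%N ->
  nth false (code (@event R) k xi) (k - i.+1) = (xi \in @event R i).
Proof.
elim: k => // k ih; rewrite ltnS leq_eqVlt => /predU1P[->|ik].
  by rewrite subnn.
by rewrite subSS -(subnSK ik)/= ih.
Qed.

Definition depends_below (k : nat) (B : (nat -> bool) -> bool) :=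
  forall x y : nat -> bool, (forall i, (i < k)%N -> x i = y i) -> B x = B y.

Lemma measurable_tree_pred k (g : pred (seq bool)) :
  @measurable _ borelR [set u | g (tree_bits p k u)].
Proof.
by have [] := @prob_code _ _ R (@leb01 R : probability _ R) (tree_bits p k) k g (size_tree_bits p k)
  (fun w wk => eq_rect _ (fun j => measurable [set u | tree_bits p j u == w])
     (measurable_tree_bits p w) _ wk).
Qed.

Lemma cvg_bits k B : depends_below k B ->
  @measurable _ borelR [set u | B (bit^~ u)] /\
  fine (Q (phi n) [set xi | B (fun i => xi \in @event R i)]) @[n --> \oo] -->
  fine (leb01 [set u | B (bit^~ u)]).
Proof.
move=> Bk; pose g (w : seq bool) := B (fun i => nth false w (k - i.+1)).
have E1 : [set u | B (bit^~ u)] = [set u | g (tree_bits p k u)].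
  by apply/seteqP; split => u /=; rewrite /g (Bk _ (bit^~ u)) // => i; exact: nth_bit.
have E2 : [set xi | B (fun i => xi \in @event R i)] = [set xi | g (code (@event R) k xi)].
  by apply/seteqP; split => xi /=;
    rewrite /g (Bk _ (fun i => xi \in @event R i)) // => i; exact: nth_code.
rewrite E1 E2; split; [exact: measurable_tree_pred|exact: conv].
Qed.

(** A relation between finitely many bits that holds for all configurations has
    probability 1 along the sequence, hence in the limit. *)
Lemma ae_bits k B : depends_below k B ->
  (forall xi : config R, B (fun i => xi \in @event R i)) ->
  {ae @leb01 R, forall u, B (bit^~ u)}.
Proof.
move=> Bk hB; have [mB cB] := cvg_bits Bk.
have B1 : fine (leb01 [set u | B (bit^~ u)]) = 1.
  apply: (cvg_unique _ cB) => //.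
  rewrite (_ : (fun n => _) = cst 1); first exact: cvg_cst.
  apply/funext => n /=; rewrite (_ : [set xi | _] = setT) ?probability_setT//.
  by apply/seteqP; split => // xi _; exact: hB.
exists (~` [set u | B (bit^~ u)]); split.
- exact: measurableC.
- have -> := @probability_setC _ _ _ (@leb01 R : probability _ R) _ mB.
  have fB : leb01 [set u | B (bit^~ u)] \is a fin_num by exact: (@fin_num_measure _ _ _ (@leb01 R : probability _ R)).
  by rewrite -[X in (_ - X)%E](fineK fB) B1 subee.
- by [].
Qed.

(** The existence of a vanishing bit involves infinitely many bits and could be
    lost in the limit. By equicontinuity the events have small probabilities for
    large j, uniformly along the sequence, hence so do the limit bits. *)
Lemma ae_exists_bit (i_ : nat -> nat) r : (0 < r)%N ->
  (forall j, insens (@window R r) (fun xi => xi \in @event R (i_ j))) ->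
  (forall xi, \forall j \near \oo, ~ @event R (i_ j) xi) ->
  {ae @leb01 R, forall u, exists j, ~~ bit (i_ j) u}.
Proof.
move=> r0 iE E0.
have mE j := @measurable_event R (i_ j).
have dep j : depends_below (i_ j).+1 (fun x => x (i_ j)) by move=> x y; apply.
have mb j := (cvg_bits (dep j)).1.
exists (\bigcap_j [set u | bit (i_ j) u]); split.
- exact: bigcapT_measurable.
- apply/eqP; rewrite eq_le measure_ge0 andbT.
  apply/lee_addgt0Pr => e e0; rewrite add0e.
  have [N _ /(_ N (leqnn _)) hN] := equicontinuous_sets r0 mE iE E0 e0.
  apply: (@le_trans _ _ (leb01 [set u | bit (i_ N) u])).
    apply: le_measure; rewrite ?inE//; first exact: bigcapT_measurable.
    exact: bigcap_inf.
  have fb : leb01 [set u | bit (i_ N) u] \is a fin_num by exact: (@fin_num_measure _ _ _ (@leb01 R : probability _ R)).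
  rewrite -(fineK fb) lee_fin.
  apply: (cvgr_to_le (cvg_bits (dep N)).2); apply: nearW => n /=.
  rewrite -lee_fin fineK; last first.
    by apply: fin_num_measure; rewrite set_mem_set.
  by rewrite set_mem_set; exact: hN.
- move=> u /= h j _ /=; apply/negPn/negP => nb; apply: h; exists j.
  exact: nb.
Qed.

Let code3 (a b : rat) (m : nat) : nat := pickle (a, b, m).

Let in_event xi a b m : (xi \in @event R (code3 a b m)) =
  (m%:R%:E <= xi (rat_itv a b))%E.
Proof. by rewrite eventE; apply/idP/idP; rewrite inE. Qed.

Let event_code3 (xi : config R) a b m :
  event (code3 a b m) xi = ((m%:R%:E <= xi (rat_itv a b))%E : Prop).
Proof. by rewrite eventE. Qed.

Let depends1 (i : nat) (f : bool -> bool) : depends_below i.+1 (fun x => f (x i)).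
Proof. by move=> x y xy; rewrite xy. Qed.

Let depends2 (i j : nat) (f : bool -> bool -> bool) :
  depends_below (maxn i j).+1 (fun x => f (x i) (x j)).
Proof. by move=> x y xy; rewrite !xy// ltnS ?leq_maxl ?leq_maxr. Qed.

Let depends3 (i j k : nat) (f : bool -> bool -> bool -> bool) :
  depends_below (maxn i (maxn j k)).+1 (fun x => f (x i) (x j) (x k)).
Proof. by move=> x y xy; rewrite !xy// ltnS !leq_max leqnn ?orbT. Qed.

Let rat_itvD (xi : config R) a b t : a <= b -> b <= t ->
  xi (@rat_itv R a t) = (xi (rat_itv a b) + xi (rat_itv b t))%E.
Proof.
move=> ab bt; rewrite -measureU.
- congr (config_measure xi _).
  apply/seteqP; split => x; rewrite /rat_itv/= !in_itv/=.
    move=> /andP[ax xt]; rewrite ax xt andbT /=; case: (leP x (ratr b)); [left|right] => //.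
  have ab' : ratr a <= ratr b :> R by rewrite ler_rat.
  have bt' : ratr b <= ratr t :> R by rewrite ler_rat.
  by case=> /andP[h1 h2]; apply/andP; split; lra.
- exact: measurable_rat_itv.
- exact: measurable_rat_itv.
- apply/seteqP; split => x //=; rewrite /rat_itv/= !in_itv/=.
  by move=> [/andP[_ h1] /andP[h2 _]]; move: h1; rewrite leNgt h2.
Qed.

(** Of the relations assumed in [config_of_bits], finiteness of the counts and
    right-continuity are those that involve infinitely many bits. *)
Lemma ae_bits_config : {ae @leb01 R, forall u, exists xi : config R,
  forall i, (xi \in event i) = bit i u}.
Proof.
have A0 : {ae @leb01 R, forall u, forall i,
    bit i u == if unpickle i is Some z then bit (pickle (z : rat * rat * nat)) u else false}.
  apply: (@ae_countable _ _ _ nat (fun i u => _ == _ :> bool)) => i; case E : (unpickle i) => [z|].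
    apply: (ae_bits (@depends2 i (pickle z) (fun a b => a == b))) => xi.
    by rewrite eventE /event E.
  by apply: (ae_bits (@depends1 i (fun a => a == false))) => xi; rewrite /event E in_set0.
have A1 : {ae @leb01 R, forall u, forall z : rat * rat, bit (code3 z.1 z.2 0) u}.
  apply: ae_countable => z; apply: (ae_bits (@depends1 (code3 z.1 z.2 0) id)) => xi.
  by rewrite in_event; exact: measure_ge0.
have A2 : {ae @leb01 R, forall u, forall z : rat * rat * nat,
    bit (code3 z.1.1 z.1.2 z.2.+1) u ==> bit (code3 z.1.1 z.1.2 z.2) u}.
  apply: ae_countable => z.
  apply: (ae_bits (@depends2 (code3 z.1.1 z.1.2 z.2.+1) (code3 z.1.1 z.1.2 z.2) implb)) => xi.
  rewrite !in_event; apply/implyP; apply: le_trans.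
  by rewrite lee_fin ler_nat.
have A3 : {ae @leb01 R, forall u, forall z : rat * rat * rat * nat * nat,
    (z.1.1.1.1 <= z.1.1.1.2) ==> (z.1.1.1.2 <= z.1.1.2) ==>
    (bit (code3 z.1.1.1.1 z.1.1.1.2 z.1.2) u ==> bit (code3 z.1.1.1.2 z.1.1.2 z.2) u ==>
    bit (code3 z.1.1.1.1 z.1.1.2 (z.1.2 + z.2)) u)}.
  apply: ae_countable => -[[[[a b] t] m] l] /=.
  apply: (ae_bits (@depends3 (code3 a b m) (code3 b t l) (code3 a t (m + l))
    (fun x y z => (a <= b) ==> (b <= t) ==> (x ==> y ==> z)))) => xi.
  apply/implyP => ab; apply/implyP => bt; rewrite !in_event (rat_itvD _ ab bt).
  apply/implyP => h1; apply/implyP => h2; rewrite natrD EFinD; exact: leeD.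
have A4 : {ae @leb01 R, forall u, forall z : rat * rat * rat * nat * nat,
    (z.1.1.1.1 <= z.1.1.1.2) ==> (z.1.1.1.2 <= z.1.1.2) ==>
    (bit (code3 z.1.1.1.1 z.1.1.2 (z.1.2 + z.2).+1) u ==>
      bit (code3 z.1.1.1.1 z.1.1.1.2 z.1.2.+1) u || bit (code3 z.1.1.1.2 z.1.1.2 z.2.+1) u)}.
  apply: ae_countable => -[[[[a b] t] m] l] /=.
  apply: (ae_bits (@depends3 (code3 a t (m + l).+1) (code3 a b m.+1) (code3 b t l.+1)
    (fun x y z => (a <= b) ==> (b <= t) ==> (x ==> y || z)))) => xi.
  apply/implyP => ab; apply/implyP => bt; rewrite !in_event (rat_itvD _ ab bt).
  have [i ->] := config_rat_itv xi a b; have [j ->] := config_rat_itv xi b t.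
  rewrite -EFinD -natrD !lee_fin !ler_nat; apply/implyP; lia.
have A5 : {ae @leb01 R, forall u, forall z : rat * rat,
    (z.2 <= z.1) ==> ~~ bit (code3 z.1 z.2 1) u}.
  apply: ae_countable => -[a b] /=.
  apply: (ae_bits (@depends1 (code3 a b 1) (fun x => (b <= a) ==> ~~ x))) => xi.
  apply/implyP => ba; rewrite in_event (_ : rat_itv a b = set0) ?measure0 ?lee_fin ?lern0//.
  by rewrite /rat_itv set_itv_ge// bnd_simp -leNgt ler_rat.
have A6 : {ae @leb01 R, forall u, forall z : rat * rat, exists m, ~~ bit (code3 z.1 z.2 m) u}.
  apply: ae_countable => -[a b] /=.
  have [r r0 sub] := rat_itv_window a b.
  apply: (ae_exists_bit r0) => [m|xi].
    by rewrite eventE; apply: insens_at_least.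
  have [k kE] := config_rat_itv xi a b.
  have : \forall m \near \oo, (k < m)%N by exact: nbhs_infty_gt.
  apply: filterS => m km; rewrite event_code3 kE lee_fin ler_nat.
  by apply/negP; rewrite -ltnNge.
have A7 : {ae @leb01 R, forall u, forall q : rat,
    exists j : nat, ~~ bit (code3 q (q + j.+1%:R^-1) 1) u}.
  apply: ae_countable => q.
  have [r r0 sub] := rat_itv_window q (q + 1).
  have mono i j : (i <= j)%N -> rat_itv q (q + j.+1%:R^-1) `<=` @rat_itv R q (q + i.+1%:R^-1).
    move=> ij x; rewrite /rat_itv/= !in_itv/= => /andP[-> /le_trans]; apply.
    by rewrite ler_rat lerD2l lef_pV2 ?posrE// ler_nat.
  apply: (ae_exists_bit r0) => [j|xi].
    rewrite eventE; apply: insens_at_least => /=; apply: subset_trans sub.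
    by have := mono 0%N j (leq0n j); rewrite invr1.
  have h : xi (rat_itv q (q + n.+1%:R^-1)) @[n --> \oo] --> xi set0.
    rewrite (_ : set0 = \bigcap_n @rat_itv R q (q + n.+1%:R^-1)); last first.
      apply/seteqP; split => // x /= hx.
      have := hx 0%N I; rewrite /rat_itv/= in_itv/= => /andP[qx _].
      have [q' ] := rat_in_itvoo qx; rewrite in_itv/= ltr_rat => /andP[qq' q'x].
      have [j jq] : exists j : nat, j.+1%:R^-1 < q' - q.
        exists (Num.truncn (q' - q)^-1).
        rewrite invf_plt ?posrE ?subr_gt0//; exact: truncnS_gt.
      have := hx j I; rewrite /rat_itv/= in_itv/= => /andP[_]; apply/negP.
      rewrite -ltNge; apply: lt_trans q'x; by rewrite ltr_rat -ltrBrDl.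
    apply: nonincreasing_cvg_mu.
    - have [k ->] := config_rat_itv xi q (q + 1%:R^-1); exact: ltry.
    - by move=> n; exact: measurable_rat_itv.
    - by apply: bigcapT_measurable => n; exact: measurable_rat_itv.
    - by move=> i j ij; apply/subsetPset; exact: mono.
  move: h; rewrite measure0 => h.
  have : \forall n \near \oo, (xi (rat_itv q (q + n.+1%:R^-1)) < 1)%E.
    by apply: (h _ (open_ereal_lt' _)); rewrite lte_fin.
  apply: filterS => n hn; rewrite event_code3; apply/negP.
  by rewrite -ltNge.
have FF : Filter (almost_everywhere (@leb01 R)).
  exact: (@ae_filter_ringOfSetsType _ _ _ (@leb01 R : {measure set _ -> \bar R})).
apply: filterS (filterI A0 (filterI A1 (filterI A2 (filterI A3
  (filterI A4 (filterI A5 (filterI A6 A7))))))).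
move=> u [h0 [h1 [h2 [h3 [h4 [h5 [h6 h7]]]]]]].
apply: config_of_bits.
- by move=> i; exact/eqP/h0.
- by move=> a b; exact: (h1 (a, b)).
- by move=> a b m; apply/implyP; exact: (h2 (a, b, m)).
- move=> a b t m l ab bt; have /= := h3 (a, b, t, m, l).
  by rewrite ab bt/= => /implyP h /h/implyP; exact.
- move=> a b t m l ab bt; have /= := h4 (a, b, t, m, l).
  by rewrite ab bt/= => /implyP; exact.
- by move=> a b ba; have /= := h5 (a, b); rewrite ba.
- by move=> a b; exact: (h6 (a, b)).
- by move=> q; exact: h7.
Qed.

End limit_process.

(** The limit is the law of the configuration decoded from the bits of a uniform
    point of [0, 1[; on the null set where decoding fails, it is set to be empty. *)
Theorem equicontinuous_cvg_events (R : realType) (Q : nat -> probability (config R) R) :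
  equicontinuous Q ->
  exists (phi : nat -> nat) (P : probability (config R) R),
    {homo phi : i j / (i < j)%N} /\
    forall s, fine (Q (phi n) (events s)) @[n --> \oo] --> fine (P (events s)).
Proof.
move=> Qe; have [phi [p [hphi [p0 pge ps] conv]]] := limit_code Q (@measurable_event R).
have [N [mN N0 hN]] := ae_bits_config Qe conv.
have /choice[Xi hXi] : forall u : measurableTypeR R, exists xi : config R,
    if u \in N then xi = config0 R else forall i, (xi \in event i) = bit p i u.
  move=> u; have [_|] := boolP (u \in N); first by exists (config0 R).
  rewrite notin_setE => Nu; apply: contrapT => h; apply: Nu; exact: hN.
have mbit i : @measurable _ (measurableTypeR R) [set u | bit p i u].
  have dep : depends_below i.+1 (fun x => x i) by move=> x y; apply.
  exact: (cvg_bits conv dep).1.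
have mXi : measurable_fun setT Xi.
  apply: measurable_to_config_event => i.
  rewrite (_ : [set t | _] = (N `&` [set _ | event i (config0 R)]) `|` (~` N `&` [set u | bit p i u])).
    apply: measurableU; apply: measurableI => //; last exact: measurableC.
    case: (pselect (event i (config0 R))) => h.
      by rewrite (_ : [set _ | _] = setT)//; apply/seteqP; split.
    by rewrite (_ : [set _ | _] = set0)//; apply/seteqP; split.
  apply/seteqP; split => u /=; have := hXi u.
    case: ifPn => [/set_mem Nu -> h|]; [by left|].
    by rewrite notin_setE => Nu h eX; right; split => //; rewrite -h; exact: mem_set.
  case: ifPn => [/set_mem Nu -> [[]|[]]//|].
  rewrite notin_setE => Nu h [[]//|[_]]; rewrite -h; exact: set_mem.
pose mfunXi := isMeasurableFun.Build _ _ _ _ Xi mXi.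
pose X : {mfun measurableTypeR R >-> config R} := HB.pack Xi mfunXi.
exists phi, (distribution (@leb01 R : probability _ R) X); split => // s.
pose B (x : nat -> bool) := all x s.
have dep : depends_below (\max_(i <- s) i).+1 B.
  move=> x y xy; apply: eq_in_all => i si; apply: xy; rewrite ltnS.
  exact: leq_bigmax_seq.
have [mB cB] := cvg_bits conv dep.
have E : [set xi | B (fun i => xi \in @event R i)] = events s.
  apply/seteqP; split => xi /=.
    by move=> /allP h i /h; exact: set_mem.
  by move=> h; apply/allP => i /h; exact: mem_set.
rewrite E in cB.
suff -> : fine (distribution (@leb01 R : probability _ R) X (events s)) =
  fine (leb01 [set u | B ((bit p)^~ u)]) by [].
congr fine; rewrite /distribution /pushforward.
have mA : @measurable _ (measurableTypeR R) (X @^-1` events s).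
  by have := mXi measurableT _ (measurable_events s); rewrite setTI.
rewrite -(measureU0 mA mN N0) -(measureU0 mB mN N0); congr (leb01 _).
have hN' u : ~ N u -> (X @^-1` events s) u = [set u | B ((bit p)^~ u)] u.
  move=> Nu; have := hXi u; rewrite memNset// => h; rewrite -E/= /B.
  by under eq_all do rewrite h.
apply/seteqP; split => u /= [h|Nu]; (have [Nu'|Nu'] := pselect (N u); [by right|left]) => //.
- by move: h; rewrite -[X in X -> _]/((X @^-1` events s) u) hN'.
- by suff : (X @^-1` events s) u by []; rewrite hN'.
Qed.

(** * Convergence of local tame functionals *)

Section local_convergence.
Context (R : realType).
Local Notation borelR := (measurableTypeR R).
Variables (Q : nat -> probability (config R) R) (P : probability (config R) R).
Hypothesis Q_equi : equicontinuous Q.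
Hypothesis cvg_events :
  forall s, fine (Q n (events s)) @[n --> \oo] --> fine (P (events s)).

Definition restr r : config R -> config R := restrict (@measurable_window R r).

Lemma measurable_restr r : measurable_fun setT (restr r).
Proof. exact: measurable_restrict. Qed.

Lemma measurable_restr_preimage r S : measurable S -> measurable (restr r @^-1` S).
Proof. by move=> mS; have := measurable_restr r measurableT mS; rewrite setTI. Qed.

Lemma restr_add_point r x xi : ~ window r x -> restr r (add_point x xi) = restr r xi.
Proof.
move=> wx; apply: config_eqP => A; rewrite !restrictE add_pointE indicE memNset ?adde0//.
by move=> [].
Qed.

(** Restricting the configuration to the window amounts to intersecting the
    intervals of the counting events with it. *)
Let clip (r : nat) (i : nat) : nat :=
  if (unpickle i : option (rat * rat * nat)) is Some (a, b, m) then
    pickle (Order.max a (- r%:R), Order.min b r%:R, m) else i.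

Let clipE r i xi : event (clip r i) xi = event i (restr r xi).
Proof.
rewrite /clip; case E : (unpickle i) => [[[a b] m]|]; last by rewrite /event E.
rewrite eventE /event E; congr (is_true (_ <= _)%E).
have -> : rat_itv (Order.max a (- r%:R)) (Order.min b r%:R) = rat_itv a b `&` window r :> set R.
  rewrite -rat_itvI; congr (_ `&` _).
  by rewrite /rat_itv /window rmorphN/= ratr_nat.
by [].
Qed.

Let restr_events r s : restr r @^-1` (events s) = events (map (clip r) s).
Proof.
apply/seteqP; split => xi /=.
  by move=> h _ /mapP[i si ->]; rewrite clipE; exact: h.
by move=> h i si; rewrite -clipE; apply: h; exact: map_f.
Qed.

Let finP (M : probability (config R) R) A : measurable A -> M A \is a fin_num.
Proof. by move=> mA; rewrite fin_num_measure. Qed.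

(** The class of convergent events is a Dynkin class: in a countable disjoint
    union, the tails decrease to the empty set, and equicontinuity makes them small
    uniformly along the sequence. *)
Lemma cvg_restr_sets r S : (0 < r)%N -> measurable S ->
  fine (Q n (restr r @^-1` S)) @[n --> \oo] --> fine (P (restr r @^-1` S)).
Proof.
move=> r0 mS.
apply: (events_dynkin (H := fun S =>
  fine (Q n (restr r @^-1` S)) @[n --> \oo] --> fine (P (restr r @^-1` S)))) => //.
- rewrite preimage_setT probability_setT.
  by under eq_fun do rewrite probability_setT; exact: cvg_cst.
- by move=> s; rewrite restr_events; exact: cvg_events.
- move=> {mS}S mS cS; have mr := measurable_restr_preimage r mS.
  have E (M : probability (config R) R) :
      fine (M (restr r @^-1` (~` S))) = 1 - fine (M (restr r @^-1` S)).
    by rewrite preimage_setC probability_setC// fineB// finP.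
  rewrite E; under eq_fun do rewrite E.
  by apply: cvgB => //; exact: cvg_cst.
move=> {mS}F mF tF cF.
pose A k := restr r @^-1` (F k).
have mA k : measurable (A k) by exact: measurable_restr_preimage.
have tA : trivIset setT A.
  by apply/trivIsetP => i j _ _ ij; rewrite -preimage_setI;
    move/trivIsetP : tF => /(_ i j I I ij) ->; rewrite preimage_set0.
pose T K := restr r @^-1` (\bigcup_(k in [set k | (K <= k)%N]) F k).
have mT K : measurable (T K).
  by apply: measurable_restr_preimage; exact: bigcup_measurable.
have T0 xi : \forall K \near \oo, ~ T K xi.
  have [[k Fk]|h] := pselect (exists k, A k xi).
    have : \forall K \near \oo, (k < K)%N by exact: nbhs_infty_gt.
    apply: filterS => K kK [j /= Kj Fj].
    have jk : j != k by rewrite gtn_eqF// (leq_trans kK).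
    move/trivIsetP : tA => /(_ j k I I jk)/seteqP[+ _] => /(_ xi); exact.
  by apply: nearW => K [j _ Fj]; apply: h; exists j.
have iT K : insens (window r) (fun xi => xi \in T K).
  move=> x xi wx; apply/idP/idP; rewrite !inE /T/=;
  by rewrite restr_add_point.
have split (M : probability (config R) R) K :
    fine (M (restr r @^-1` (\bigcup_k F k))) = \sum_(k < K) fine (M (A k)) + fine (M (T K)).
  have -> : restr r @^-1` (\bigcup_k F k) = (\big[setU/set0]_(k < K) A k) `|` T K.
    rewrite -bigcup_mkord; apply/seteqP; split => xi /=.
      move=> [k _ Fk]; case: (ltnP k K) => kK; [by left; exists k|by right; exists k].
    by case=> [[k _ Fk]|[k _ Fk]]; exists k.
  rewrite measureU//; last first.
  - apply/seteqP; split => xi //= [].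
    rewrite -bigcup_mkord => -[k /= kK Fk] [j /= Kj Fj].
    have jk : j != k by rewrite gtn_eqF// (leq_trans kK).
    by move/trivIsetP : tA => /(_ j k I I jk)/seteqP[+ _] => /(_ xi); exact.
  - by apply: bigsetU_measurable => k _.
  rewrite fineD ?finP//; last by apply: bigsetU_measurable => k _.
  congr (_ + _); rewrite measure_bigsetU//.
    rewrite (eq_bigr (fun i : 'I_K => (fine (M (A i)))%:E)); last first.
      by move=> i _; rewrite fineK ?finP.
    by rewrite sumEFin.
have PT : fine (P (T K)) @[K --> \oo] --> 0.
  rewrite -[0]/(fine 0%E); apply: fine_cvg.
  rewrite -(measure0 P) (_ : set0 = \bigcap_K T K); last first.
    apply/seteqP; split => // xi h; have [N _ hN] := T0 xi.
    by case: (hN N (leqnn N)); exact: h.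
  rewrite fineK; last by apply: finP; exact: bigcapT_measurable.
  apply: nonincreasing_cvg_mu => //.
  - by rewrite -ge0_fin_numE// finP.
  - by apply: bigcapT_measurable.
  - move=> i j ij; apply/subsetPset => xi [k /= jk Fk]; exists k => //=.
    exact: leq_trans jk.
apply/cvgrPdist_le => e e0.
have e3 : 0 < e / 3 by rewrite divr_gt0.
have hQ := equicontinuous_sets Q_equi r0 mT iT T0 e3.
have hP : \forall K \near \oo, fine (P (T K)) <= e / 3.
  have := (@cvgr_le _ _ _ _ _ _ PT); apply; exact: e3.
have [K [QK PK]] := filter_ex (filterI hQ hP).
have cS : \sum_(k < K) fine (Q n (A k)) @[n --> \oo] --> \sum_(k < K) fine (P (A k)).
  by apply: cvg_big => [|k _]; [exact: add_continuous|exact: cF].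
have /cvgrPdist_le/(_ _ e3) := cS; apply: filterS => n hn.
rewrite (split P K) (split (Q n) K).
have q0 : 0 <= fine (Q n (T K)) by exact: fine_ge0.
have p0 : 0 <= fine (P (T K)) by exact: fine_ge0.
have qe : fine (Q n (T K)) <= e / 3 by rewrite -lee_fin fineK ?finP// QK.
move: hn; rewrite !ler_norml => /andP[h1 h2].
move: PK => /= PK; apply/andP; split; lra.
Qed.

Import HBNNSimple.

Lemma measurable_restr_comp r (G : config R -> R) : measurable_fun setT G ->
  measurable_fun setT (G \o restr r).
Proof. by move=> mG; apply: measurableT_comp => //; exact: measurable_restr. Qed.

Lemma integral_restr_nnsfun (M : probability (config R) R) r (f : {nnsfun config R >-> R}) :
  (\int[M]_xi (f (restr r xi))%:E)%E =
  (\sum_(x <- finmap.enum_fset (fset_set (range f))) x * fine (M (restr r @^-1` (f @^-1` [set x]))))%:E.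
Proof.
pose mfr := isMeasurableFun.Build _ _ _ _ (restr r) (measurable_restr r).
pose X : {mfun config R >-> config R} := HB.pack (restr r) mfr.
transitivity (\int[distribution M X]_xi (f xi)%:E)%E.
  rewrite ge0_integral_pushforward//; first by exact/measurable_EFinP.
  by move=> t _; rewrite lee_fin.
rewrite integralT_nnsfun sintegralE fsbig_finite//= -sumEFin.
apply: eq_bigr => x _; rewrite EFinM fineK//; apply: finP.
exact: measurable_restr_preimage.
Qed.

Lemma cvg_restr_nnsfun r (f : {nnsfun config R >-> R}) : (0 < r)%N ->
  (\int[Q n]_xi (f (restr r xi))%:E @[n --> \oo] --> \int[P]_xi (f (restr r xi))%:E)%E.
Proof.
move=> r0; rewrite integral_restr_nnsfun; under eq_fun do rewrite integral_restr_nnsfun.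
apply: cvg_EFin; first exact: nearW.
apply: cvg_big => [|x _]; first exact: add_continuous.
by apply: cvgM; [exact: cvg_cst|exact: cvg_restr_sets].
Qed.

(** F is approximated from below by simple functions, for which convergence is
    that of local events. The errors tend to 0 pointwise and have linear growth:
    they are small uniformly along the sequence. *)
Lemma cvg_local_nonneg r (C0 : R) (F : config R -> R) : (0 < r)%N -> 0 <= C0 ->
  measurable_fun setT F -> (forall xi, 0 <= F xi) ->
  (forall xi, F (restr r xi) = F xi) ->
  (forall xi, F xi <= C0 * (1 + count (window r) xi)) ->
  (\int[P]_xi (F xi)%:E < +oo)%E /\
  (\int[Q n]_xi (F xi)%:E @[n --> \oo] --> \int[P]_xi (F xi)%:E)%E.
Proof.
move=> r0 c0 mF F0 Fr FC.
have mEF : measurable_fun setT (EFin \o F) by exact/measurable_EFinP.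
pose f := nnsfun_approx measurableT mEF.
have f_le j xi : f j xi <= F xi.
  have h : f i xi @[i --> \oo] --> F xi.
    by have /fine_cvg := @cvg_nnsfun_approx _ _ _ _ measurableT _ mEF (fun x _ => F0 x) xi I.
  rewrite -(cvg_lim _ h)//; apply: nondecreasing_cvgn_le; last exact: (cvgP _ h).
  by move=> i k ik; exact/lefP/nd_nnsfun_approx.
pose G j xi := f j (restr r xi).
have mG j : measurable_fun setT (G j) by exact: measurable_restr_comp.
have G0 j xi : 0 <= G j xi by rewrite /G.
have G_le j xi : G j xi <= F xi by rewrite /G -(Fr xi).
pose Phi j xi := F xi - G j xi.
have mPhi j : measurable_fun setT (Phi j) by apply: measurable_funB.
have Phi0 j xi : 0 <= Phi j xi by rewrite subr_ge0.
have iPhi j : insens (window r) (Phi j).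
  by move=> x xi wx; rewrite /Phi /G -(Fr (add_point x xi)) restr_add_point// Fr.
have PhiC j xi : Phi j xi <= C0 * (1 + count (window r) xi).
  by apply: le_trans (FC xi); rewrite /Phi gerBl.
have Gcvg xi : G j xi @[j --> \oo] --> F xi.
  have := @cvg_nnsfun_approx _ _ _ _ measurableT _ mEF (fun x _ => F0 x) (restr r xi) I.
  by rewrite /= Fr => /fine_cvg.
have Phicvg xi : Phi j xi @[j --> \oo] --> 0.
  rewrite -(subrr (F xi)); apply: cvgB; first exact: cvg_cst.
  exact: Gcvg.
have split (M : probability (config R) R) j :
    (\int[M]_xi (F xi)%:E = \int[M]_xi (G j xi)%:E + \int[M]_xi (Phi j xi)%:E)%E.
  rewrite -ge0_integralD//; last 4 first.
  - by move=> xi _; rewrite lee_fin.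
  - exact/measurable_EFinP.
  - by move=> xi _; rewrite lee_fin.
  - exact/measurable_EFinP.
  by apply: eq_integral => xi _; rewrite -EFinD /Phi subrKC.
have EC e (e0 : 0 < e) := Q_equi r0 c0 mPhi Phi0 iPhi PhiC Phicvg e0.
have cG j := @cvg_restr_nnsfun r (f j) r0.
have fG (M : probability (config R) R) j : (\int[M]_xi (G j xi)%:E)%E \is a fin_num.
  by rewrite integral_restr_nnsfun.
have monoP : (\int[P]_xi (G j xi)%:E @[j --> \oo] --> \int[P]_xi (F xi)%:E)%E.
  rewrite (eq_integral (fun xi => limn (fun j => (G j xi)%:E))); last first.
    move=> xi _; apply/esym/cvg_lim => //; apply: cvg_EFin; first exact: nearW.
    exact: Gcvg.
  apply: cvg_monotone_convergence => //.
  - by move=> j; exact/measurable_EFinP.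
  - by move=> j xi _; rewrite lee_fin.
  - move=> xi _ i j ij; rewrite lee_fin.
    by have /lefP := nd_nnsfun_approx measurableT mEF ij; exact.
(* The error is uniformly small along the sequence, hence small for P too. *)
have bound e : 0 < e -> \forall j \near \oo,
    (\int[P]_xi (F xi)%:E <= \int[P]_xi (G j xi)%:E + e%:E)%E /\
    forall n, (\int[Q n]_xi (Phi j xi)%:E <= e%:E)%E.
  move=> e0; apply: filterS (EC e e0) => j hj; split => //.
  apply: (cvge_to_le monoP); apply: nearW => i.
  apply: (lee_cvg_to (cG i) (cvgeD _ (cG j) (cvg_cst e%:E))).
    by rewrite fin_num_adde_defl.
  apply: nearW => n.
  apply: (@le_trans _ _ (\int[Q n]_xi (F xi)%:E)%E).
    by rewrite (split (Q n) i) leeDl//; apply: integral_ge0 => xi _; rewrite lee_fin.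
  by rewrite (split (Q n) j) leeD2l.
have Pfin : (\int[P]_xi (F xi)%:E < +oo)%E.
  have [j [hj _]] := filter_ex (bound 1 ltr01).
  by apply: le_lt_trans hj _; rewrite -(fineK (fG P j)) ltry.
split => //.
have PE : (\int[P]_xi (F xi)%:E = (fine (\int[P]_xi (F xi)%:E))%:E)%E.
  by rewrite fineK// ge0_fin_numE//; apply: integral_ge0 => xi _; rewrite lee_fin.
set alpha := fine _ in PE.
have QE n : exists2 a, (\int[Q n]_xi (F xi)%:E = a%:E)%E & forall j e, 0 < e ->
   (\int[Q n]_xi (Phi j xi)%:E <= e%:E)%E -> 0 <= a - fine (\int[Q n]_xi (G j xi)%:E)%E <= e.
  have [j [_ hj]] := filter_ex (bound 1 ltr01).
  have fin : (\int[Q n]_xi (F xi)%:E)%E \is a fin_num.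
    rewrite ge0_fin_numE; last by apply: integral_ge0 => xi _; rewrite lee_fin.
    rewrite (split (Q n) j); apply: (@le_lt_trans _ _ (\int[Q n]_xi (G j xi)%:E + 1%:E)%E).
      by rewrite leeD2l.
    by rewrite -(fineK (fG (Q n) j)) ltry.
  exists (fine (\int[Q n]_xi (F xi)%:E)%E); first by rewrite fineK.
  move=> {hj}{}j e e0 he.
  have Pge : (0 <= \int[Q n]_xi (Phi j xi)%:E)%E by apply: integral_ge0 => xi _; rewrite lee_fin.
  have fP : (\int[Q n]_xi (Phi j xi)%:E)%E \is a fin_num.
    by rewrite ge0_fin_numE//; apply: le_lt_trans he _; rewrite ltry.
  rewrite (split (Q n) j) fineD//.
  by rewrite addrAC subrr add0r -lee_fin -(lee_fin _ e) fineK// Pge.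
have /choice[a ha] : forall n, exists a, (\int[Q n]_xi (F xi)%:E = a%:E)%E /\ forall j e, 0 < e ->
   (\int[Q n]_xi (Phi j xi)%:E <= e%:E)%E -> 0 <= a - fine (\int[Q n]_xi (G j xi)%:E)%E <= e.
  by move=> n; have [a h1 h2] := QE n; exists a.
rewrite PE; under eq_fun do rewrite (ha _).1.
apply: cvg_EFin; first exact: nearW.
apply/cvgrPdist_le => e e0.
have e2 : 0 < e / 2 by rewrite divr_gt0.
have [j [hP hQ]] := filter_ex (bound _ e2).
have bj : fine (\int[Q n]_xi (G j xi)%:E)%E @[n --> \oo] --> fine (\int[P]_xi (G j xi)%:E)%E.
  by apply: fine_cvg; rewrite fineK//; exact: cG.
have /cvgrPdist_le/(_ _ e2) := bj; apply: filterS => n hn.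
have := (ha n).2 j _ e2 (hQ n).
have h1 : alpha <= fine (\int[P]_xi (G j xi)%:E)%E + e / 2.
  by rewrite -lee_fin -PE EFinD fineK.
have h2 : fine (\int[P]_xi (G j xi)%:E)%E <= alpha.
  rewrite -lee_fin -PE fineK// (split P j) leeDl//.
  by apply: integral_ge0 => xi _; rewrite lee_fin.
move: hn; rewrite /= !ler_norml => /andP[h3 h4] /andP[h5 h6].
by apply/andP; split; lra.
Qed.

End local_convergence.

(** * Mean number of points in a bounded interval *)

Section edge_bounds.
Context (R : realType).
Local Notation borelR := (measurableTypeR R).
Local Notation leb := (@lebesgue_measure R).
Implicit Types (h : config R -> \bar R) (B D : set borelR) (xi : config R).

Lemma leb_box n : leb (box n) = n%:R%:E.
Proof.
rewrite /box lebesgue_measure_itv/= lte_fin.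
have n0 : 0 <= n%:R :> R by [].
case: ifPn => [_|]; first by rewrite -EFinB; congr (_%:E); lra.
by rewrite -leNgt => h; congr (_%:E); lra.
Qed.

Lemma integral_cst_box n (c : R) : (\int[leb]_(x in box n) c%:E = (c * n%:R)%:E)%E.
Proof.
rewrite (@integral_cst _ _ _ leb (box n) (@measurable_box R n)).
by rewrite (_ : _ (box n) = n%:R%:E) -?EFinM//; exact: leb_box.
Qed.

Lemma binomial_outside n (n0 : (0 < n)%N) :
  binomial_process R n0 [set xi | xi (~` (box n)) != 0%E] = 0%E.
Proof.
have mB := @measurable_box R n.
pose A := [set xi : config R | xi (~` (box n)) != 0%E].
have mA : measurable A by apply: measurable_count_neq; exact: measurableC.
have nA := @nnm_indic R _ _ _ mA.
transitivity (\int[binomial_process R n0]_xi (\1_A xi)%:E)%E.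
  by rewrite integral_indic// setIT.
rewrite (integral_binomial_process n0 nA).
have -> : iter n (addint (box n)) (fun xi => (\1_A xi)%:E) (config0 R) = 0%E.
  have ins x xi : box n x -> \1_A (add_point x xi) = \1_A xi :> R.
    move=> bx; rewrite !indicE; congr (_%:R); congr nat_of_bool.
    have E : add_point x xi (~` box n) = xi (~` box n).
      by rewrite add_pointE indicE memNset ?adde0// => /(_ bx).
    by apply/idP/idP; rewrite !inE /A/= E.
  have h m xi : iter m (addint (box n)) (fun xi => (\1_A xi)%:E : \bar R) xi =
      ((n%:R ^+ m) * \1_A xi)%:E.
    elim: m xi => [|m ih] xi; first by rewrite expr0 mul1r.
    rewrite iterS /addint.
    rewrite (eq_integral (fun=> (n%:R ^+ m * \1_A xi)%:E)); last first.
      by move=> x; rewrite inE => bx; rewrite ih ins.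
    by rewrite integral_cst_box exprSr; congr (_%:E); ring.
  by rewrite h indicE memNset ?mulr0// /A/= eqxx.
by rewrite mule0.
Qed.

(** Each point falls in D with probability at most l / n, so that the
    exponential moment is at most (1 + l (e^K - 1) / n)^n. *)
Lemma binomial_expcount n (n0 : (0 < n)%N) (D : set borelR) (r l K : R) :
  measurable D -> D `<=` `[- r, r]%classic -> (leb D <= l%:E)%E -> 0 <= K ->
  (\int[binomial_process R n0]_xi (expR (K * count D xi))%:E <=
    (expR (l * (expR K - 1)))%:E)%E.
Proof.
move=> mD Dr lD K0; have mB := @measurable_box R n.
have n1 : 0 < n%:R :> R by rewrite ltr0n.
have l0 : 0 <= l by rewrite -lee_fin; apply: le_trans lD; exact: measure_ge0.
have e1 : 0 <= expR K - 1 by rewrite subr_ge0 -expR0 ler_expR.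
have mX : measurable_fun setT (fun xi => K * count D xi).
  by apply: measurable_funM => //; exact: measurable_count.
have nX := nnm_expR mX.
rewrite (integral_binomial_process n0 nX).
pose q := n%:R + l * (expR K - 1).
have q0 : 0 <= q by rewrite addr_ge0// mulr_ge0.
have h m xi : (iter m (addint (box n)) (fun xi => (expR (K * count D xi))%:E) xi <=
    (q ^+ m)%:E * (expR (K * count D xi))%:E)%E.
  elim: m xi => [|m ih] xi; first by rewrite expr0 mul1e.
  rewrite iterS exprSr.
  apply: (@le_trans _ _ (addint (box n) (fun xi => (q ^+ m)%:E *
     (expR (K * count D xi))%:E)%E xi)).
    apply: addint_le => //; first exact: nnm_iter.
    by apply: nnmM => //; apply: nnm_cst; rewrite lee_fin exprn_ge0.
  rewrite addintZ//; last by rewrite lee_fin exprn_ge0.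
  rewrite EFinM -muleA; apply: lee_wpmul2l; first by rewrite lee_fin exprn_ge0.
  rewrite /addint (eq_integral (fun x => (expR (K * count D xi))%:E +
    (expR (K * count D xi) * (expR K - 1))%:E * (\1_D x)%:E)%E); last first.
    move=> x _; rewrite (count_add_point _ _ mD Dr) mulrDr expRD -EFinM -EFinD; congr (_%:E).
    by rewrite indicE; case: (x \in D) => /=; rewrite ?mulr1 ?mulr0 ?expR0; ring.
  have ee : 0 <= expR (K * count D xi) * (expR K - 1) by rewrite mulr_ge0 ?expR_ge0.
  rewrite ge0_integralD//; last 2 first.
  - by move=> x _; rewrite mule_ge0 ?lee_fin.
  - apply: emeasurable_funM => //; apply/measurable_EFinP; apply: measurable_funTS.
    exact: measurable_indic.
  rewrite integral_cst_box ge0_integralZl//; last first.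
    by apply/measurable_EFinP; apply: measurable_funTS; exact: measurable_indic.
  rewrite integral_indic//.
  apply: (@le_trans _ _ ((expR (K * count D xi) * n%:R)%:E +
      (expR (K * count D xi) * (expR K - 1))%:E * l%:E)%E).
    apply: leeD => //; apply: lee_wpmul2l; first by rewrite lee_fin.
    by apply: le_trans lD; apply: le_measure; rewrite ?inE//; exact: measurableI.
  by rewrite -!EFinM -EFinD lee_fin /q le_eqVlt; apply/orP; left; apply/eqP; ring.
apply: (@le_trans _ _ ((n%:R^-1 ^+ n)%:E * (q ^+ n)%:E)%E).
  apply: lee_wpmul2l; first by rewrite lee_fin exprn_ge0.
  by apply: (le_trans (h n _)); rewrite count0 mulr0 expR0 mule1.
rewrite -EFinM lee_fin -exprMn.
have -> : n%:R^-1 * q = 1 + (l * (expR K - 1)) / n%:R by rewrite /q; field; rewrite gt_eqF.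
have -> : l * (expR K - 1) = ((l * (expR K - 1)) / n%:R) * n%:R by field; rewrite gt_eqF.
(* (1 + t)^n <= e^(t n) *)
set t := l * (expR K - 1) / n%:R.
have t0 : 0 <= t by rewrite divr_ge0// mulr_ge0.
rewrite mulfK ?gt_eqF// expRM_natr lerXn2r ?nnegrE ?addr_ge0 ?expR_ge0//.
exact: expR_ge1Dx.
Qed.

Lemma translate_count u D xi : count D (translate u xi) = count [set y | D (y + u)] xi.
Proof. by []. Qed.

(** For large K the leading term C n / K is a small fraction of n: the mean
    number of points in an interval of bounded length is o(n). *)
Lemma gas_interval_bound n (n0 : (0 < n)%N) (mu : probability (config R) R)
    (C t c l K : R) : 0 <= C -> 0 <= l -> 0 < K ->
  (forall A, measurable A ->
    mu A <= (expR (C * n%:R))%:E * binomial_process R n0 (translate t @^-1` A))%E ->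
  (\int[mu]_xi xi `[c, (c + l)%R]%classic <= ((C * n%:R + l * (expR K - 1)) / K)%:E)%E.
Proof.
move=> C0 l0 K0 muB.
pose D : set borelR := `[c, (c + l)]%classic.
have mD : measurable D by exact: measurable_itv.
have Dr : D `<=` `[- (`|c| + l), `|c| + l]%classic.
  move=> x; rewrite /D/= !in_itv/= => /andP[h1 h2].
  have := ler_norm c; have := ler_norm (- c); rewrite normrN => *.
  by apply/andP; split; lra.
have mX : measurable_fun setT (fun xi => K * count D xi).
  by apply: measurable_funM => //; exact: measurable_count.
have mt : measurable_fun setT (translate t : config R -> config R).
  by apply: measurable_translate.
pose mft := isMeasurableFun.Build _ _ _ _ (translate t : config R -> config R) mt.
pose X : {mfun config R >-> config R} := HB.pack (translate t : config R -> config R) mft.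
have e1 : 0 <= expR K - 1 by rewrite subr_ge0 -expR0 ler_expR ltW.
have nK := nnm_expR mX.
have lD : (leb D <= l%:E)%E.
  by rewrite /D lebesgue_measure_itv/= lte_fin; case: ifP => _; rewrite -?EFinB lee_fin//; lra.
have tilt : (\int[mu]_xi (K * count D xi)%:E <= (l * (expR K - 1) + C * n%:R)%:E)%E.
  apply: (@expR_tilt R _ _ mu (distribution (binomial_process R n0) X)) => //.
  - exact: mulr_ge0.
  - exact: mulr_ge0.
  - by move=> xi; apply: mulr_ge0; [exact: ltW|exact: count_ge0].
  rewrite ge0_integral_pushforward//; last exact: nK.1.
  rewrite preimage_setT /=.
  under eq_integral do rewrite translate_count.
  have ml := lebesgue_measure_itv.
  have mDt := measurable_shift t mD.
  apply: (@binomial_expcount _ _ _ (`|c| + l + `|t|)) => //.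
  - move=> x /= /Dr/=; rewrite !in_itv/= => /andP[h1 h2].
    have := ler_norm t; have := ler_norm (- t); rewrite normrN => *.
    by apply/andP; split; lra.
  - rewrite (_ : [set y | D (y + t)] = `[(c - t), (c - t) + l]%classic).
      by rewrite lebesgue_measure_itv/= lte_fin; case: ifP => _; rewrite -?EFinB lee_fin//; lra.
    by apply/seteqP; split => x/=; rewrite /D/= !in_itv/= => /andP[h1 h2];
      apply/andP; split; lra.
  - exact: ltW.
have nc : nnm (fun xi => (count D xi)%:E).
  by split; [apply/measurable_EFinP; exact: measurable_count|
             move=> xi; rewrite lee_fin; exact: count_ge0].
move: tilt; under eq_integral do rewrite EFinM.
rewrite (nnm_integralZ mu nc (ltW K0)) => tilt.
under eq_integral do rewrite (countE _ mD Dr).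
have -> : ((C * n%:R + l * (expR K - 1)) / K)%:E =
   (K^-1%:E * (l * (expR K - 1) + C * n%:R)%:E)%E by rewrite -EFinM; congr (_%:E); ring.
apply: (@le_trans _ _ (K^-1%:E * (K%:E * \int[mu]_x (count D x)%:E))%E); last first.
  by apply: lee_wpmul2l => //; rewrite lee_fin invr_ge0 ltW.
by rewrite muleA -EFinM mulVf ?gt_eqF// mul1e.
Qed.

End edge_bounds.

(** * The stationarization and the shift of a single tile *)

Section joint_law.
Context (R : realType) d d1 d2 (Omega : measurableType d) (T1 : measurableType d1)
  (T2 : measurableType d2) (Pr : probability Omega R)
  (X : {RV Pr >-> T1}) (Y : {RV Pr >-> T2}).
Hypothesis indep : forall A B, measurable A -> measurable B ->
  Pr (X @^-1` A `&` Y @^-1` B) = (Pr (X @^-1` A) * Pr (Y @^-1` B))%E.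

Let Z (w : Omega) : T1 * T2 := (X w, Y w).
Let mZ : measurable_fun setT Z.
Proof. by apply: measurable_fun_pair; exact: measurable_funPT. Qed.
HB.instance Definition _ := isMeasurableFun.Build _ _ _ _ Z mZ.

Lemma integral_independent (h : T1 * T2 -> \bar R) : nnm h ->
  (\int[Pr]_w h (X w, Y w) =
   \int[distribution Pr X]_x \int[distribution Pr Y]_y h (x, y))%E.
Proof.
move=> [mh h0].
rewrite -(fubini_tonelli1 _ mh h0).
transitivity (\int[distribution Pr Z]_z h z)%E.
  by rewrite ge0_integral_pushforward.
apply: eq_measure_integral => A mA _; apply/esym.
apply: (@product_measure_unique _ _ _ _ _ (distribution Pr X) (distribution Pr Y)
  (distribution Pr Z)) => // B C mB mC.
Qed.

Lemma integral_independentM (A : set T1) (g : T2 -> \bar R) : measurable A -> nnm g ->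
  (\int[Pr]_w ((\1_A (X w))%:E * g (Y w)) = Pr (X @^-1` A) * \int[Pr]_w g (Y w))%E.
Proof.
move=> mA [mg g0].
have i0 : (0 <= \int[distribution Pr Y]_y g y)%E by apply: integral_ge0.
rewrite (@integral_independent (fun z => (\1_A z.1)%:E * g z.2)%E); last first.
  split; last by move=> z; rewrite mule_ge0// lee_fin.
  apply: emeasurable_funM; last exact: (measurableT_comp mg measurable_snd).
  apply/measurable_EFinP; apply: (measurableT_comp _ measurable_fst).
  exact: measurable_indic.
transitivity (\int[distribution Pr X]_x ((\1_A x)%:E * \int[distribution Pr Y]_y g y))%E.
  by apply: eq_integral => x _ /=; rewrite ge0_integralZl ?lee_fin.
have mi : measurable_fun setT (fun x : T1 => (\1_A x : R)%:E).
  by apply/measurable_EFinP; exact: measurable_indic.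
rewrite ge0_integralZr//.
rewrite integral_indic// setIT; congr (_ * _)%E.
by rewrite ge0_integral_pushforward.
Qed.

End joint_law.

Section stationarization_comparison.
Context (R : realType).
Local Notation borelR := (measurableTypeR R).
Local Notation leb := (@lebesgue_measure R).
Implicit Types (xi : config R).

(** When the shift is within r of an end of the box, the window of radius r shows
    only points that come from an interval of length 3 r around the other end. *)
Definition edge_left n r : set borelR := `[(- (n%:R / 2) - r), (- (n%:R / 2) - r) + 3 * r]%classic.
Definition edge_right n r : set borelR := `[(n%:R / 2 - 2 * r), (n%:R / 2 - 2 * r) + 3 * r]%classic.

Definition edge n (r : R) xi : \bar R := (xi (edge_left n r) + xi (edge_right n r))%E.

Lemma nnm_edge n r : nnm (edge n r).
Proof.
split; last by move=> xi; rewrite adde_ge0.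
by apply: emeasurable_funD; apply: measurable_config_eval; exact: measurable_itv.
Qed.

Definition inner n (r : R) : set borelR := `](- (n%:R / 2) + r), (n%:R / 2 - r)[%classic.

Lemma window_shift_edge n (r : nat) (u : R) : 2 * r%:R < n%:R :> R ->
  box n u -> ~ inner n r%:R u ->
  [set y : borelR | window r (y + u)] `<=` edge_left n r%:R `|` edge_right n r%:R.
Proof.
move=> rn; rewrite /box /inner /window /edge_left /edge_right /= !in_itv/=.
move=> /andP[u1 u2] ui y /=.
rewrite !in_itv/= => /andP[h1 h2].
case: (leP u 0) => u0; [right|left].
  have ui' : u <= - (n%:R / 2) + r%:R.
    by rewrite leNgt; apply/negP => ui'; apply: ui; apply/andP; split=> //; lra.
  by apply/andP; split; lra.
have ui' : n%:R / 2 - r%:R <= u.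
  by rewrite leNgt; apply/negP => ui'; apply: ui; apply/andP; split=> //; lra.
by apply/andP; split; lra.
Qed.

Lemma window_shift_le n (r : nat) (u : R) xi : 2 * r%:R < n%:R :> R ->
  box n u -> ~ inner n r%:R u -> (translate u xi (window r) <= edge n r%:R xi)%E.
Proof.
move=> rn bu iu; rewrite translateE.
have ml : measurable (edge_left n r%:R) by exact: measurable_itv.
have mr : measurable (edge_right n r%:R) by exact: measurable_itv.
apply: (@le_trans _ _ (xi (edge_left n r%:R `|` edge_right n r%:R))).
  apply: le_measure; rewrite ?inE; [|exact: measurableU|exact: window_shift_edge].
  by apply: measurable_shift; exact: measurable_window.
exact: measureU2.
Qed.

Lemma uniform_setC n (n0 : (0 < n)%N) (A : set borelR) (l : R) : measurable A ->
  A `<=` (box n : set borelR) -> leb A = l%:E ->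
  uniform_prob (box_lt R n0) (~` A) = (1 - l / n%:R)%:E.
Proof.
move=> mA An lA; have n1 : 0 < n%:R :> R by rewrite ltr0n.
rewrite probability_setC// EFinB; congr (_ - _)%E.
transitivity (\int[uniform_prob (box_lt R n0)]_x (\1_A x)%:E)%E.
  by rewrite integral_indic// setIT.
rewrite integral_uniform//; last by apply/measurable_EFinP; exact: measurable_indic.
rewrite integral_indic//.
rewrite (setIidl An).
transitivity (((n%:R / 2 - - (n%:R / 2))^-1)%:E * l%:E)%E; first by congr (_ * _)%E.
have -> : l / n%:R = (n%:R / 2 - - (n%:R / 2))^-1 * l.
  by clear lA; field; rewrite gt_eqF//=; lra.
by rewrite EFinM.
Qed.

Lemma uniform_inner n (n0 : (0 < n)%N) (r : R) : 0 <= r -> 2 * r < n%:R ->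
  uniform_prob (box_lt R n0) (~` inner n r) = (2 * r / n%:R)%:E.
Proof.
move=> r0 rn; have n1 : 0 < n%:R :> R by rewrite ltr0n.
have mi : measurable (inner n r) by exact: measurable_itv.
rewrite (@uniform_setC _ _ _ (n%:R - 2 * r))//.
- by congr (_%:E); field; rewrite gt_eqF.
- move=> x; rewrite /inner /box/= !in_itv/= => /andP[h1 h2].
  by apply/andP; split; lra.
rewrite /inner lebesgue_measure_itv/= lte_fin ifT; last lra.
by rewrite -EFinB; congr (_%:E); lra.
Qed.

Lemma tile_disjoint (y u r n kn : R) : - (n / 2) + r < u -> u < n / 2 - r ->
  - r < y + u -> y + u <= r -> - (n / 2) <= y - kn -> y - kn <= n / 2 ->
  kn <= -1 * n \/ 1 * n <= kn -> False.
Proof. by move=> h1 h2 h3 h4 h5 h6 [h7|h7]; lra. Qed.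

Lemma tile_far (y u r n kn : R) : 0 < n -> 2 * r < n -> - (n / 2) <= u -> u <= n / 2 ->
  - r < y + u -> y + u <= r -> - (n / 2) <= y - kn -> y - kn <= n / 2 ->
  kn <= -2 * n \/ 2 * n <= kn -> False.
Proof. by move=> n0 rn h1 h2 h3 h4 h5 h6 [h7|h7]; lra. Qed.

Section comparison.
Variables (n : nat) (n0 : (0 < n)%N) (Rz : set (config R) -> \bar R) (C : R).
Hypothesis C0 : 0 <= C.
Hypothesis RzB : forall A, measurable A ->
  (Rz A <= (expR (C * n%:R))%:E * binomial_process R n0 A)%E.
Variables (d : measure_display) (Omega : measurableType d)
  (Pr : probability Omega R) (xi : int -> {RV Pr >-> config R})
  (U : {RV Pr >-> borelR}) (Xi : {RV Pr >-> config R}).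
Hypothesis xiE : forall (k : int) (A : set (config R)), measurable A ->
  distribution Pr (xi k) A = Rz (translate (k%:~R * n%:R) @^-1` A).
Hypothesis UE : forall B : set borelR, measurable B ->
  distribution Pr U B = uniform_prob (box_lt R n0) B.
Hypothesis indep : independent_systems Pr (fun o : option int =>
  if o is Some k then generated_by (xi k) else generated_by U).
Hypothesis XiE : {ae Pr, forall w, forall A : set borelR, measurable A ->
  Xi w A = \esum_(k in [set: int]) translate (U w) (xi k w) A}.

Variable r : nat.
Hypothesis rn : 2 * r%:R < n%:R :> R.

Let n1 : 0 < n%:R :> R. Proof. by rewrite ltr0n. Qed.

Lemma indep_pair k A B : measurable A -> measurable B ->
  Pr (U @^-1` A `&` xi k @^-1` B) = (Pr (U @^-1` A) * Pr (xi k @^-1` B))%E.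
Proof.
move=> mA mB.
have := @indep [:: None; Some k]
  (fun o => if o is Some _ then xi k @^-1` B else U @^-1` A) erefl.
rewrite !big_cons big_nil mule1 => <-.
  congr (Pr _); apply/seteqP; split => w /=.
    by move=> [h1 h2] [j|].
  move=> h; split; first by have := h None; rewrite /= !inE; apply.
  by have := h (Some k); rewrite /= !inE eqxx orbT; apply.
move=> [j|]; last by move=> _; exists A => //; rewrite setTI.
by rewrite !inE/= => /eqP[->]; exists B => //; rewrite setTI.
Qed.

Lemma tile_law_le k A : measurable A ->
  (distribution Pr (xi k) A <=
   (expR (C * n%:R))%:E * binomial_process R n0 (translate (k%:~R * n%:R) @^-1` A))%E.
Proof.
move=> mA; rewrite xiE//; apply: RzB.
exact: measurable_translate_preimage.
Qed.

Let tile (k : int) : set borelR := [set y | box n (y - k%:~R * n%:R)].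

(** The tile laws are dominated by translates of the binomial process, which
    puts all its points in the box. *)
Lemma ae_tile : {ae Pr, forall w, forall k, xi k w (~` tile k) = 0%E}.
Proof.
apply: ae_countable => k.
have mt : measurable (~` tile k).
  apply: measurableC; apply: (@measurable_shift _ (- (k%:~R * n%:R))).
  exact: measurable_box.
pose A := [set eta : config R | eta (~` tile k) != 0%E].
have mA : measurable A by exact: measurable_count_neq.
exists (xi k @^-1` A); split.
- by have := @measurable_funPT _ _ _ _ (xi k) measurableT A mA; rewrite setTI.
- apply/eqP; rewrite -measure_le0; apply: (le_trans (tile_law_le k mA)).
  rewrite (_ : translate _ @^-1` A = [set eta | eta (~` box n) != 0%E]).
    by rewrite [X in (_ * X)%E](@binomial_outside R n n0) mule0.
  apply/seteqP; split => eta; rewrite /A/= translateE;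
  by rewrite (_ : [set y | (~` tile k) (y + k%:~R * n%:R)] = ~` box n)//;
    apply/seteqP; split => y/=; rewrite /tile/= addrK.
- by move=> w /= /eqP h; exact: h.
Qed.

Lemma ae_box : {ae Pr, forall w, box n (U w)}.
Proof.
exists (U @^-1` (~` box n)); split=> //.
- rewrite -[X in measurable X]setTI; apply: measurable_funPT => //.
  by apply: measurableC; exact: measurable_box.
- have -> : Pr (U @^-1` (~` box n)) = distribution Pr U (~` box n) by [].
  rewrite UE; last by apply: measurableC; exact: measurable_box.
  rewrite (@uniform_setC _ _ _ n%:R)//; last exact: leb_box.
    by rewrite divff ?subrr// gt_eqF.
  exact: measurable_box.
Qed.

Let sum_edge (w : Omega) : \bar R :=
  (edge n r%:R (xi (-1) w) + edge n r%:R (xi 0 w) + edge n r%:R (xi 1 w))%E.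

Let bad (w : Omega) : R := \1_(~` inner n r%:R) (U w).

(** Tile k is invisible in the window when k != 0 and the shift is far from the
    ends of the box; whatever the shift, it is invisible when |k| >= 2. *)
Let tile0 (k : int) (w : Omega) (A : set borelR) : measurable A ->
  A `<=` window r -> box n (U w) -> xi k w (~` tile k) = 0%E ->
  (inner n r%:R (U w) /\ k != 0) \/ (1 < `|k|) ->
  translate (U w) (xi k w) A = 0%E.
Proof.
move=> mA Ar bU xk0 hk; rewrite translateE; apply/eqP; rewrite -measure_le0 -xk0.
have mA' := measurable_shift (U w) mA.
apply: le_measure; rewrite ?inE//.
  apply: measurableC; apply: (@measurable_shift _ (- (k%:~R * n%:R))).
  exact: measurable_box.
move=> y /= /Ar; rewrite /window/= in_itv/= => /andP[h1 h2].
rewrite /tile /= /box/= in_itv/= => /andP[h3 h4].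
have kle (z : int) (c : R) : k <= z -> c = z%:~R -> k%:~R * n%:R <= c * n%:R.
  by move=> h ->; apply: ler_wpM2r; [exact: ltW|rewrite ler_int].
have kge (z : int) (c : R) : z <= k -> c = z%:~R -> c * n%:R <= k%:~R * n%:R.
  by move=> h ->; apply: ler_wpM2r; [exact: ltW|rewrite ler_int].
move: bU; rewrite /box/= in_itv/= => /andP[h5 h6].
case: hk => [[]|k1].
  rewrite /inner/= in_itv/= => /andP[h7 h8] k0.
  apply: (tile_disjoint h7 h8 h1 h2 h3 h4).
  have [k1|k1] : k <= -1 \/ 1 <= k by clear -k0; lia.
    by left; exact: (kle (-1) (-1) k1 erefl).
  by right; exact: (kge 1 1 k1 erefl).
apply: (tile_far n1 rn h5 h6 h1 h2 h3 h4).
have [k2|k2] : k <= -2 \/ 2 <= k by clear -k1; lia.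
  by left; exact: (kle (-2) (-2) k2 erefl).
by right; exact: (kge 2 2 k2 erefl).
Qed.

Let Xi_inner w : inner n r%:R (U w) -> box n (U w) ->
  (forall k, xi k w (~` tile k) = 0%E) ->
  (forall A : set borelR, measurable A ->
     Xi w A = \esum_(k in [set: int]) translate (U w) (xi k w) A) ->
  forall A : set borelR, measurable A -> A `<=` window r ->
  Xi w A = translate (U w) (xi 0 w) A.
Proof.
move=> iU bU xk0 XiwE A mA Ar; rewrite XiwE//.
rewrite -(@esum_set1 R _ 0 (fun k : int => translate (U w) (xi k w) A))//.
rewrite [RHS]esum_mkcond; apply: eq_esum => k _.
case: ifPn => //; rewrite notin_setE/= => /eqP k0.
by apply: tile0 => //; left.
Qed.

Let Xi_edge w : ~ inner n r%:R (U w) -> box n (U w) ->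
  (forall k, xi k w (~` tile k) = 0%E) ->
  (forall A : set borelR, measurable A ->
     Xi w A = \esum_(k in [set: int]) translate (U w) (xi k w) A) ->
  (Xi w (window r) <= sum_edge w)%E.
Proof.
move=> iU bU xk0 XiwE; have mW := @measurable_window R r; rewrite XiwE//.
have ti k : (0 <= translate (U w) (xi k w) (window r))%E by [].
pose s3 : seq int := [:: -1; 0; 1].
rewrite (_ : esum _ _ = \esum_(k in [set` s3])
    translate (U w) (xi k w) (window r))%E; last first.
  rewrite [RHS]esum_mkcond; apply: eq_esum => k _.
  case: ifPn => //; rewrite notin_setE/= => hk; apply: tile0 => //; right.
  by move: hk; rewrite !inE; lia.
rewrite esum_fset//; last exact: finite_seq.
rewrite -(@fsbig_seq _ _ _ _ s3)//= !big_cons big_nil adde0 /sum_edge addeA.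
by apply: leeD; [apply: leeD|]; exact: window_shift_le.
Qed.

Let bad_error : \bar R := (\int[Pr]_w ((bad w)%:E * (1 + sum_edge w)))%E.

Let mU A : measurable A -> measurable_fun setT (fun w => (\1_A (U w) : R)%:E).
Proof.
move=> mA; apply/measurable_EFinP; apply: (@measurableT_comp _ _ _ _ _ _ (\1_A : borelR -> R)).
  exact: measurable_indic.
exact: measurable_funPT.
Qed.

Let m_edge k : measurable_fun setT (fun w => edge n r%:R (xi k w)).
Proof. by apply: (measurableT_comp (nnm_edge n r%:R).1); exact: measurable_funPT. Qed.

Let edge0 k w : (0 <= edge n r%:R (xi k w))%E.
Proof. exact: (nnm_edge n r%:R).2. Qed.

Let nnm_bad_error : nnm (fun w => (bad w)%:E * (1 + sum_edge w))%E.
Proof.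
split; last by move=> w; rewrite mule_ge0 ?lee_fin// !adde_ge0.
apply: emeasurable_funM; last first.
  by apply: emeasurable_funD => //; apply: emeasurable_funD => //; exact: emeasurable_funD.
by apply: mU; apply: measurableC; exact: measurable_itv.
Qed.

Lemma edge_le (K : R) k : 0 < K -> (\int[Pr]_w edge n r%:R (xi k w) <=
  (2 * ((C * n%:R + 3 * r%:R * (expR K - 1)) / K))%:E)%E.
Proof.
move=> K0.
have -> : (\int[Pr]_w edge n r%:R (xi k w) =
    \int[distribution Pr (xi k)]_eta edge n r%:R eta)%E.
  rewrite ge0_integral_pushforward//; first exact: (nnm_edge _ _).1.
  by move=> eta _; exact: (nnm_edge _ _).2.
have mcl D : measurable D -> measurable_fun setT (fun eta : config R => eta D).
  exact: measurable_config_eval.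
rewrite /edge ge0_integralD//; last 2 first.
- by apply: mcl; exact: measurable_itv.
- by apply: mcl; exact: measurable_itv.
rewrite mulrDl mul1r EFinD; apply: leeD.
- by apply: (@gas_interval_bound R n n0 (distribution Pr (xi k)) C (k%:~R * n%:R)
    _ _ K C0 _ K0 (@tile_law_le k)); exact: mulr_ge0.
- by apply: (@gas_interval_bound R n n0 (distribution Pr (xi k)) C (k%:~R * n%:R)
    _ _ K C0 _ K0 (@tile_law_le k)); exact: mulr_ge0.
Qed.

(** The shift and the tiles are independent: the probability 2 r / n of a shift
    close to the ends multiplies a mean number of points of order n / K. *)
Let bad_error_le (K : R) : 0 < K -> (bad_error <= (2 * r%:R / n%:R *
  (1 + 6 * ((C * n%:R + 3 * r%:R * (expR K - 1)) / K)))%:E)%E.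
Proof.
move=> K0; have mi : measurable (~` inner n r%:R).
  by apply: measurableC; exact: measurable_itv.
have PU : Pr (U @^-1` (~` inner n r%:R)) = (2 * r%:R / n%:R)%:E.
  transitivity (distribution Pr U (~` inner n r%:R)) => //.
  by rewrite UE// uniform_inner.
have bE k : (\int[Pr]_w ((bad w)%:E * edge n r%:R (xi k w)) =
   (2 * r%:R / n%:R)%:E * \int[Pr]_w edge n r%:R (xi k w))%E.
  rewrite -PU; apply: (integral_independentM (@indep_pair k)) => //.
  exact: nnm_edge.
have mb := mU mi.
have nb k : nnm (fun w => (bad w)%:E * edge n r%:R (xi k w))%E.
  by split; [exact: emeasurable_funM|move=> w; rewrite mule_ge0// lee_fin].
rewrite /bad_error.
under eq_integral => w _ do rewrite ge0_muleDr ?adde_ge0// mule1 /sum_edge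
  ge0_muleDr ?adde_ge0// ge0_muleDr//.
have n1' : nnm (fun w => (bad w)%:E) by split => // w; rewrite lee_fin.
rewrite (nnm_integralD _ n1'); last by do 2 apply: nnmD => //.
rewrite nnm_integralD//; last by apply: nnmD.
rewrite nnm_integralD// !bE.
have -> : (\int[Pr]_w (bad w)%:E = (2 * r%:R / n%:R)%:E)%E.
  rewrite -PU; transitivity (\int[Pr]_w (\1_(U @^-1` (~` inner n r%:R)) w)%:E)%E => //.
  rewrite integral_indic// ?setIT// -[X in measurable X]setTI.
  exact: measurable_funPT.
set q := (2 * r%:R / n%:R); have q0 : 0 <= q by rewrite divr_ge0 ?mulr_ge0.
have ek k : (q%:E * \int[Pr]_w edge n r%:R (xi k w) <=
    (q * (2 * ((C * n%:R + 3 * r%:R * (expR K - 1)) / K)))%:E)%E.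
  by rewrite (EFinM q); apply: lee_wpmul2l; [rewrite lee_fin|exact: edge_le].
apply: (@le_trans _ _ (q%:E + ((q * (2 * ((C * n%:R + 3 * r%:R * (expR K - 1)) / K)))%:E +
  (q * (2 * ((C * n%:R + 3 * r%:R * (expR K - 1)) / K)))%:E + (q * (2 * ((C * n%:R + 3 * r%:R * (expR K - 1)) / K)))%:E))%E).
  by apply: leeD => //; apply: leeD => //; apply: leeD.
rewrite -!EFinD lee_fin le_eqVlt; apply/orP; left; apply/eqP; ring.
Qed.

Section functional.
Variables (F : config R -> R) (c : R).
Hypotheses (mF : measurable_fun setT F) (F0 : forall eta, 0 <= F eta) (c0 : 0 <= c).
Hypotheses (Fc : forall eta, F eta <= c * (1 + count (window r) eta))
  (locF : local_on (window r) F).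

Let FcE eta : ((F eta)%:E <= c%:E * (1 + eta (window r)))%E.
Proof.
rewrite (countE _ (@measurable_window R r) (@window_sub R r)) -EFinD -EFinM.
by rewrite lee_fin.
Qed.

Let ae_compare : {ae Pr, forall w,
  ((F (Xi w))%:E <= (F (translate (U w) (xi 0 w)))%:E + c%:E * ((bad w)%:E * (1 + sum_edge w)))%E /\
  ((F (translate (U w) (xi 0 w)))%:E <= (F (Xi w))%:E + c%:E * ((bad w)%:E * (1 + sum_edge w)))%E}.
Proof.
have := ae_tile; have := ae_box; move: XiE; apply: filterS3 => w XiwE bU xk0.
have s0 : (0 <= sum_edge w)%E by rewrite !adde_ge0.
have [iU|iU] := pselect (inner n r%:R (U w)).
  have -> : F (Xi w) = F (translate (U w) (xi 0 w)).
    by apply: locF => A mA Ar; exact: Xi_inner.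
  by rewrite leeDl// !mule_ge0 ?lee_fin ?adde_ge0.
have -> : bad w = 1 by rewrite /bad indicE mem_set.
rewrite mul1e; split.
  apply: (@le_trans _ _ (c%:E * (1 + sum_edge w))%E).
    apply: (le_trans (FcE _)); apply: lee_wpmul2l => //.
    by rewrite leeD2l//; exact: Xi_edge.
  by rewrite leeDr// lee_fin.
apply: (@le_trans _ _ (c%:E * (1 + sum_edge w))%E).
  apply: (le_trans (FcE _)); apply: lee_wpmul2l => //.
  rewrite leeD2l//; apply: (le_trans (window_shift_le _ rn bU iU)).
  by rewrite /sum_edge -addeA addeCA leeDl// adde_ge0.
by rewrite leeDr// lee_fin.
Qed.

Let nF : nnm (fun w => (F (Xi w))%:E).
Proof.
split; last by move=> w; rewrite lee_fin.
by apply/measurable_EFinP; apply: (measurableT_comp mF); exact: measurable_funPT.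
Qed.

Let nS : nnm (fun w => (F (translate (U w) (xi 0 w)))%:E).
Proof.
split; last by move=> w; rewrite lee_fin.
apply/measurable_EFinP; apply: (measurableT_comp mF); apply: measurable_translate;
  exact: measurable_funPT.
Qed.

Let nB : nnm (fun w => c%:E * ((bad w)%:E * (1 + sum_edge w)))%E.
Proof.
split; first by apply: emeasurable_funM => //; exact: nnm_bad_error.1.
by move=> w; rewrite mule_ge0// nnm_bad_error.2.
Qed.

Let shifted_lawE : (\int[Pr]_w (F (translate (U w) (xi 0 w)))%:E =
  \int[shifted_law n0 (distribution Pr (xi 0))]_eta (F eta)%:E)%E.
Proof.
have nn : nnm (fun eta => (F eta)%:E).
  by split; [exact/measurable_EFinP|move=> w; rewrite lee_fin].
have ns : nnm (fun z => (F (translate z.1 z.2))%:E).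
  split; last by move=> w; rewrite lee_fin.
  by apply: (measurableT_comp nn.1); exact: measurable_shift_map.
rewrite (@integral_independent _ _ _ _ _ _ _ _ U (xi 0) (@indep_pair 0)
  (fun z => (F (translate z.1 z.2))%:E) ns).
rewrite [RHS]ge0_integral_pushforward//; last 2 first.
- exact: nn.1.
- by move=> t _; exact: nn.2.
rewrite preimage_setT fubini_tonelli1//; last 2 first.
- exact: ns.1.
- by move=> t; exact: ns.2.
by apply: eq_measure_integral => A mA _; exact: UE.
Qed.

(** For a shift far from the ends of the box, both sides see tile 0 only. For
    the other shifts, both sides are bounded by the number of points that the
    tiles -1, 0 and 1 have near the ends of the box. *)
Lemma stationarization_close (K : R) : 0 < K ->
  let err := c * (2 * r%:R / n%:R *
      (1 + 6 * ((C * n%:R + 3 * r%:R * (expR K - 1)) / K))) in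
  (\int[distribution Pr Xi]_eta (F eta)%:E <=
     \int[shifted_law n0 (distribution Pr (xi 0))]_eta (F eta)%:E + err%:E)%E /\
  (\int[shifted_law n0 (distribution Pr (xi 0))]_eta (F eta)%:E <=
     \int[distribution Pr Xi]_eta (F eta)%:E + err%:E)%E.
Proof.
move=> K0 err.
have nn : nnm (fun eta => (F eta)%:E).
  by split; [exact/measurable_EFinP|move=> w; rewrite lee_fin].
have XE : (\int[distribution Pr Xi]_eta (F eta)%:E = \int[Pr]_w (F (Xi w))%:E)%E.
  by rewrite ge0_integral_pushforward//; [exact: nn.1|move=> w _; exact: nn.2].
have bE : (\int[Pr]_w (c%:E * ((bad w)%:E * (1 + sum_edge w))) <= err%:E)%E.
  rewrite (nnm_integralZ _ nnm_bad_error c0) /err EFinM.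
  by apply: lee_wpmul2l; [rewrite lee_fin|exact: bad_error_le].
rewrite -shifted_lawE XE; split.
- apply: (@le_trans _ _ (\int[Pr]_w ((F (translate (U w) (xi 0 w)))%:E +
      c%:E * ((bad w)%:E * (1 + sum_edge w))))%E).
    apply: ae_ge0_le_integral => //.
    + by move=> w _; exact: nF.2.
    + exact: nF.1.
    + by move=> w _; rewrite adde_ge0 ?nS.2 ?nB.2.
    + by apply: emeasurable_funD; [exact: nS.1|exact: nB.1].
    by move: ae_compare; apply: filterS => w [].
  by rewrite nnm_integralD// leeD2l.
- apply: (@le_trans _ _ (\int[Pr]_w ((F (Xi w))%:E +
      c%:E * ((bad w)%:E * (1 + sum_edge w))))%E).
    apply: ae_ge0_le_integral => //.
    + by move=> w _; exact: nS.2.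
    + exact: nS.1.
    + by move=> w _; rewrite adde_ge0 ?nF.2 ?nB.2.
    + by apply: emeasurable_funD; [exact: nF.1|exact: nB.1].
    by move: ae_compare; apply: filterS => w [].
  by rewrite nnm_integralD// leeD2l.
Qed.

End functional.
End comparison.
End stationarization_comparison.

(** * Stationarity of the limit *)

Section limit_stationary.
Context (R : realType).
Local Notation borelR := (measurableTypeR R).
Local Notation leb := (@lebesgue_measure R).

Lemma box_shift_le n (x : R) (G : borelR -> \bar R) : nnm G -> (forall u, G u <= 1)%E ->
  (\int[leb]_(u in [set u | box n (u - x)%R]) G u <=
   \int[leb]_(u in box n) G u + `|x|%:E)%E.
Proof.
move=> [mG G0] G1.
have mB : @measurable _ borelR (box n) by exact: measurable_box.
pose E : set borelR := if 0 <= x then `](n%:R / 2), (n%:R / 2 + x)]%classic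
  else `[(- (n%:R / 2) + x), (- (n%:R / 2))[%classic.
have mE : measurable E by rewrite /E; case: ifP => _; exact: measurable_itv.
have BE : [disjoint (box n : set borelR) & E].
  apply/disj_setPS => u [/=]; rewrite /box/= in_itv/= => /andP[h1 h2].
  by rewrite /E; case: ifP => _; rewrite /= in_itv/= => /andP[h3 h4]; lra.
have lE : (leb E <= `|x|%:E)%E.
  rewrite /E; case: ifPn => [x0|]; last rewrite -ltNge => x0.
    by rewrite lebesgue_measure_itv/= lte_fin; case: ifP => _; rewrite -?EFinB lee_fin//
      ger0_norm//; lra.
  by rewrite lebesgue_measure_itv/= lte_fin; case: ifP => _; rewrite -?EFinB lee_fin//
      ltr0_norm//; lra.
apply: (@le_trans _ _ (\int[leb]_(u in box n `|` E) G u)%E).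
  apply: ge0_subset_integral => //.
  - by apply: (@measurable_shift _ (- x)).
  - exact: measurableU.
  - exact: measurable_funTS.
  move=> u /=; rewrite /box/= in_itv/= => /andP[h1 h2].
  rewrite in_itv/= /E; clear lE; have [h3|h3] := leP u (n%:R / 2).
    have [h4|h4] := leP (- (n%:R / 2)) u; first by left.
    right; case: ifPn => [x0|_]; first by lra.
    by rewrite /= in_itv/=; apply/andP; split; lra.
  right; case: ifPn => [x0|]; last by rewrite -ltNge => x0; lra.
  by rewrite /= in_itv/=; apply/andP; split; lra.
rewrite ge0_integral_setU//; last exact: measurable_funTS.
rewrite leeD2l//; apply: (@le_trans _ _ (\int[leb]_(u in E) 1)%E).
  by apply: ge0_le_integral => //; exact: measurable_funTS.
by rewrite integral_cst// mul1e.
Qed.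

(** A translation by x moves the range of the shift by x; the moved box exceeds
    the box by an interval of length |x|. *)
Lemma shifted_law_translate n (n0 : (0 < n)%N) (mu : probability (config R) R) (x : R) A :
  measurable A ->
  (shifted_law n0 mu (translate x @^-1` A) <= shifted_law n0 mu A + (`|x| / n%:R)%:E)%E.
Proof.
move=> mA; have mB := measurable_translate_preimage x mA.
have nA := nnm_indic R mA; have nB := nnm_indic R mB.
have E S : measurable S -> shifted_law n0 mu S =
    (\int[shifted_law n0 mu]_xi (\1_S xi)%:E)%E.
  by move=> mS; rewrite integral_indic// setIT.
rewrite !E// !integral_shifted_law//.
pose G u := (\int[mu]_xi (\1_A (translate u xi))%:E)%E.
have nG : nnm G := nnm_shift_integral mu nA.
have G1 u : (G u <= 1)%E.
  apply: (@le_trans _ _ (\int[mu]_xi 1)%E); last first.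
    by rewrite integral_cst//= mul1e probability_setT.
  apply: ge0_le_integral => //.
  - apply: (measurableT_comp nA.1); exact: measurable_translate.
  - by move=> xi _; rewrite lee_fin indicE lern1 leq_b1.
have -> : (\int[leb]_(u in box n) \int[mu]_xi (\1_(translate x @^-1` A) (translate u xi))%:E =
   \int[leb]_(u in [set u | box n (u - x)%R]) G u)%E.
  have mBx : @measurable _ borelR [set u | box n (u - x)].
    by apply: (@measurable_shift _ (- x)); exact: measurable_box.
  rewrite -(integral_shift x mBx nG).
  rewrite (_ : [set v | _] = (box n : set borelR)); last first.
    by apply/seteqP; split => v/=; rewrite addrK.
  apply: eq_integral => u _; apply: eq_integral => xi _.
  by rewrite addrC -translateD.
have n1 : 0 < n%:R :> R by rewrite ltr0n.
apply: (@le_trans _ _ (n%:R^-1%:E * (\int[leb]_(u in box n) G u + `|x|%:E))%E).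
  by apply: lee_wpmul2l; [rewrite lee_fin invr_ge0 ltW|exact: box_shift_le].
rewrite ge0_muleDr ?lee_fin//; last by apply: integral_ge0 => u _; exact: nG.2.
by rewrite leeD2l// -EFinM mulrC.
Qed.

Variables (Q : nat -> probability (config R) R) (P : probability (config R) R).
Hypothesis Q_equi : equicontinuous Q.
Hypothesis cvg_events :
  forall s, fine (Q n (events s)) @[n --> \oo] --> fine (P (events s)).
Hypothesis Q_shift : forall (x e : R), 0 < e -> \forall n \near \oo, forall A, measurable A ->
  (Q n (translate x @^-1` A) <= Q n A + e%:E)%E.

Lemma restr_event_id i : exists r, forall r', (r <= r')%N ->
  restr r' @^-1` (@event R i) = event i.
Proof.
rewrite /event; case: (unpickle i) => [[[a b] m]|]; last by exists 0%N.
have [r _ ab] := @rat_itv_window R a b.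
exists r => r' rr'; apply/seteqP; split => xi; rewrite /preimage /at_least/= restrictE setIidl//;
  apply: (subset_trans ab) => x; rewrite /window/= !in_itv/=;
  have : r%:R <= r'%:R :> R by rewrite ler_nat.
  all: by move=> h /andP[h1 h2]; apply/andP; split; lra.
Qed.

Lemma restr_events_id s : exists r, forall r', (r <= r')%N ->
  restr r' @^-1` (@events R s) = events s.
Proof.
elim: s => [|i s [r hr]]; first by exists 0%N => r' _; apply/seteqP; split.
have [r1 hr1] := restr_event_id i; exists (maxn r r1) => r'; rewrite geq_max => /andP[h1 h2].
rewrite -cat1s events_cat preimage_setI hr//; congr (_ `&` _).
have e1 : events [:: i] = @event R i.
  apply/seteqP; split => xi /=; first by apply; rewrite mem_head.
  by move=> h j; rewrite inE => /eqP ->.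
by rewrite e1 hr1.
Qed.

(** Both a local event and its translate have convergent probabilities, and
    these become equal in the limit. The counting events, which are local, form
    a pi-system. *)
Lemma limit_stationary : stationary P.
Proof.
move=> x.
have H s : P (translate x @^-1` (events s)) = P (events s).
  have [r hr] := restr_events_id s.
  pose r1 := maxn r 1; have r10 : (0 < r1)%N by rewrite /r1 leq_max orbT.
  have mE := @measurable_events R s.
  have mT := measurable_translate_preimage x mE.
  pose r2 := (r1 + (Num.truncn `|x|).+1)%N.
  have r20 : (0 < r2)%N by rewrite /r2 addnS.
  have hT : restr r2 @^-1` (translate x @^-1` (events s)) = translate x @^-1` (events s).
    have e xi : restr r1 (translate x (restr r2 xi)) = restr r1 (translate x xi).
      apply: config_eqP => A; rewrite !restrictE !translateE restrictE; congr (xi _).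
      apply/setIidl => y /= [_]; rewrite /window/= !in_itv/= /r2 natrD.
      have /ltr_normlP[h1 h2] := truncnS_gt `|x|; move=> /andP[h3 h4].
      by apply/andP; split; lra.
    by rewrite -(hr r1) ?leq_maxl//; apply/seteqP; split => xi; rewrite /preimage/= e.
  have c1 := cvg_restr_sets Q_equi cvg_events r10 mE.
  have c2 := cvg_restr_sets Q_equi cvg_events r20 mT.
  move: c1 c2; rewrite hT hr ?leq_maxl// => c1 c2.
  have fP S : measurable S -> P S \is a fin_num by move=> mS; exact: fin_num_measure.
  have fQ n S : measurable S -> Q n S \is a fin_num by move=> mS; exact: fin_num_measure.
  rewrite -(fineK (fP _ mE)) -(fineK (fP _ mT)); congr (_%:E).
  apply/eqP; rewrite eq_le; apply/andP; split; apply/ler_addgt0Pr => e e0.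
    apply: (ler_cvg_to c2 (cvgD c1 (cvg_cst e))).
    move: (Q_shift x e0); apply: filterS => n /(_ _ mE) h.
    by rewrite /= -lee_fin EFinD !fineK// fQ.
  apply: (ler_cvg_to c1 (cvgD c2 (cvg_cst e))).
  move: (Q_shift (- x) e0); apply: filterS => n /(_ _ mT) h.
  rewrite /= -lee_fin EFinD !fineK ?fQ//; apply: le_trans h.
  rewrite (_ : translate (- x) @^-1` _ = events s)//.
  apply/seteqP; split => xi; rewrite /preimage/= translateD subrr translate0//.
move=> A mA; move: A mA; apply: events_dynkin => //.
- move=> S mS h; rewrite preimage_setC !probability_setC//; first by rewrite h.
  exact: measurable_translate_preimage.
- move=> F mF tF h; rewrite preimage_bigcup !measure_bigcup//.
  + by apply: eq_eseriesr => i _; exact: h.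
  + by move=> i _; exact: measurable_translate_preimage.
  + apply/trivIsetP => i j _ _ ij; rewrite -preimage_setI.
    by move/trivIsetP : tF => /(_ i j I I ij) ->; rewrite preimage_set0.
Qed.

End limit_stationary.

(** * Accumulation points under an exponential density bound *)

Section accumulation.
Context (R : realType).
Local Notation borelR := (measurableTypeR R).

Lemma cvg_close (u v : nat -> \bar R) (l : \bar R) : l \is a fin_num ->
  v n @[n --> \oo] --> l ->
  (forall e : R, 0 < e -> \forall n \near \oo,
     (u n <= v n + e%:E)%E /\ (v n <= u n + e%:E)%E) ->
  u n @[n --> \oo] --> l.
Proof.
move=> lf vl uv; rewrite -(fineK lf) in vl *.
have /fine_cvgP[vf vl'] := vl.
have uf : \forall n \near \oo, u n \is a fin_num.
  move: (uv 1 ltr01) vf; apply: filterS2 => n [h1 h2] vfn.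
  move: h1 h2; rewrite -(fineK vfn); case: (u n) => [r| |]//=.
apply/fine_cvgP; split => //.
apply/cvgrPdist_le => e e0; have e2 : 0 < e / 2 by rewrite divr_gt0.
move/cvgrPdist_le : vl' => /(_ _ e2) vl'.
have ufv : \forall n \near \oo, u n \is a fin_num /\ v n \is a fin_num.
  by move: uf vf; apply: filterS2.
move: (uv _ e2) ufv vl'; apply: filterS3 => n [h1 h2] [ufn vfn].
move: h1 h2; rewrite -(fineK vfn) -(fineK ufn) -!EFinD !lee_fin /=.
rewrite !ler_norml => h1 h2 /andP[h3 h4].
by apply/andP; split; lra.
Qed.

(** The conclusion of [stationarization_close], freed from the probability
    space that carries the tiles and the shift. *)
Definition closeness (C : R) n (n0 : (0 < n)%N) (Q S : probability (config R) R) :=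
  forall (r : nat) (F : config R -> R) (c K : R), 2 * r%:R < n%:R :> R ->
  measurable_fun setT F -> (forall eta, 0 <= F eta) -> 0 <= c ->
  (forall eta, F eta <= c * (1 + count (window r) eta)) -> local_on (window r) F ->
  0 < K ->
  let err := c * (2 * r%:R / n%:R *
      (1 + 6 * ((C * n%:R + 3 * r%:R * (expR K - 1)) / K))) in
  (\int[Q]_eta (F eta)%:E <= \int[S]_eta (F eta)%:E + err%:E)%E /\
  (\int[S]_eta (F eta)%:E <= \int[Q]_eta (F eta)%:E + err%:E)%E.

Lemma stationarization_shifted_law n (n0 : (0 < n)%N) (C : R)
    (Rz : set (config R) -> \bar R) (Q : probability (config R) R) : 0 <= C ->
  (forall A, measurable A -> (Rz A <= (expR (C * n%:R))%:E * binomial_process R n0 A)%E) ->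
  is_stationarization (box_lt R n0) Rz Q ->
  exists mu : probability (config R) R,
    (forall A, measurable A -> mu A <= (expR (C * n%:R))%:E * binomial_process R n0 A)%E /\
    closeness C n0 Q (shifted_law n0 mu).
Proof.
move=> C0 RzB [d] [W] [Pr] [xi] [U] [Xi] [xiE UE indep XiE QE].
have lE : n%:R / 2 - - (n%:R / 2) = n%:R :> R by lra.
rewrite lE in xiE.
exists (distribution Pr (xi 0)); split.
  move=> A mA; have := tile_law_le RzB xiE 0 mA.
  rewrite mul0r (_ : translate 0 @^-1` A = A)//.
  by apply/seteqP; split => eta; rewrite /preimage/= translate0.
move=> r F c K rn mF F0 c0 Fc locF K0 err.
have -> : (\int[Q]_eta (F eta)%:E = \int[distribution Pr Xi]_eta (F eta)%:E)%E.
  by apply: eq_measure_integral => A mA _; exact: QE.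
exact: (stationarization_close C0 RzB xiE UE indep XiE rn mF F0 c0 Fc locF K0).
Qed.

(** K is chosen first, and makes the part of the error that does not depend on
    n small; n is then taken large. *)
Lemma error_cvg (C c r e : R) : 0 <= C -> 0 <= c -> 0 <= r -> 0 < e ->
  exists2 K, 0 < K & \forall n \near \oo,
  c * (2 * r / n.+1%:R * (1 + 6 * ((C * n.+1%:R + 3 * r * (expR K - 1)) / K))) <= e.
Proof.
move=> C0 c0 r0 e0.
(* The part of the error that does not depend on n is 12 c r C / K. *)
pose K := 24 * c * r * C / e + 1.
have K0 : 0 < K by rewrite ltr_wpDl// divr_ge0 ?mulr_ge0//; exact: ltW.
exists K => //.
pose M := 2 * c * r * (1 + 18 * r * (expR K - 1) / K).
have := @nbhs_infty_ger R (2 * M / e).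
apply: filterS => n hn.
have n1 : 0 < n.+1%:R :> R by [].
have hn' : 2 * M / e <= n.+1%:R by apply: (le_trans hn); rewrite ler_nat.
have h1 : M / n.+1%:R <= e / 2.
  rewrite ler_pdivrMr//; move: hn'; rewrite ler_pdivrMr//; lra.
have h2 : 12 * c * r * C / K <= e / 2.
  rewrite ler_pdivrMr// /K mulrDr mulr1.
  rewrite (_ : e / 2 * (24 * c * r * C / e) = 12 * c * r * C); last by field; rewrite gt_eqF.
  by lra.
rewrite (_ : c * _ = M / n.+1%:R + 12 * c * r * C / K); first by rewrite [leRHS]splitr; exact: lerD.
by rewrite /M; field; rewrite !gt_eqF.
Qed.

Lemma local_tame_window (F : config R -> R) : local_tame F ->
  exists r c, [/\ (0 < r)%N, 0 <= c, local_on (window r) F &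
    forall xi, `|F xi| <= c * (1 + count (window r) xi)].
Proof.
move=> [a [b [locF [c c0 tF]]]].
pose r := (Num.truncn (`|a| + `|b| : R)).+1.
have abr : `[a, b]%classic `<=` (window r : set borelR).
  have := truncnS_gt (`|a| + `|b| : R); rewrite -/r => hr.
  move=> x; rewrite /window/= !in_itv/= => /andP[h1 h2].
  have := ler_norm (- a); have := ler_norm b; rewrite normrN.
  have := normr_ge0 a; have := normr_ge0 b.
  by move=> *; apply/andP; split; lra.
exists r, c; split => //; first exact: ltW.
- by move=> xi eta h; apply: locF => A mA Aab; apply: h => //; exact: subset_trans abr.
- move=> xi; have := tF xi; rewrite -lee_fin EFinM EFinD.
  rewrite -(countE _ (@measurable_window R r) (@window_sub R r)) => /le_trans; apply.
  apply: lee_wpmul2l; first by rewrite lee_fin ltW.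
  rewrite leeD2l//; apply: le_measure; rewrite ?inE//; exact: measurable_window.
Qed.

Lemma local_on_restr r (F : config R -> R) xi : local_on (window r) F ->
  F (restr r xi) = F xi.
Proof. by move=> locF; apply: locF => A mA Ar; rewrite restrictE setIidl. Qed.

(** The density bound makes the shifted laws equicontinuous, which yields a
    limit along a subsequence. The stationarizations have the same limit, because
    they are asymptotically close to the shifted laws on nonnegative local tame
    functionals. A signed functional is split into its positive and negative parts. *)
Theorem accumulation_of_stationarizations (C : R)
    (Rz : forall n, (0 < n)%N -> set (config R) -> \bar R)
    (Pstat : nat -> probability (config R) R) : 0 <= C ->
  (forall n (n0 : (0 < n)%N) A, measurable A ->
    (Rz n n0 A <= (expR (C * n%:R))%:E * binomial_process R n0 A)%E) ->
  (forall n (n0 : (0 < n)%N), is_stationarization (box_lt R n0) (Rz n n0) (Pstat n)) ->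
  exists (phi : nat -> nat) (P : probability (config R) R),
    [/\ {homo phi : i j / (i < j)%N}, (0 < phi 0)%N, stationary P
      & cvg_local (fun k => Pstat (phi k)) P].
Proof.
move=> C0 RzB PstatE.
have /choice[mu hmu] : forall n, exists mu : probability (config R) R,
    (forall A, measurable A ->
      mu A <= (expR (C * n.+1%:R))%:E * binomial_process R (ltn0Sn n) A)%E /\
    closeness C (ltn0Sn n) (Pstat n.+1) (shifted_law (ltn0Sn n) mu).
  move=> n; apply: (stationarization_shifted_law C0 (RzB n.+1 (ltn0Sn n))).
  exact: PstatE.
pose Q0 n := shifted_law (ltn0Sn n) (mu n).
have Q0e : equicontinuous Q0.
  by apply: (equicontinuous_shifted_law C0) => n; exact: (hmu n).1.
have [phi [P [hphi conv]]] := equicontinuous_cvg_events Q0e.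
pose Q n := Q0 (phi n).
have Qe : equicontinuous Q.
  move=> r c Phi r0 c0 mPhi Phi0 iPhi PhiC Phicvg e e0.
  have := Q0e r c Phi r0 c0 mPhi Phi0 iPhi PhiC Phicvg e e0.
  by apply: filterS => j hj n; exact: hj.
have phige n : (n <= phi n)%N.
  by elim: n => // n ih; apply: leq_ltn_trans ih _; exact: hphi.
have philarge (T : nat -> Prop) : (\forall n \near \oo, T n) -> \forall n \near \oo, T (phi n).
  move=> [N _ hN]; exists N => // n /= Nn; apply: hN => /=.
  exact: leq_trans Nn (phige n).
(* The shifted laws are indexed from 0, with n.+1 points at index n. *)
exists (fun k => (phi k).+1), P; split => //.
- apply: (limit_stationary Qe conv) => x e e0.
  have : \forall n \near \oo, `|x| / e <= n%:R by exact: nbhs_infty_ger.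
  move=> /philarge; apply: filterS => n hn A mA.
  apply: (le_trans (shifted_law_translate _ _ _ mA)).
  rewrite leeD2l// lee_fin ler_pdivrMr// -ler_pdivrMl//.
  by apply: (@le_trans _ _ (phi n)%:R); [rewrite mulrC|rewrite ler_nat].
move=> F mF /local_tame_window[r [c [r0 c0 locF tF]]].
have part (G : config R -> R) : measurable_fun setT G -> (forall xi, 0 <= G xi) ->
    (forall xi, G xi <= c * (1 + count (window r) xi)) -> local_on (window r) G ->
    (\int[P]_xi (G xi)%:E)%E \is a fin_num /\
    (\int[Pstat (phi n).+1]_xi (G xi)%:E @[n --> \oo] --> \int[P]_xi (G xi)%:E)%E.
  move=> mG G0 Gc locG.
  have [Py QP] := cvg_local_nonneg Qe conv r0 c0 mG G0 (fun xi => local_on_restr xi locG) Gc.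
  have Pf : (\int[P]_xi (G xi)%:E)%E \is a fin_num.
    by rewrite ge0_fin_numE//; apply: integral_ge0 => xi _; rewrite lee_fin.
  split => //; apply: (cvg_close Pf QP) => e e0.
  have [K K0 hK] := @error_cvg C c r%:R e C0 c0 (ler0n _ _) e0.
  have big : \forall n \near \oo, 2 * r%:R <= n%:R :> R by exact: nbhs_infty_ger.
  move: (philarge _ hK) (philarge _ big); apply: filterS2 => n hn rn.
  have rn' : 2 * r%:R < (phi n).+1%:R :> R by apply: (le_lt_trans rn); rewrite ltr_nat.
  have [h1 h2] := (hmu (phi n)).2 r G c K rn' mG G0 c0 Gc locG K0.
  by split; [apply: (le_trans h1)|apply: (le_trans h2)]; rewrite leeD2l// lee_fin.
have bnd (x y : R) : `|x| <= y -> Order.max x 0 <= y.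
  move=> xy; rewrite ge_max (le_trans (ler_norm x) xy)/=.
  exact: le_trans (normr_ge0 x) xy.
have [fp cp] : (\int[P]_xi (Order.max (F xi) 0)%:E)%E \is a fin_num /\
    (\int[Pstat (phi n).+1]_xi (Order.max (F xi) 0)%:E @[n --> \oo] -->
      \int[P]_xi (Order.max (F xi) 0)%:E)%E.
  apply: part.
  - exact: measurable_maxr.
  - by move=> xi; rewrite le_max lexx orbT.
  - by move=> xi; exact: bnd.
  - by move=> xi eta h; rewrite (locF xi eta h).
have [fm cm] : (\int[P]_xi (Order.max (- F xi) 0)%:E)%E \is a fin_num /\
    (\int[Pstat (phi n).+1]_xi (Order.max (- F xi) 0)%:E @[n --> \oo] -->
      \int[P]_xi (Order.max (- F xi) 0)%:E)%E.
  apply: part.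
  - by apply: measurable_maxr => //; exact: measurableT_comp.
  - by move=> xi; rewrite le_max lexx orbT.
  - by move=> xi; apply: bnd; rewrite normrN.
  - by move=> xi eta h; rewrite (locF xi eta h).
have E (S : probability (config R) R) : ('E_S[F] = \int[S]_xi (Order.max (F xi) 0)%:E -
    \int[S]_xi (Order.max (- F xi) 0)%:E)%E.
  rewrite unlock integralE; congr (_ - _)%E; apply: eq_integral => xi _.
    by rewrite funeposE -EFin_max.
  by rewrite funenegE -EFinN -EFin_max.
under eq_fun do rewrite E; rewrite E.
by apply: cvgeB => //; rewrite fin_num_adde_defl// fin_numN.
Qed.

End accumulation.

(** * Powers of the distance as mixtures of cosines *)

Section cosine_mixture.
Context (R : realType).
Local Notation borelR := (measurableTypeR R).
Local Notation leb := (@lebesgue_measure R).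
Variable a : R.
Hypotheses (a0 : 0 < a) (a2 : a < 2).

(** In terms of t = e^v, this is (1 - cos (t x)) t^(-a-1) dt: the kernel that
    represents |x|^a. On the logarithmic scale, replacing x by a multiple is a
    translation of v. *)
Definition cosmix (x v : R) : R := (1 - cos (expR v * x)) * expR (- a * v).

Lemma cosmix_ge0 x v : 0 <= cosmix x v.
Proof. by rewrite mulr_ge0 ?expR_ge0// subr_ge0 cos_le1. Qed.

Lemma continuous_cosmix x : continuous (cosmix x).
Proof.
move=> v; apply: (@continuousM _ R^o (fun v => 1 - cos (expR v * x)) (fun v => expR (- a * v))).
  apply: (@continuousB _ R^o R^o); first exact: cst_continuous.
  apply: continuous_comp; last exact: continuous_cos.
  by apply: (@continuousM _ R^o); [exact: continuous_expR|exact: cst_continuous].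
apply: continuous_comp; last exact: continuous_expR.
by apply: (@continuousM _ R^o); [exact: cst_continuous|exact: cvg_id].
Qed.

Lemma sin_le_id (x : R) : 0 <= x -> sin x <= x.
Proof.
rewrite le_eqVlt => /predU1P[<-|x0]; first by rewrite sin0.
have [c _] := @MVT R sin cos 0 x x0 (fun c _ => is_derive_sin c)
  (continuous_subspaceT (@continuous_sin R)).
rewrite sin0 !subr0 => ->; by rewrite ler_piMl ?cos_le1// ltW.
Qed.

Lemma cos_quadratic (x : R) : 0 <= x -> 1 - cos x <= x ^+ 2.
Proof.
move=> x0; have x2 : 0 <= x / 2 by rewrite divr_ge0.
have -> : cos x = 1 - 2 * sin (x / 2) ^+ 2.
  by rewrite {1}(splitr x) cosD -!expr2 cos2sin2; ring.
have h1 : sin (x / 2) <= x / 2 := sin_le_id x2.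
have h2 : - (x / 2) <= sin (x / 2).
  have [h|h] := leP (x / 2) 1.
    apply: (@le_trans _ _ 0); first lra.
    move: x2; rewrite le_eqVlt => /predU1P[<-|x2]; first by rewrite sin0.
    by apply/ltW/sin2_gt0; apply/andP; split; lra.
  by apply: le_trans (sin_geN1 _); lra.
have : sin (x / 2) ^+ 2 <= (x / 2) ^+ 2 by rewrite -subr_ge0 subr_sqr mulr_ge0//; lra.
have : (x / 2) ^+ 2 = x ^+ 2 / 4 by field.
have := sqr_ge0 x; lra.
Qed.

Let d := Order.min a (2 - a).
Let d0 : 0 < d. Proof. by rewrite /d lt_min a0 subr_gt0. Qed.

(** For v >= 0 the decay comes from a > 0; for v < 0 it comes from a < 2 and
    from 1 - cos y <= y^2. *)
Lemma cosmix_dominated v : cosmix 1 v <= 2 * expR (- d * `|v|).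
Proof.
have e2 t : 0 <= 2 * expR t by rewrite mulr_ge0 ?expR_ge0.
rewrite /cosmix mulr1; have [v0|v0] := leP 0 v.
  apply: (@le_trans _ _ (2 * expR (- a * v))).
    by rewrite ler_wpM2r ?expR_ge0//; have := cos_geN1 (expR v); lra.
  rewrite ler_wpM2l// ler_expR !mulNr lerN2 (ger0_norm v0) ler_wpM2r//.
  by rewrite /d ge_min lexx.
apply: (@le_trans _ _ (expR v ^+ 2 * expR (- a * v))).
  by rewrite ler_wpM2r ?expR_ge0//; apply: cos_quadratic; exact: expR_ge0.
rewrite -expRM_natl -expRD; apply: (@le_trans _ _ (expR (- d * - v))).
  rewrite ler_expR; have : d <= 2 - a by rewrite /d ge_min lexx orbT.
  move=> h; have : 0 <= (2 - a - d) * - v by rewrite mulr_ge0//; lra.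
  by move=> h'; rewrite -subr_ge0 (_ : _ - _ = (2 - a - d) * - v)//; ring.
by rewrite (ltr0_norm v0) ler_peMl ?expR_ge0// ler1n.
Qed.

Definition mixc : \bar R := (\int[leb]_v (cosmix 1 v)%:E)%E.

Lemma measurable_cosmix x : measurable_fun setT (cosmix x).
Proof. by apply: continuous_measurable_fun; exact: continuous_cosmix. Qed.

Lemma mixc_ltry : (mixc < +oo)%E.
Proof.
have cf : continuous (fun v : R => 2 * expR (- d * `|v|)).
  move=> v; apply: (@continuousM _ R^o (fun=> 2) (fun v => expR (- d * `|v|))).
    exact: cst_continuous.
  apply: continuous_comp; last exact: continuous_expR.
  apply: (@continuousM _ R^o (fun=> - d) (fun v => `|v|)); first exact: cst_continuous.
  exact: norm_continuous.
have f0 (v : R) : 0 <= 2 * expR (- d * `|v|) by rewrite mulr_ge0 ?expR_ge0.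
apply: (@le_lt_trans _ _ (\int[leb]_v (2 * expR (- d * `|v|))%:E)%E).
  apply: ge0_le_integral => //.
  - by move=> v _; rewrite lee_fin cosmix_ge0.
  - by apply/measurable_EFinP; exact: measurable_cosmix.
  - by apply/measurable_EFinP; exact: continuous_measurable_fun.
  - by move=> v _; rewrite lee_fin cosmix_dominated.
rewrite (ge0_symfun_integralT f0 cf); last by move=> v /=; rewrite normrN.
rewrite lte_mul_pinfty// -set_itvcy.
apply: (@le_lt_trans _ _ ((2 / d)%:E * \int[leb]_x (exponential_pdf d x)%:E)%E); last first.
  by rewrite integral_exponential_pdf// mule1 ltry.
rewrite -ge0_integralZl//; last 3 first.
- by apply/measurable_EFinP; exact: measurable_exponential_pdf.
- by move=> x _; rewrite lee_fin exponential_pdf_ge0// ltW.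
- by rewrite lee_fin divr_ge0// ltW.
have mp : measurable_fun setT (fun x => (2 / d)%:E * (exponential_pdf d x)%:E)%E.
  by apply: emeasurable_funM => //; apply/measurable_EFinP; exact: measurable_exponential_pdf.
have p0 x : (0 <= (2 / d)%:E * (exponential_pdf d x)%:E)%E.
  by rewrite -EFinM lee_fin mulr_ge0 ?exponential_pdf_ge0 ?divr_ge0// ltW.
apply: (@le_trans _ _ (\int[leb]_(x in `[0%R, +oo[) ((2 / d)%:E * (exponential_pdf d x)%:E))%E).
  apply: ge0_le_integral => //.
  - by apply/measurable_EFinP; apply: measurable_funTS; exact: continuous_measurable_fun.
  - exact: (measurable_funTS mp).
  move=> x; rewrite /= in_itv/= andbT => x0.
  rewrite exponential_pdfE// -EFinM lee_fin ger0_norm//.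
  by rewrite mulrA divfK// gt_eqF.
by apply: ge0_subset_integral => //; exact: measurable_itv.
Qed.

Lemma mixc_gt0 : (0 < mixc)%E.
Proof.
have pi1 : 1 <= pi :> R by apply: le_trans (pi_ge2 R); rewrite ler1n.
have e1 : expR (-1) < 1 :> R by rewrite -[ltRHS]expR0 ltr_expR; lra.
have e0 : 0 < expR (-1) :> R by exact: expR_gt0.
pose q : R := 1 - cos (expR (-1)).
have q0 : 0 < q.
  have : cos (expR (-1)) < cos (0 : R).
    by rewrite ltr_cos// in_itv/= ?lexx ?pi_ge0//; apply/andP; split; lra.
  by rewrite cos0 /q subr_gt0.
apply: (@lt_le_trans _ _ (\int[leb]_(v in `[(-1)%R, 0%R]) q%:E)%E).
  rewrite integral_cst//= lebesgue_measure_itv/= lte_fin ifT; last lra.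
  by rewrite -EFinB -EFinM lte_fin; lra.
apply: (@le_trans _ _ (\int[leb]_(v in `[(-1)%R, 0%R]) (cosmix 1 v)%:E)%E).
  apply: ge0_le_integral => //.
  - by move=> v _; rewrite lee_fin ltW.
  - apply/measurable_EFinP; apply: measurable_funTS; exact: measurable_cosmix.
  move=> v; rewrite /= in_itv/= => /andP[v1 v0]; rewrite lee_fin /cosmix mulr1.
  have h1 : expR (-1) <= expR v by rewrite ler_expR.
  have h2 : expR v <= 1 by rewrite -[leRHS]expR0 ler_expR.
  have h3 : cos (expR v) <= cos (expR (-1)).
    move: h1; rewrite le_eqVlt => /predU1P[->//|h1]; apply: ltW.
    by rewrite ltr_cos// in_itv/=; apply/andP; split; lra.
  have h4 : 1 <= expR (- a * v) by rewrite -expR0 ler_expR mulNr oppr_ge0 mulr_ge0_le0// ltW.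
  apply: (@le_trans _ _ (1 - cos (expR v))); first by rewrite /q; lra.
  by rewrite ler_peMr// subr_ge0 cos_le1.
apply: ge0_subset_integral => //.
- by apply/measurable_EFinP; exact: measurable_cosmix.
- by move=> v _; rewrite lee_fin cosmix_ge0.
Qed.

(** Writing |x| = e^u, a translation of v by u takes cosmix 1 to cosmix x, up to
    the factor |x|^a. *)
Lemma powR_cosmix (x : R) : ((`|x| `^ a)%:E * mixc = \int[leb]_v (cosmix x v)%:E)%E.
Proof.
have [->|x0] := eqVneq x 0.
  rewrite normr0 powR0 ?gt_eqF// mul0e; apply/esym; apply: integral0_eq => v _.
  by rewrite /cosmix mulr0 cos0 subrr mul0r.
have nx : 0 < `|x| by rewrite normr_gt0.
pose u := ln `|x|.
have ux : expR u = `|x| by rewrite /u lnK.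
have ng : nnm (fun v : borelR => (cosmix 1 v)%:E).
  by split; [apply/measurable_EFinP; exact: measurable_cosmix|move=> v; rewrite lee_fin cosmix_ge0].
rewrite /mixc -(integral_shift u measurableT ng).
rewrite (_ : [set _ | _] = setT); last by apply/seteqP.
rewrite -ge0_integralZl//=; last 2 first.
- apply: (measurableT_comp ng.1); exact: measurable_funD.
- by move=> v _; exact: ng.2.
apply: eq_integral => v _; rewrite -EFinM; congr (_%:E).
rewrite /cosmix mulr1 expRD ux mulrDr expRD.
have -> : cos (expR v * `|x|) = cos (expR v * x).
  by case: (ger0P x) => // _; rewrite mulrN cosN.
have pe : `|x| `^ a * expR (- a * u) = 1.
  by rewrite /powR gt_eqF// -/u -expRD mulNr subrr expR0.
transitivity ((1 - cos (expR v * x)) * expR (- a * v) * (`|x| `^ a * expR (- a * u))).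
  ring.
by rewrite pe mulr1.
Qed.

End cosine_mixture.

(** * Conditional negative definiteness of the power kernel *)

Section finite_pairing.
Context (R : realType).
Local Notation borelR := (measurableTypeR R).
Local Notation leb := (@lebesgue_measure R).
Implicit Types (m : {measure set borelR -> \bar R}).

Section finite_copy.
Variables (m : {measure set borelR -> \bar R}) (mT : (m setT < +oo)%E).

(** Carries the finiteness of m, so that it can be turned into a structure. *)
Definition finite_copy : set borelR -> \bar R := let _ := mT in m.

HB.instance Definition _ := Measure.on finite_copy.

Let finite_copy_fin : fin_num_fun finite_copy.
Proof.
move=> A mA; rewrite ge0_fin_numE//; apply: le_lt_trans mT.
by apply: (@le_measure _ _ _ m); rewrite ?inE.
Qed.

HB.instance Definition _ := Measure_isFinite.Build _ _ _ finite_copy finite_copy_fin.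

End finite_copy.

Lemma finite_measureP m : (m setT < +oo)%E ->
  exists m' : {finite_measure set borelR -> \bar R}, m = m' :> {measure set borelR -> \bar R}.
Proof. by move=> mT; exists (finite_copy mT); apply: eq_measure. Qed.

Lemma finite_tonelli d (T : measurableType d) (m : {measure set borelR -> \bar R})
    (m2 : {sigma_finite_measure set T -> \bar R}) (f : borelR * T -> \bar R) :
  (m setT < +oo)%E -> nnm f ->
  (\int[m]_x \int[m2]_y f (x, y) = \int[m2]_y \int[m]_x f (x, y))%E.
Proof.
move=> /finite_measureP[m' ->] [mf f0].
exact: (@fubini_tonelli _ _ _ _ _ m' m2 f mf f0).
Qed.

Lemma nnm_finite_integral d (T : measurableType d) m (f : T * borelR -> \bar R) :
  (m setT < +oo)%E -> nnm f -> nnm (fun t => \int[m]_x f (t, x))%E.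
Proof.
move=> /finite_measureP[m' ->] [mf f0]; split; last by move=> t; apply: integral_ge0.
exact: (@measurable_fun_fubini_tonelli_F _ _ _ _ _ m' f mf f0).
Qed.

Section trigonometric_moments.
Variables (m : {measure set borelR -> \bar R}) (N t : R).
Hypothesis mN : m setT = N%:E.

Let C := (\int[m]_x cos (t * x))%R.
Let S := (\int[m]_x sin (t * x))%R.

Lemma measurable_cosM : measurable_fun setT (fun x : borelR => cos (t * x)).
Proof.
apply: (measurableT_comp (continuous_measurable_fun (@continuous_cos R))).
exact: measurable_funM.
Qed.

Lemma measurable_sinM : measurable_fun setT (fun x : borelR => sin (t * x)).
Proof.
apply: (measurableT_comp (continuous_measurable_fun (@continuous_sin R))).
exact: measurable_funM.
Qed.

Lemma bounded_integrable (f : borelR -> R) (M : R) : measurable_fun setT f ->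
  (forall x, `|f x| <= M) -> m.-integrable setT (EFin \o f).
Proof.
move=> mf fM; apply: measurable_bounded_integrable => //; first by rewrite mN ltry.
exists M; split; first exact: num_real.
by move=> M' MM' x _ /=; apply: (le_trans (fM x)); exact: ltW.
Qed.

Lemma integrable_trigonometric (a b c : R) :
  m.-integrable setT (EFin \o (fun x => a - b * cos (t * x) - c * sin (t * x))).
Proof.
apply: (@bounded_integrable _ (`|a| + `|b| + `|c|)).
  apply: measurable_funB; first apply: measurable_funB => //; apply: measurable_funM => //.
    exact: measurable_cosM.
  exact: measurable_sinM.
move=> x; apply: (le_trans (ler_normB _ _)); apply: lerD.
  apply: (le_trans (ler_normB _ _)); apply: lerD => //.
  by rewrite normrM ler_piMr// cos_max.
by rewrite normrM ler_piMr// sin_max.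
Qed.

Lemma integral_trigonometric (a b c : R) :
  (\int[m]_x (a - b * cos (t * x) - c * sin (t * x))%:E = (a * N - b * C - c * S)%:E)%E.
Proof.
have ic := bounded_integrable measurable_cosM (fun x => cos_max (t * x)).
have is_ := bounded_integrable measurable_sinM (fun x => sin_max (t * x)).
have int2 (u v : R) (f : R -> R) : m.-integrable setT (EFin \o f) ->
    m.-integrable setT (EFin \o (fun x => v * f x)).
  by move=> /(integrableZl measurableT v).
have ia : m.-integrable setT (EFin \o (fun=> a)).
  by apply: (@bounded_integrable _ `|a|).
have iab : m.-integrable setT (EFin \o (fun x => a - b * cos (t * x))).
  have := integrable_trigonometric a b 0.
  by congr (integrable _ _ _); apply/funext => x /=; rewrite mul0r subr0.
rewrite -[LHS]fineK; last exact: (integrable_fin_num _ (integrable_trigonometric a b c)).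
rewrite -/(Rintegral m setT (fun x => a - b * cos (t * x) - c * sin (t * x))).
by rewrite !RintegralB ?RintegralZl// ?Rintegral_cst// ?mN//; apply: int2.
Qed.

End trigonometric_moments.

Section positivity.
Variables (a : R) (a0 : 0 < a) (a2 : a < 2).

Definition pairing (m1 m2 : {measure set borelR -> \bar R}) : \bar R :=
  (\int[m1]_x \int[m2]_y (`|x - y| `^ a)%:E)%E.

Let q (v : R) (z : borelR * borelR) : \bar R := (cosmix a (z.1 - z.2) v)%:E.

Let mq : measurable_fun setT (fun w : (borelR * borelR) * borelR => q w.2 w.1).
Proof.
apply/measurable_EFinP; apply: measurable_funM.
  apply: measurable_funB => //.
  apply: (measurableT_comp (continuous_measurable_fun (@continuous_cos R))).
  apply: measurable_funM.
    by apply: measurableT_comp; [exact: measurable_expR|exact: measurable_snd].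
  apply: measurable_funB.
    exact: (measurableT_comp measurable_fst measurable_fst).
  exact: (measurableT_comp measurable_snd measurable_fst).
apply: measurableT_comp; first exact: measurable_expR.
by apply: measurable_funM => //; exact: measurable_snd.
Qed.

Let q0 v z : (0 <= q v z)%E.
Proof. by rewrite lee_fin cosmix_ge0. Qed.

Let Q (m1 m2 : {measure set borelR -> \bar R}) (v : borelR) : \bar R :=
  (\int[m1]_x \int[m2]_y q v (x, y))%E.

Lemma measurable_kernel : measurable_fun setT
  (fun z : borelR * borelR => (`|z.1 - z.2| `^ a)%:E).
Proof.
apply/measurable_EFinP; apply: (measurableT_comp (@measurable_powR R a)).
by apply: measurableT_comp => //; exact: measurable_funB.
Qed.

Lemma nnm_kernel : nnm (fun z : borelR * borelR => (`|z.1 - z.2| `^ a)%:E).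
Proof. by split; [exact: measurable_kernel|move=> z; rewrite lee_fin powR_ge0]. Qed.

Let nnm_Q m1 m2 : (m1 setT < +oo)%E -> (m2 setT < +oo)%E -> nnm (Q m1 m2).
Proof.
move=> f1 f2.
have h1 : nnm (fun w : borelR * borelR => \int[m2]_y q w.1 (w.2, y))%E.
  apply: (@nnm_finite_integral _ _ m2
    (fun w : (borelR * borelR) * borelR => q w.1.1 (w.1.2, w.2)) f2).
  split; last by move=> w; exact: q0.
  apply: (@measurableT_comp _ _ _ _ _ _ (fun w : (borelR * borelR) * borelR => q w.2 w.1) _
    (fun w : (borelR * borelR) * borelR => ((w.1.2, w.2), w.1.1))) => //.
  apply: measurable_fun_pair.
    apply: measurable_fun_pair; last exact: measurable_snd.
    exact: (measurableT_comp measurable_snd measurable_fst).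
  exact: (measurableT_comp measurable_fst measurable_fst).
exact: (@nnm_finite_integral _ _ m1 (fun w => \int[m2]_y q w.1 (w.2, y))%E f1 h1).
Qed.

Lemma pairing_mixture m1 m2 : (m1 setT < +oo)%E -> (m2 setT < +oo)%E ->
  (pairing m1 m2 * mixc a = \int[leb]_v Q m1 m2 v)%E.
Proof.
move=> f1 f2.
have nk (x : borelR) : nnm (fun y : borelR => (`|x - y| `^ a)%:E).
  split; last by move=> y; rewrite lee_fin powR_ge0.
  exact: (measurableT_comp measurable_kernel (measurable_pair1 x)).
have [c cE] : exists c : R, mixc a = c%:E.
  exists (fine (mixc a)); rewrite fineK// ge0_fin_numE ?mixc_ltry//.
  exact/ltW/mixc_gt0.
have c0 : 0 <= c by rewrite -lee_fin -cE; exact/ltW/mixc_gt0.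
have nI := @nnm_finite_integral _ _ m2 (fun z : borelR * borelR => (`|z.1 - z.2| `^ a)%:E) f2 nnm_kernel.
rewrite cE muleC /pairing -(nnm_integralZ _ nI c0).
under eq_integral => x _ do rewrite -(nnm_integralZ _ (nk x) c0).
under eq_integral => x _ do under eq_integral => y _ do rewrite muleC -cE powR_cosmix//.
have h2 x : (\int[m2]_y \int[leb]_v (cosmix a (x - y) v)%:E =
    \int[leb]_v \int[m2]_y q v (x, y))%E.
  apply: (@finite_tonelli _ _ m2 leb (fun w => (cosmix a (x - w.1) w.2)%:E) f2).
  split; last by move=> w; rewrite lee_fin cosmix_ge0.
  apply: (@measurableT_comp _ _ _ _ _ _ (fun w : (borelR * borelR) * borelR => q w.2 w.1) _
    (fun w : borelR * borelR => ((x, w.1), w.2))) => //.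
  by apply: measurable_fun_pair; [apply: measurable_fun_pair|]; rewrite //; exact: measurable_fst.
under eq_integral => x _ do rewrite h2.
apply: (@finite_tonelli _ _ m1 leb (fun w => \int[m2]_y q w.2 (w.1, y))%E f1).
apply: (@nnm_finite_integral _ _ m2
    (fun w : (borelR * borelR) * borelR => q w.1.2 (w.1.1, w.2)) f2).
split; last by move=> w; exact: q0.
apply: (@measurableT_comp _ _ _ _ _ _ (fun w : (borelR * borelR) * borelR => q w.2 w.1) _
    (fun w : (borelR * borelR) * borelR => ((w.1.1, w.2), w.1.2))) => //.
apply: measurable_fun_pair.
  apply: measurable_fun_pair; last exact: measurable_snd.
  exact: (measurableT_comp measurable_fst measurable_fst).
exact: (measurableT_comp measurable_snd measurable_fst).
Qed.

Section equal_mass.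
Variables (m1 m2 : {measure set borelR -> \bar R}) (N : R).
Hypotheses (m1N : m1 setT = N%:E) (m2N : m2 setT = N%:E).

Let C m v := (\int[m]_x cos (expR v * x))%R.
Let S m v := (\int[m]_x sin (expR v * x))%R.

Let QE (m m' : {measure set borelR -> \bar R}) v : m setT = N%:E -> m' setT = N%:E ->
  Q m m' v = ((N * N - C m v * C m' v - S m v * S m' v) * expR (- a * v))%:E.
Proof.
move=> mN mN'; have e0 : 0 <= expR (- a * v) by exact: expR_ge0.
have ct x y : cosmix a (x - y) v = expR (- a * v) *
   (1 - cos (expR v * x) * cos (expR v * y) - sin (expR v * x) * sin (expR v * y)).
  by rewrite /cosmix mulrBr cosB; ring.
rewrite /Q /q /=.
have -> : (\int[m]_x \int[m']_y (cosmix a (x - y) v)%:E =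
    \int[m]_x ((expR (- a * v))%:E * (N - C m' v * cos (expR v * x) - S m' v * sin (expR v * x))%:E))%E.
  apply: eq_integral => x _.
  under eq_integral => y _ do rewrite ct EFinM.
  rewrite integralZl//; last exact: (integrable_trigonometric _ mN').
  rewrite (integral_trigonometric _ mN'); congr (_ * _%:E)%E.
  by rewrite mul1r; congr (_ - _ - _); exact: mulrC.
rewrite integralZl//; last exact: (integrable_trigonometric _ mN).
rewrite (integral_trigonometric _ mN) -EFinM; congr (_%:E).
rewrite /C /S; ring.
Qed.

(** By [powR_cosmix] it is enough to compare, for each frequency, the integrals
    of 1 - cos. As the masses are equal the constants cancel, and the right-hand
    side exceeds the left-hand side by (C1 - C2)^2 + (S1 - S2)^2, where C and S
    are the cosine and sine moments. *)
Lemma pairing_positive :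
  (pairing m1 m1 + pairing m2 m2 <= pairing m1 m2 + pairing m2 m1)%E.
Proof.
have f1 : (m1 setT < +oo)%E by rewrite m1N ltry.
have f2 : (m2 setT < +oo)%E by rewrite m2N ltry.
have c0 := mixc_gt0 a0; have cf := mixc_ltry a0 a2.
have [c cE] : exists c : R, mixc a = c%:E.
  by exists (fine (mixc a)); rewrite fineK// ge0_fin_numE// ltW.
have P0 m m' : (0 <= pairing m m')%E.
  by apply: integral_ge0 => x _; apply: integral_ge0 => y _; rewrite lee_fin powR_ge0.
have c0' : 0 < c by rewrite -lte_fin -cE.
suff : ((pairing m1 m1 + pairing m2 m2) * c%:E <= (pairing m1 m2 + pairing m2 m1) * c%:E)%E.
  by rewrite lee_pmul2r// ltry.
rewrite ge0_muleDl ?P0// [leRHS]ge0_muleDl ?P0// -cE.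
rewrite (pairing_mixture f1 f1) (pairing_mixture f2 f2).
rewrite (pairing_mixture f1 f2) (pairing_mixture f2 f1).
have qD := @nnm_integralD R _ borelR leb.
apply: (@le_trans _ _ (\int[leb]_v (Q m1 m1 v + Q m2 m2 v))%E).
  by rewrite (qD _ _ (nnm_Q f1 f1) (nnm_Q f2 f2)).
apply: (@le_trans _ _ (\int[leb]_v (Q m1 m2 v + Q m2 m1 v))%E); last first.
  by rewrite (qD _ _ (nnm_Q f1 f2) (nnm_Q f2 f1)).
apply: ge0_le_integral => //.
- by move=> v _; rewrite adde_ge0// (nnm_Q _ _).2.
- by apply: emeasurable_funD; apply: (nnm_Q _ _).1.
- by apply: emeasurable_funD; apply: (nnm_Q _ _).1.
move=> v _; rewrite !QE// -!EFinD lee_fin -!mulrDl ler_wpM2r ?expR_ge0//.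
have := sqr_ge0 (C m1 v - C m2 v); have := sqr_ge0 (S m1 v - S m2 v).
by rewrite !sqrrB !expr2; lra.
Qed.

End equal_mass.
End positivity.
End finite_pairing.

(** * The Riesz energy in terms of pairings *)

Section energy.
Context (R : realType).
Local Notation borelR := (measurableTypeR R).
Local Notation leb := (@lebesgue_measure R).
Implicit Types (m : {measure set borelR -> \bar R}) (g : config R).

Lemma ge0_integral_mrestr m (D : set borelR) (mD : measurable D) (f : borelR -> \bar R) :
  nnm f -> (\int[mrestr m mD]_x f x = \int[m]_(x in D) f x)%E.
Proof.
move=> [mf f0].
rewrite -(setUv D) ge0_integral_setU//; last 3 first.
- exact: measurableC.
- by rewrite setUv.
- exact/disj_setPCl.
rewrite [X in (_ + X)%E]null_set_integral//; last 3 first.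
- exact: measurableC.
- exact: measurable_funTS.
- by transitivity (m (~` D `&` D)) => //; rewrite setICl measure0.
rewrite adde0; apply: eq_measure_integral => A mA AD.
by transitivity (m (A `&` D)) => //; rewrite setIidl.
Qed.

Lemma pairing_sym (a : R) m1 m2 : (m1 setT < +oo)%E -> (m2 setT < +oo)%E ->
  pairing a m1 m2 = pairing a m2 m1.
Proof.
move=> f1 /finite_measureP[m2' ->].
have H := @finite_tonelli R _ borelR m1 m2'
  (fun z : borelR * borelR => (`|z.1 - z.2| `^ a)%:E) f1 (nnm_kernel a).
rewrite /pairing; apply: (etrans H).
by apply: eq_integral => x _; apply: eq_integral => y _; rewrite distrC.
Qed.

Variables (a : R) (n : nat).
Hypotheses (a0 : 0 < a).

Let B : set borelR := box n.
Let mB : measurable B. Proof. exact: measurable_box. Qed.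

Definition in_box m : {measure set borelR -> \bar R} := mrestr m mB.

Lemma in_boxT m : in_box m setT = m B.
Proof. by transitivity (m (setT `&` B)) => //; rewrite setTI. Qed.

Definition potential m (x : R) : \bar R := (\int[in_box m]_y (`|x - y| `^ a)%:E)%E.

Lemma nnm_kernel1 (x : R) : nnm (fun y : borelR => (`|x - y| `^ a)%:E).
Proof.
split; last by move=> y; rewrite lee_fin powR_ge0.
exact: (measurableT_comp (@measurable_kernel R a) (measurable_pair1 x)).
Qed.

Lemma nnm_potential m : (m B < +oo)%E -> nnm (potential m : borelR -> \bar R).
Proof.
move=> mBoo; apply: (@nnm_finite_integral _ _ _ (in_box m)
  (fun z : borelR * borelR => (`|z.1 - z.2| `^ a)%:E)); last exact: nnm_kernel.
by rewrite in_boxT.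
Qed.

Lemma kernel_le (x y : R) : B x -> B y -> `|x - y| `^ a <= n%:R `^ a.
Proof.
rewrite /B /box/= !in_itv/= => /andP[x1 x2] /andP[y1 y2].
apply: ge0_ler_powR; rewrite ?nnegrE//; first exact: ltW.
by rewrite ler_norml; apply/andP; split; lra.
Qed.

Lemma potential_le m x : B x -> (potential m x <= (n%:R `^ a)%:E * m B)%E.
Proof.
move=> Bx; rewrite /potential ge0_integral_mrestr; last exact: nnm_kernel1.
apply: (@le_trans _ _ (\int[m]_(y in B) (n%:R `^ a)%:E)%E); last by rewrite integral_cst.
apply: ge0_le_integral => //.
- exact: (measurable_funTS (nnm_kernel1 x).1).
- by move=> y By; rewrite lee_fin kernel_le.
Qed.

Lemma potential_fin m x : (m B < +oo)%E -> B x -> potential m x \is a fin_num.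
Proof.
move=> mBoo Bx; rewrite ge0_fin_numE; last by apply: integral_ge0 => y _; rewrite lee_fin powR_ge0.
apply: (le_lt_trans (potential_le m Bx)); exact: lte_mul_pinfty.
Qed.

Lemma pairing_in_box m m' : (m' B < +oo)%E ->
  pairing a (in_box m) (in_box m') = (\int[m]_(x in B) potential m' x)%E.
Proof. by move=> m'B; rewrite -ge0_integral_mrestr//; exact: nnm_potential. Qed.

Lemma pairing_fin m m' : (m B < +oo)%E -> (m' B < +oo)%E ->
  pairing a (in_box m) (in_box m') \is a fin_num.
Proof.
move=> mBoo m'B; rewrite ge0_fin_numE; last first.
  by apply: integral_ge0 => x _; apply: integral_ge0 => y _; rewrite lee_fin powR_ge0.
rewrite pairing_in_box//.
apply: (@le_lt_trans _ _ (\int[m]_(x in B) ((n%:R `^ a)%:E * m' B))%E).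
  apply: ge0_le_integral => //.
  - by move=> x _; exact: (nnm_potential m'B).2.
  - exact: (measurable_funTS (nnm_potential m'B).1).
  - by move=> x Bx; exact: potential_le.
rewrite integral_cst//; apply: lte_mul_pinfty => //.
by rewrite fin_numM// ge0_fin_numE.
Qed.

Lemma integrable_potential m m' : (m B < +oo)%E -> (m' B < +oo)%E ->
  m.-integrable B (EFin \o (fine \o potential m')).
Proof.
move=> mBoo m'B; apply: measurable_bounded_integrable => //.
  apply: measurable_funTS; apply: measurableT_comp => //; exact: (nnm_potential m'B).1.
exists (fine ((n%:R `^ a)%:E * m' B)); split; first exact: num_real.
move=> M MM x Bx /=; apply: ltW; apply: le_lt_trans MM.
rewrite ger0_norm; last by apply: fine_ge0; exact: (nnm_potential m'B).2.
apply: fine_le; [exact: potential_fin| |exact: potential_le].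
by rewrite fin_numM// ge0_fin_numE.
Qed.

Lemma Rintegral_potential m m' : (m B < +oo)%E -> (m' B < +oo)%E ->
  \int[m]_(x in B) fine (potential m' x) = fine (pairing a (in_box m) (in_box m')).
Proof.
move=> mBoo m'B; rewrite pairing_in_box// /Rintegral; congr fine.
by apply: eq_integral => x; rewrite inE => Bx; rewrite fineK// potential_fin.
Qed.

Lemma leb_box_ltry : (leb B < +oo)%E.
Proof. by rewrite /B leb_box ltry. Qed.

Lemma config_box_ltry g : (g B < +oo)%E.
Proof. exact: config_bounded_ltry g (n%:R / 2) B mB (@subset_refl _ _). Qed.

(** The kernel is bounded in the box: all terms are finite, and the square of
    the signed measure can be expanded. *)
Lemma riesz_energyE (s : R) g : a = - s -> riesz_energy s n g =
  fine (pairing a (in_box g) (in_box leb)) -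
  2^-1 * (fine (pairing a (in_box g) (in_box g)) + fine (pairing a (in_box leb) (in_box leb))).
Proof.
move=> aE; have gB := config_box_ltry g; have lB := leb_box_ltry.
have inner x : B x -> integral_fluct n g (fun y => riesz_potential s (x - y)) =
    fine (potential leb x) - fine (potential g x).
  move=> Bx.
  have N m : \int[m]_(y in B) riesz_potential s (x - y) = - fine (potential m x).
    rewrite /Rintegral /potential ge0_integral_mrestr -?fineN; last exact: nnm_kernel1.
    rewrite -integral_ge0N; last by move=> y _; rewrite lee_fin powR_ge0.
    by congr fine; apply: eq_integral => y _; rewrite -EFinN /riesz_potential aE.
  by rewrite /integral_fluct -/B !N opprK addrC.
rewrite /riesz_energy {1}/integral_fluct -/B.
have ii m m' : (m B < +oo)%E -> (m' B < +oo)%E -> m.-integrable B (EFin \o (fun x => fine (potential m' x))).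
  exact: integrable_potential.
rewrite (@eq_Rintegral _ _ _ g B (fun x => fine (potential leb x) - fine (potential g x))); last first.
  by move=> x; rewrite inE => /inner ->.
rewrite (@eq_Rintegral _ _ _ leb B (fun x => fine (potential leb x) - fine (potential g x))); last first.
  by move=> x; rewrite inE => /inner ->.
rewrite !RintegralB//; try exact: ii.
rewrite !Rintegral_potential//.
have -> : pairing a (in_box leb) (in_box g) = pairing a (in_box g) (in_box leb).
  by apply: pairing_sym; rewrite in_boxT.
by field.
Qed.

(** [pairing_positive] for the points and Lebesgue measure: both have mass n. *)
Lemma riesz_energy_ge0 (s : R) g : a = - s -> a < 2 -> g B = n%:R%:E ->
  0 <= riesz_energy s n g.
Proof.
move=> aE a2 gn; rewrite (riesz_energyE _ aE).
have lB : leb B = n%:R%:E by exact: leb_box.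
have gB := config_box_ltry g; have lB' := leb_box_ltry.
have := @pairing_positive R a a0 a2 (in_box g) (in_box leb) n%:R.
rewrite !in_boxT => /(_ gn lB).
have -> : pairing a (in_box leb) (in_box g) = pairing a (in_box g) (in_box leb).
  by apply: pairing_sym; rewrite in_boxT.
rewrite -(fineK (pairing_fin gB gB)) -(fineK (pairing_fin gB lB')) -(fineK (pairing_fin lB' lB')).
by rewrite -!EFinD lee_fin; lra.
Qed.

Lemma measurable_in_box_integral d (T : measurableType d) (c : T -> config R)
    (f : T * borelR -> \bar R) : measurable_fun setT c -> nnm f ->
  nnm (fun t => \int[in_box (c t)]_y f (t, y))%E.
Proof.
move=> mc [mf f0]; split; last by move=> t; apply: integral_ge0.
have mr : measurable_fun setT (fun t => restrict mB (c t)).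
  exact: (measurableT_comp (measurable_restrict mB) mc).
exact: (@measurable_config_integral R _ T (fun t => restrict mB (c t)) mr f f0 mf).
Qed.

Lemma nnm_self_pairing : nnm (fun g => pairing a (in_box g) (in_box g)).
Proof.
apply: (@measurable_in_box_integral _ (config R) id
  (fun z : config R * borelR => \int[in_box z.1]_y (`|z.2 - y| `^ a)%:E)%E) => //.
apply: (@measurable_in_box_integral _ (config R * borelR)%type fst
  (fun z => (`|z.1.2 - z.2| `^ a)%:E)); first exact: measurable_fst.
split; last by move=> z; rewrite lee_fin powR_ge0.
apply/measurable_EFinP; apply: (measurableT_comp (@measurable_powR R a)).
apply: measurableT_comp => //; apply: measurable_funB; last exact: measurable_snd.
exact: (measurableT_comp measurable_snd measurable_fst).
Qed.

Lemma nnm_linear (f : borelR -> \bar R) : nnm f -> nnm (fun g => \int[in_box g]_x f x)%E.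
Proof.
move=> [mf f0]; apply: (@measurable_in_box_integral _ (config R) id (fun z => f z.2)) => //.
by split => //; exact: (measurableT_comp mf measurable_snd).
Qed.

Lemma measurable_riesz_energy (s : R) : a = - s ->
  measurable_fun setT (riesz_energy s n : config R -> R).
Proof.
move=> aE; rewrite (_ : riesz_energy s n = (fun g => fine (pairing a (in_box g) (in_box leb)) -
  2^-1 * (fine (pairing a (in_box g) (in_box g)) + fine (pairing a (in_box leb) (in_box leb))))); last first.
  by apply/funext => g; exact: riesz_energyE.
have mfine (h : config R -> \bar R) : nnm h -> measurable_fun setT (fun g => fine (h g)).
  by move=> [mh _]; apply: measurableT_comp.
apply: measurable_funB; first by apply: mfine; apply: nnm_linear; apply: nnm_potential; exact: leb_box_ltry.
apply: measurable_funM => //; apply: measurable_funD => //; apply: mfine.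
exact: nnm_self_pairing.
Qed.

End energy.

(** * One point in each unit cell *)

Lemma ereal_sum_shuffle (R : realType) (A B C D E : \bar R) :
  (A + B + C + (D + E) = A + (B + D) + (C + E))%E.
Proof. by rewrite addeACA (addeA A B D). Qed.

Lemma ereal_sum_shuffle' (R : realType) (A B C D : \bar R) :
  (A + (B + B) + (C + D) = A + C + B + (B + D))%E.
Proof. by rewrite addeACA -(addeA B B D) addeA. Qed.

Lemma ereal_sum_shuffle3 (R : realType) (A P L Q C : \bar R) :
  (A + P + (L + Q) + C = A + L + C + (P + Q))%E.
Proof. by rewrite (addeACA A P L Q) (addeAC (A + L) (P + Q) C). Qed.

Section cells.
Context (R : realType).
Local Notation borelR := (measurableTypeR R).
Local Notation leb := (@lebesgue_measure R).
Implicit Types (m : {measure set borelR -> \bar R}) (g : config R) (h : config R -> \bar R).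
Variables (a : R) (n : nat).
Hypotheses (a0 : 0 < a).

Definition cell (j : nat) : set borelR :=
  `](- (n%:R / 2) + j%:R), (- (n%:R / 2) + j.+1%:R)]%classic.

Definition cells (j : nat) : set borelR :=
  `](- (n%:R / 2)), (- (n%:R / 2) + j%:R)]%classic.

Lemma measurable_cell j : measurable (cell j). Proof. exact: measurable_itv. Qed.
Lemma measurable_cells j : measurable (cells j). Proof. exact: measurable_itv. Qed.

Lemma leb_cell j : leb (cell j) = 1%E.
Proof.
rewrite /cell lebesgue_measure_itv/= lte_fin -natr1 ifT; last lra.
by rewrite -EFinB; congr (_%:E); lra.
Qed.

Lemma cellsS j : cells j.+1 = cells j `|` cell j.
Proof.
have j0 : 0 <= j%:R :> R by [].
rewrite /cells /cell -natr1; apply/seteqP; split => x /=; rewrite !in_itv/=.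
  move=> /andP[h1 h2]; case: (leP x (- (n%:R / 2) + j%:R)) => h3; [left|right];
  apply/andP; split => //; lra.
by case=> /andP[h1 h2]; apply/andP; split; lra.
Qed.

Lemma disj_cells j : [disjoint cells j & cell j].
Proof.
apply/disj_setPS => x []; rewrite /cells /cell/= !in_itv/= => /andP[h1 h2] /andP[h3 h4].
by move: h2; rewrite leNgt h3.
Qed.

Lemma cell_sub_box j : (j < n)%N -> cell j `<=` (box n : set borelR).
Proof.
rewrite -(ler_nat R) => jn x; rewrite /cell /box/= !in_itv/= => /andP[h1 h2].
have j0 : 0 <= j%:R :> R by [].
by apply/andP; split; lra.
Qed.

(** The cells have length 1: this is the expectation of h after adding one
    uniform point in each of the first j cells, independently. *)
Fixpoint cells_add (j : nat) h : config R -> \bar R :=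
  if j is k.+1 then addint (cell k) (cells_add k h) else h.

Lemma nnm_cells_add j h : nnm h -> nnm (cells_add j h).
Proof. by move=> nh; elim: j => //= j ih; apply: nnm_addint => //; exact: measurable_cell. Qed.

Lemma cells_add_le j h h' g : nnm h -> nnm h' -> (forall g, h g <= h' g)%E ->
  (cells_add j h g <= cells_add j h' g)%E.
Proof.
move=> nh nh' hh; elim: j g => [|j ih] g; first exact: hh.
by apply: addint_le => //; [exact: measurable_cell|exact: measurable_cell|
  exact: nnm_cells_add|exact: nnm_cells_add].
Qed.

Lemma cells_addD j h h' g : nnm h -> nnm h' ->
  (cells_add j (fun g => h g + h' g) g = cells_add j h g + cells_add j h' g)%E.
Proof.
move=> nh nh'; elim: j g => // j ih g /=.
rewrite -addintD; [|exact: measurable_cell|exact: nnm_cells_add|exact: nnm_cells_add].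
by apply: eq_integral => x _; rewrite ih.
Qed.

Lemma addint_affine j h g (A : \bar R) (f : borelR -> \bar R) : (0 <= A)%E -> nnm f ->
  (forall x, cell j x -> h (add_point x g) = A + f x)%E ->
  (addint (cell j) h g = A + \int[leb]_(x in cell j) f x)%E.
Proof.
move=> A0 [mf f0] hE; have mc := measurable_cell j.
rewrite /addint (eq_integral (fun x => A + f x)%E); last by move=> x; rewrite inE => /hE.
rewrite ge0_integralD//; last exact: measurable_funTS.
by rewrite integral_cst// [X in (_ * X)%E]leb_cell mule1.
Qed.

Lemma cells_add_cst j (c : \bar R) g : (0 <= c)%E -> cells_add j (fun=> c) g = c.
Proof.
move=> c0; elim: j g => //= j ih g.
rewrite (@addint_affine _ _ _ c (fun=> 0%E))//; last by move=> x _; rewrite ih adde0.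
by rewrite integral0 adde0.
Qed.

Definition linear (f : borelR -> \bar R) g : \bar R := (\int[in_box n g]_x f x)%E.

Lemma linear_add_point (f : borelR -> \bar R) x g : nnm f -> box n x ->
  linear f (add_point x g) = (linear f g + f x)%E.
Proof.
move=> [mf f0] bx; have mB := @measurable_box R n.
transitivity (\int[measure_add (in_box n g) (\d_x : {measure set borelR -> \bar R})]_y f y)%E.
  apply: eq_measure_integral => A mA _.
  transitivity (in_box n g A + \d_x A)%E; last by rewrite [RHS]measure_addE.
  rewrite diracE; transitivity (add_point x g (A `&` box n)) => //.
  rewrite add_pointE; congr (_ + _)%E; rewrite indicE; congr (_%:R%:E); congr nat_of_bool.
  by apply/idP/idP; rewrite !inE => //= -[].
by rewrite ge0_integral_measure_add// integral_dirac// diracT mul1e.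
Qed.

Lemma linear0 (f : borelR -> \bar R) : nnm f -> linear f (config0 R) = 0%E.
Proof.
move=> [mf f0]; apply/eqP; rewrite eq_le integral_ge0// andbT.
rewrite -(integral_measure_zero setT f); apply: ge0_le_measure_integral => //.
Qed.

Lemma linearD (f f' : borelR -> \bar R) g : nnm f -> nnm f' ->
  linear (fun x => f x + f' x)%E g = (linear f g + linear f' g)%E.
Proof. by move=> nf nf'; rewrite /linear nnm_integralD. Qed.

Lemma linear_ge0 f g : nnm f -> (0 <= linear f g)%E.
Proof. by move=> nf; exact: (nnm_linear n nf).2. Qed.

Lemma integral_cellsS j (f : borelR -> \bar R) : nnm f ->
  (\int[leb]_(x in cells j.+1) f x = \int[leb]_(x in cells j) f x + \int[leb]_(x in cell j) f x)%E.
Proof.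
move=> [mf f0]; rewrite cellsS ge0_integral_setU//.
- exact: measurable_cells.
- exact: measurable_cell.
- exact: measurable_funTS.
- exact: disj_cells.
Qed.

Lemma cells_add_linear j f g : (j <= n)%N -> nnm f ->
  cells_add j (linear f) g = (linear f g + \int[leb]_(x in cells j) f x)%E.
Proof.
move=> jn nf; elim: j g jn => [|j ih] g jn.
  by rewrite /= /cells addr0 set_itvoc0 integral_set0 adde0.
have i0 : (0 <= \int[leb]_(x in cells j) f x)%E by apply: integral_ge0 => x _; exact: nf.2.
rewrite /= (@addint_affine _ _ _ (linear f g + \int[leb]_(x in cells j) f x)%E f)//.
- by rewrite -addeA; congr (_ + _)%E; exact/esym/integral_cellsS.
- by rewrite adde_ge0// linear_ge0.
move=> x cx; rewrite ih 1?ltnW// linear_add_point//; last exact: cell_sub_box cx.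
by rewrite addeAC.
Qed.

Definition cellm j : {measure set borelR -> \bar R} := mrestr leb (measurable_cell j).
Definition cellsm j : {measure set borelR -> \bar R} := mrestr leb (measurable_cells j).

Definition pot m (x : borelR) : \bar R := (\int[m]_y (`|x - y| `^ a)%:E)%E.

Lemma nnm_pot m : (m setT < +oo)%E -> nnm (pot m).
Proof.
by move=> mT; apply: (@nnm_finite_integral _ _ _ m
  (fun z : borelR * borelR => (`|z.1 - z.2| `^ a)%:E) mT (nnm_kernel a)).
Qed.

Lemma pairingE m m' : pairing a m m' = (\int[m]_x pot m' x)%E. Proof. by []. Qed.

Lemma cellm_fin j : (cellm j setT < +oo)%E.
Proof.
rewrite (_ : cellm j setT = 1%E) ?ltry//.
by transitivity (leb (setT `&` cell j)) => //; rewrite setTI leb_cell.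
Qed.

Lemma cellsm_fin j : (cellsm j setT < +oo)%E.
Proof.
rewrite (_ : cellsm j setT = leb (cells j)); last first.
  by transitivity (leb (setT `&` cells j)) => //; rewrite setTI.
by rewrite /cells lebesgue_measure_itv/=; case: ifP => _; rewrite ?ltry// -EFinB ltry.
Qed.

Lemma in_box_fin m : (m (box n) < +oo)%E -> (in_box n m setT < +oo)%E.
Proof. by rewrite in_boxT. Qed.

Lemma cellsmS j (f : borelR -> \bar R) : nnm f ->
  (\int[cellsm j.+1]_x f x = \int[cellsm j]_x f x + \int[cellm j]_x f x)%E.
Proof. by move=> nf; rewrite !ge0_integral_mrestr// integral_cellsS. Qed.

Lemma pot_cellsmS j x : pot (cellsm j.+1) x = (pot (cellsm j) x + pot (cellm j) x)%E.
Proof. by rewrite /pot cellsmS//; exact: nnm_kernel1. Qed.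

(** The pairing of Lebesgue measure on the first j cells with itself, without
    the interactions of each cell with itself. *)
Fixpoint cross (j : nat) : \bar R :=
  if j is k.+1 then (cross k + 2%:E * pairing a (cellm k) (cellsm k))%E else 0%E.

Lemma pairing_ge0 m m' : (0 <= pairing a m m')%E.
Proof. by apply: integral_ge0 => x _; apply: integral_ge0 => y _; rewrite lee_fin powR_ge0. Qed.

Lemma cross_ge0 j : (0 <= cross j)%E.
Proof. by elim: j => //= j ih; rewrite adde_ge0// mule_ge0 ?pairing_ge0. Qed.

Definition self g : \bar R := pairing a (in_box n g) (in_box n g).

Lemma self_add_point x g : box n x ->
  self (add_point x g) = (self g + 2%:E * pot (in_box n g) x)%E.
Proof.
move=> bx; have gf := in_box_fin (config_box_ltry n g).
have gf' := in_box_fin (config_box_ltry n (add_point x g)).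
rewrite /self pairingE -/(linear (pot (in_box n (add_point x g))) (add_point x g)).
rewrite (linear_add_point _ (nnm_pot gf') bx).
have pE y : pot (in_box n (add_point x g)) y = (pot (in_box n g) y + (`|y - x| `^ a)%:E)%E.
  exact: (linear_add_point g (nnm_kernel1 a y) bx).
rewrite pE subrr normr0 powR0 ?gt_eqF// adde0.
have -> : linear (pot (in_box n (add_point x g))) g =
    (linear (pot (in_box n g)) g + pot (in_box n g) x)%E.
  rewrite (_ : pot (in_box n (add_point x g)) = fun y => (pot (in_box n g) y + (`|x - y| `^ a)%:E)%E).
    by rewrite linearD//; [exact: nnm_pot|exact: nnm_kernel1].
  by apply/funext => y; rewrite pE distrC.
by rewrite -addeA; congr (_ + _)%E; rewrite mule_natl mule2n.
Qed.

Lemma nnm_self : nnm self.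
Proof. exact: nnm_self_pairing. Qed.

(** The average over a uniform point of a cell replaces the point by Lebesgue
    measure on the cell. The kernel vanishes at 0, so that a point has no
    interaction with itself, and the diagonal terms of the cells are absent. *)
Lemma cells_add_self j g : (j <= n)%N ->
  cells_add j self g = (self g + 2%:E * linear (pot (cellsm j)) g + cross j)%E.
Proof.
elim: j g => [|j ih] g jn.
  rewrite /= adde0 (_ : pot (cellsm 0) = fun=> 0%E).
    by rewrite /linear integral0 mule0 adde0.
  apply/funext => x; rewrite /pot ge0_integral_mrestr; last exact: nnm_kernel1.
  by rewrite /cells addr0 set_itvoc0 integral_set0.
have nj := nnm_pot (cellsm_fin j); have nc := nnm_pot (cellm_fin j).
have gf := in_box_fin (config_box_ltry n g); have ng := nnm_pot gf.
have two (x : \bar R) : (0 <= x)%E -> (0 <= 2%:E * x)%E by move=> x0; rewrite mule_ge0.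
rewrite /= (@addint_affine _ _ _ (self g + 2%:E * linear (pot (cellsm j)) g + cross j)%E
  (fun x => 2%:E * pot (in_box n g) x + 2%:E * pot (cellsm j) x)%E).
- rewrite -(ge0_integral_mrestr leb (measurable_cell j)); last first.
    split; last by move=> x; rewrite adde_ge0 ?two ?ng.2 ?nj.2.
    by apply: emeasurable_funD; apply: emeasurable_funM => //; [exact: ng.1|exact: nj.1].
  rewrite nnm_integralD; last 2 first.
  + split; last by move=> x; rewrite two ?ng.2.
    by apply: emeasurable_funM => //; exact: ng.1.
  + split; last by move=> x; rewrite two ?nj.2.
    by apply: emeasurable_funM => //; exact: nj.1.
  rewrite !nnm_integralZ// -/(cellm j) -!pairingE (pairing_sym a (cellm_fin j) gf).
  rewrite [X in _ = (_ + 2%:E * linear X g + _)%E](_ : _ = fun x => (pot (cellsm j) x + pot (cellm j) x)%E); last first.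
    by apply/funext => x; rewrite pot_cellsmS.
  rewrite (linearD g nj nc) (ge0_muleDr _ (linear_ge0 g nj) (linear_ge0 g nc)).
  rewrite [X in (_ + (2%:E * X + _))%E]pairingE -/(linear (pot (cellm j)) g).
  exact: ereal_sum_shuffle.
- apply: adde_ge0; last exact: cross_ge0.
  by apply: adde_ge0; [exact: nnm_self.2|apply: two; exact: linear_ge0].
- split; last by move=> x; rewrite adde_ge0 ?two ?ng.2 ?nj.2.
  by apply: emeasurable_funD; apply: emeasurable_funM => //; [exact: ng.1|exact: nj.1].
move=> x cx; have bx := cell_sub_box jn cx.
rewrite ih 1?ltnW// self_add_point// (linear_add_point g nj bx).
rewrite (ge0_muleDr 2%:E (linear_ge0 g nj) (nj.2 x)).
exact: ereal_sum_shuffle3.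
Qed.

Lemma pairing_cell j : (pairing a (cellm j) (cellm j) <= 1)%E.
Proof.
rewrite pairingE ge0_integral_mrestr; last exact: nnm_pot (cellm_fin j).
have mc := measurable_cell j.
have p1 x : cell j x -> (pot (cellm j) x <= 1)%E.
  move=> cx; rewrite /pot ge0_integral_mrestr; last exact: nnm_kernel1.
  apply: (@le_trans _ _ (\int[leb]_(y in cell j) 1)%E); last first.
    by rewrite integral_cst// mul1e [leLHS]leb_cell.
  apply: ge0_le_integral => //; first exact: (measurable_funTS (nnm_kernel1 a x).1).
  move=> y cy; rewrite lee_fin; apply: (@le_trans _ _ (1 `^ a)); last by rewrite powR1.
  apply: ge0_ler_powR; rewrite ?nnegrE//.
    exact: ltW.
  move: cx cy; rewrite /cell/= !in_itv/= -natr1 => /andP[h1 h2] /andP[h3 h4].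
  by rewrite ler_norml; apply/andP; split; lra.
apply: (@le_trans _ _ (\int[leb]_(y in cell j) 1)%E); last first.
  by rewrite integral_cst// mul1e [leLHS]leb_cell.
apply: ge0_le_integral => //; [|exact: (measurable_funTS (nnm_pot (cellm_fin j)).1)].
by move=> x _; exact: (nnm_pot (cellm_fin j)).2.
Qed.

(** The distance within a cell is at most 1: each of the j diagonal terms is at
    most 1. *)
Lemma pairing_cells_le j : (pairing a (cellsm j) (cellsm j) <= cross j + j%:R%:E)%E.
Proof.
elim: j => [|j ih].
  rewrite /= add0e pairingE ge0_integral_mrestr; last exact: nnm_pot (cellsm_fin 0).
  by rewrite /cells addr0 set_itvoc0 integral_set0.
have nj := nnm_pot (cellsm_fin j); have nc := nnm_pot (cellm_fin j).
have D m : (\int[m]_x pot (cellsm j.+1) x = \int[m]_x pot (cellsm j) x + \int[m]_x pot (cellm j) x)%E.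
  by rewrite -nnm_integralD//; apply: eq_integral => x _; rewrite pot_cellsmS.
rewrite pairingE cellsmS; last exact: nnm_pot (cellsm_fin j.+1).
rewrite !D -!pairingE (pairing_sym a (cellsm_fin j) (cellm_fin j)) /=.
set p := pairing a (cellm j) (cellsm j).
have -> : (2%:E * p = p + p)%E by rewrite mule_natl mule2n.
rewrite -[j.+1%:R]natr1 EFinD.
rewrite (_ : (cross j + (p + p) + (j%:R%:E + 1) = (cross j + j%:R%:E + p) + (p + 1))%E).
  by apply: leeD; apply: leeD => //; exact: pairing_cell.
exact: ereal_sum_shuffle'.
Qed.

End cells.

(** * The density bound for the Riesz gas *)

Section partition_bound.
Context (R : realType).
Local Notation borelR := (measurableTypeR R).
Local Notation leb := (@lebesgue_measure R).
Implicit Types (g : config R) (h : config R -> \bar R).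

(** Among the ways of adding k + 1 points to the union, keep those with exactly
    one point in B2: there are k + 1 choices for it. *)
Lemma iter_addintU_ge (B1 B2 : set borelR) h k g : measurable B1 -> measurable B2 ->
  [disjoint B1 & B2] -> nnm h ->
  (k.+1%:R%:E * addint B2 (iter k (addint B1) h) g <=
   iter k.+1 (addint (B1 `|` B2)) h g)%E.
Proof.
move=> mB1 mB2 B12 nh; have mU : measurable (B1 `|` B2) by exact: measurableU.
have sub : B1 `<=` B1 `|` B2 by left.
elim: k g => [|k ih] g.
  by rewrite mul1e /= addintU// leeDr//; exact: (nnm_addint mB1 nh).2.
have ni j B : measurable B -> nnm (iter j (addint B) h) by move=> mB; exact: nnm_iter.
rewrite [iter k.+2 _ _]iterS addintU//; last exact: ni.
rewrite -[k.+2%:R]natr1 EFinD ge0_muleDl ?lee_fin// mul1e; apply: leeD; last first.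
  apply: (addint_le mB2 mB2 (@subset_refl _ B2) (ni k.+1 _ mB1) (ni k.+1 _ mU)) => x _.
  exact: (@iter_addint_le R B1 (B1 `|` B2) h h k.+1).
rewrite iterS addintC//; last exact: ni.
rewrite -addintZ//; last by apply: nnm_addint => //; exact: ni.
apply: addint_le => //; last exact: ni.
apply: nnmM; first by apply: nnm_cst; rewrite lee_fin.
by apply: nnm_addint => //; exact: ni.
Qed.

Section fixed_n.
Variable n : nat.

(** There are m! ways of placing m labelled points, one in each cell. *)
Lemma cells_add_fact_le m h g : nnm h ->
  (m`!%:R%:E * cells_add n m h g <= iter m (addint (@cells R n m)) h g)%E.
Proof.
move=> nh; elim: m g => [|m ih] g; first by rewrite fact0 mul1e.
have mc := @measurable_cell R n m; have mcs := @measurable_cells R n m.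
have H := iter_addintU_ge m g mcs mc (@disj_cells R n m) nh.
rewrite cellsS; apply: le_trans H.
rewrite factS natrM EFinM -muleA; apply: lee_wpmul2l; first by rewrite lee_fin.
have nc := nnm_cells_add n m nh.
rewrite /= -addintZ//; apply: addint_le => //.
- by apply: nnmM => //; apply: nnm_cst; rewrite lee_fin.
- exact: nnm_iter.
Qed.

Lemma cells_addZ m (c : R) h g : 0 <= c -> nnm h ->
  (cells_add n m (fun g => c%:E * h g) g = c%:E * cells_add n m h g)%E.
Proof.
move=> c0 nh; elim: m g => // m ih g /=.
rewrite -addintZ//; [|exact: measurable_cell|exact: nnm_cells_add].
by apply: eq_integral => x _; rewrite ih.
Qed.

Lemma binomial_count (n0 : (0 < n)%N) :
  binomial_process R n0 [set xi | xi (box n) != n%:R%:E] = 0%E.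
Proof.
have mB := @measurable_box R n.
pose A := [set xi : config R | xi (box n) != n%:R%:E].
have mA : measurable A by exact: measurable_count_neq.
have nA := @nnm_indic R _ _ _ mA.
transitivity (\int[binomial_process R n0]_xi (\1_A xi)%:E)%E.
  by rewrite integral_indic// setIT.
rewrite (integral_binomial_process n0 nA).
have h m xi : iter m (addint (box n)) (fun xi => (\1_A xi)%:E : \bar R) xi =
    ((n%:R ^+ m) * (xi (box n) + m%:R%:E != n%:R%:E)%E%:R)%:E.
  elim: m xi => [|m ih] xi.
    rewrite expr0 mul1r adde0 /= indicE; congr (_%:R%:E); congr nat_of_bool.
    by apply/idP/idP; rewrite inE.
  rewrite iterS /addint.
  rewrite (eq_integral (fun=> (n%:R ^+ m * (xi (box n) + m.+1%:R%:E != n%:R%:E)%E%:R)%:E)); last first.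
    move=> x; rewrite inE => bx; rewrite ih add_pointE indicE mem_set//.
    by rewrite -[m.+1%:R]natr1 EFinD (addeC m%:R%:E) addeA.
  by rewrite integral_cst_box exprSr; congr (_%:E); ring.
by rewrite h add0e eqxx mulr0 mule0.
Qed.

Variables (s beta : R).
Hypotheses (s_gt : -2 < s) (s_lt : s < 0) (beta0 : 0 < beta).

Let a := - s.
Let a0 : 0 < a. Proof. by rewrite /a oppr_gt0. Qed.
Let a2 : a < 2. Proof. by rewrite /a ltrNl. Qed.

Let w (g : config R) : \bar R := (gibbs_weight s beta n g)%:E.

Let nw : nnm w.
Proof.
apply: nnm_expR; apply: measurable_funM => //.
exact: (@measurable_riesz_energy R a n a0 s erefl).
Qed.

Lemma gibbs_weight_le1 (n0 : (0 < n)%N) : {ae binomial_process R n0, forall g, (w g <= 1)%E}.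
Proof.
exists [set xi : config R | xi (box n) != n%:R%:E]; split.
- by apply: measurable_count_neq; exact: measurable_box.
- exact: binomial_count.
move=> g /= wg; apply/eqP => gn; apply: wg.
rewrite lee_fin /gibbs_weight -expR0 ler_expR mulNr oppr_le0 mulr_ge0//; first exact: ltW.
exact: (@riesz_energy_ge0 R a n a0 s g erefl a2 gn).
Qed.

Let K := pairing a (in_box n leb) (in_box n leb).

Lemma integral_in_box_cells (f : borelR -> \bar R) : nnm f ->
  (\int[in_box n leb]_x f x = \int[leb]_(x in @cells R n n) f x)%E.
Proof.
move=> [mf f0]; rewrite /in_box ge0_integral_mrestr// /cells /box.
rewrite integral_itv_obnd_cbnd; last exact: measurable_funTS.
by have -> : - (n%:R / 2) + n%:R = n%:R / 2 :> R by lra.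
Qed.

Let K_fin : K \is a fin_num.
Proof. by apply: pairing_fin => //; exact: leb_box_ltry. Qed.

Let leb_pot : nnm (pot a (in_box n leb)).
Proof. by apply: nnm_pot; rewrite in_boxT; exact: leb_box_ltry. Qed.

Let K_cells : (K <= cross a n n + n%:R%:E)%E.
Proof.
apply: le_trans (pairing_cells_le n a0 n).
rewrite /K !pairingE integral_in_box_cells// ge0_integral_mrestr; last first.
  by apply: nnm_pot; exact: cellsm_fin.
rewrite le_eqVlt; apply/orP; left; apply/eqP; apply: eq_integral => x _.
rewrite /pot integral_in_box_cells; last exact: nnm_kernel1.
by rewrite ge0_integral_mrestr//; exact: nnm_kernel1.
Qed.

Let E := expR (- beta * (n%:R / 2)).

(** The tangent line of H |-> e^(- beta H) at H = n / 2, with the terms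
    arranged so that both sides are nonnegative. *)
Lemma tangent_bound g :
  ((E * (1 + beta * (n%:R / 2)) + E * beta / 2 * fine K)%:E + (E * beta / 2)%:E * self a n g <=
   w g + (E * beta)%:E * linear n (pot a (in_box n leb)) g)%E.
Proof.
have gf := config_box_ltry n g; have lf := leb_box_ltry R n.
have -> : linear n (pot a (in_box n leb)) g = pairing a (in_box n g) (in_box n leb) by [].
rewrite /self -(fineK (pairing_fin a0 gf lf)) -(fineK (pairing_fin a0 gf gf)).
rewrite -!EFinM -!EFinD lee_fin /gibbs_weight (@riesz_energyE R a n a0 s g erefl) -/K.
set L := fine (pairing a (in_box n g) (in_box n leb)).
set W := fine (pairing a (in_box n g) (in_box n g)).
have E0 : 0 <= E by exact: expR_ge0.
have := expR_ge1Dx (- beta * (L - 2^-1 * (W + fine K)) + beta * (n%:R / 2)).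
rewrite expRD => h.
have EE : E * expR (beta * (n%:R / 2)) = 1 by rewrite /E -expRD mulNr addNr expR0.
have := ler_wpM2l E0 h; rewrite (mulrCA E _ (expR (beta * _))) EE mulr1.
by lra.
Qed.

(** Jensen's inequality. For one uniform point in each cell, the mean energy is
    (K - cross) / 2 <= n / 2: the average of the tangent line at n / 2 is at least
    its value E there. *)
Lemma cells_add_weight_ge : (E%:E <= cells_add n n w (config0 R))%E.
Proof.
have E0 : 0 <= E by exact: expR_ge0.
have Eb : 0 <= E * beta by rewrite mulr_ge0// ltW.
have Eb2 : 0 <= E * beta / 2 by rewrite divr_ge0.
have k0 : 0 <= fine K by apply: fine_ge0; exact: pairing_ge0.
have c0 : (0 <= (E * (1 + beta * (n%:R / 2)) + E * beta / 2 * fine K)%:E)%E.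
  rewrite lee_fin; apply: addr_ge0; apply: mulr_ge0 => //.
  by apply: addr_ge0 => //; apply: mulr_ge0; [exact: ltW|exact: divr_ge0].
have nc := @nnm_cst R _ (config R) _ c0.
have ns := nnm_self a n : nnm (self a n).
have nl := nnm_linear n leb_pot.
have nZ c h : 0 <= c -> nnm h -> nnm (fun g => c%:E * h g)%E.
  by move=> c0' nh; apply: nnmM => //; apply: nnm_cst; rewrite lee_fin.
have := @cells_add_le R n n _ _ (config0 R) (nnmD nc (nZ _ _ Eb2 ns)) (nnmD nw (nZ _ _ Eb nl))
  tangent_bound.
rewrite !cells_addD ?cells_addZ//; try exact: nZ.
rewrite cells_add_cst// cells_add_self// cells_add_linear//.
rewrite !linear0//; last by apply: nnm_pot; exact: cellsm_fin.
rewrite add0e mule0 adde0.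
have -> : self a n (config0 R) = 0%E.
  exact: (linear0 n (nnm_pot a (in_box_fin (config_box_ltry n (config0 R))))).
rewrite add0e -integral_in_box_cells// -/(pairing a (in_box n leb) (in_box n leb)) -/K.
have -> : K = (fine K)%:E by rewrite fineK.
move: K_cells; rewrite -(fineK K_fin).
set k := fine K; set X := cells_add n n w (config0 R); case: (cross a n n) => [c| |].
- rewrite -EFinD lee_fin => kc; rewrite -!EFinM -EFinD /=.
  case: X => [x| |]; [|by move=> _; rewrite leey|by []].
  rewrite -EFinD !lee_fin => h.
  have : E * beta / 2 * k <= E * beta / 2 * (c + n%:R) by apply: ler_wpM2l.
  by lra.
- move=> _; rewrite -EFinM /=; case: X => [x| |]; [|by move=> _; rewrite leey|].
    have Ep : 0 < E * beta / 2 by rewrite divr_gt0// mulr_gt0// expR_gt0.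
    by rewrite gt0_muley ?lte_fin// addey.
  have Ep : 0 < E * beta / 2 by rewrite divr_gt0// mulr_gt0// expR_gt0.
  by rewrite gt0_muley ?lte_fin// addey.
- by [].
Qed.

Lemma factorial_expR_le : expR (- n%:R) <= n%:R^-1 ^+ n * n`!%:R :> R.
Proof.
have := @exp_partial_sum_le R n%:R n.+1 (ler0n _ _).
rewrite big_ord_recr/= => h.
have f0 : 0 < n`!%:R :> R by rewrite ltr0n fact_gt0.
have [->|n0] := eqVneq n 0%N; first by rewrite expr0 fact0 mul1r oppr0 expR0.
have n1 : 0 < n%:R ^+ n :> R by rewrite exprn_gt0// ltr0n lt0n.
rewrite expRN exprVn -[n`!%:R]invrK -invfM lef_pV2 ?posrE ?expR_gt0 ?mulr_gt0 ?invr_gt0//.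
rewrite mulrC; apply: le_trans h; rewrite lerDr; apply: sumr_ge0 => i _.
by rewrite mulr_ge0// exprn_ge0.
Qed.

(** Combines [cells_add_fact_le] and [cells_add_weight_ge] with
    n! >= n^n e^(-n). *)
Lemma partition_function_ge (n0 : (0 < n)%N) :
  expR (- (1 + beta / 2) * n%:R) <= partition_function s beta n0.
Proof.
rewrite -lee_fin /partition_function /Rintegral.
have le1 : (\int[binomial_process R n0]_g w g <= 1)%E.
  apply: (@le_trans _ _ (\int[binomial_process R n0]_g 1)%E).
    apply: ae_ge0_le_integral => //.
    + by move=> g _; exact: nw.2.
    + exact: nw.1.
    by move: (gibbs_weight_le1 n0); apply: filterS => g h _.
  by rewrite integral_cst//= mul1e probability_setT.
rewrite fineK; last first.
  rewrite ge0_fin_numE; first exact: le_lt_trans le1 (ltry 1).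
  by apply: integral_ge0 => g _; exact: nw.2.
rewrite -/w (integral_binomial_process n0 nw).
have mB := @measurable_box R n; have mc := @measurable_cells R n n.
apply: (@le_trans _ _ ((n%:R^-1 ^+ n)%:E * (n`!%:R%:E * E%:E))%E).
  rewrite muleA -!EFinM lee_fin.
  have -> : - (1 + beta / 2) * n%:R = - n%:R + - beta * (n%:R / 2) by field.
  by rewrite expRD ler_wpM2r ?expR_ge0// factorial_expR_le.
apply: lee_wpmul2l; first by rewrite lee_fin exprn_ge0// invr_ge0.
apply: (@le_trans _ _ (n`!%:R%:E * cells_add n n w (config0 R))%E).
  by apply: lee_wpmul2l; [rewrite lee_fin|exact: cells_add_weight_ge].
apply: (le_trans (cells_add_fact_le n (config0 R) nw)).
apply: iter_addint_le => //.
move=> x; rewrite /cells /box/= !in_itv/= => /andP[h1 h2].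
by apply/andP; split; lra.
Qed.

(** The weight is at most 1 almost surely, and the partition function is at
    least e^(- (1 + beta / 2) n). *)
Theorem riesz_gas_le (n0 : (0 < n)%N) (A : set (config R)) : measurable A ->
  (riesz_gas s beta n0 A <=
   (expR ((1 + beta / 2) * n%:R))%:E * binomial_process R n0 A)%E.
Proof.
move=> mA; rewrite /riesz_gas.
have Z0 := partition_function_ge n0.
have le1 : (\int[binomial_process R n0]_(g in A) w g <= binomial_process R n0 A)%E.
  apply: (@le_trans _ _ (\int[binomial_process R n0]_(g in A) 1)%E); last first.
    by rewrite integral_cst// mul1e.
  apply: ae_ge0_le_integral => //.
  - by move=> g _; exact: nw.2.
  - exact: (measurable_funTS nw.1).
  by move: (gibbs_weight_le1 n0); apply: filterS => g h _.
have If : (\int[binomial_process R n0]_(g in A) w g)%E \is a fin_num.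
  rewrite ge0_fin_numE; last by apply: integral_ge0 => g _; exact: nw.2.
  by apply: (le_lt_trans le1); rewrite (le_lt_trans (probability_le1 _ mA))// ltry.
rewrite mulrC EFinM /Rintegral fineK//.
apply: lee_pmul => //.
- by rewrite lee_fin invr_ge0; apply: le_trans Z0; exact: expR_ge0.
- by apply: integral_ge0 => g _; exact: nw.2.
rewrite lee_fin -[leRHS]invrK lef_pV2 ?posrE ?invr_gt0 ?expR_gt0//; last first.
  by apply: lt_le_trans Z0; exact: expR_gt0.
by rewrite -expRN -mulNr.
Qed.

End fixed_n.
End partition_bound.

Theorem theorem2p7 (R : realType) (s beta : R) (s_gtN2 : -2 < s) (s_lt0 : s < 0)
    (beta_gt0 : 0 < beta) (Pstat : nat -> probability (config R) R)
    (PstatE : forall (n : nat) (n0 : (0 < n)%N),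
      is_stationarization (box_lt R n0) (riesz_gas s beta n0) (Pstat n)) :
  exists (phi : nat -> nat) (P : probability (config R) R),
    [/\ {homo phi : i j / (i < j)%N}, (0 < phi 0)%N, stationary P
      & cvg_local (fun k => Pstat (phi k)) P].
Proof.
have C0 : 0 <= 1 + beta / 2 by rewrite addr_ge0// divr_ge0// ltW.
apply: (accumulation_of_stationarizations C0 _ PstatE) => n n0 A mA.
exact: riesz_gas_le.
Qed.
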